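(* Let $R$ be an algebra and let $A$ be an Azumaya algebra with center $C$, where $C$ is a finitely presented commutative $\mathbb{C}$-algebra. Consider the sheaf $\mathrm{Rep}_R$ on $\mathrm{Azufine}_{\mathbb{C}}$ given by $B\mapsto\mathrm{Alg}_{\mathbb{C}}(R,B)$. Its image along the composition of functors $$\mathrm{Sh}(\mathrm{Azufine}_{\mathbb{C}})\to\mathrm{Sh}(\mathrm{Azufine}_A)\to\mathrm{Sh}(\mathrm{Azufine}_C)\to\mathrm{Sh}(\mathrm{affine}_C),$$ in which the middle functor is $F\mapsto F(A\otimes_C-)$ and the other two are given by restriction, is the contravariant functor $$\mathrm{Rep}_A(R):\ \mathrm{affine}_C\to\mathrm{Sets},\qquad Z\mapsto\mathrm{Alg}_{\mathbb{C}}\bigl(R,\,A\otimes_C\mathcal{O}(Z)\bigr).$$ Therefore $\mathrm{Rep}_A(R)$ is a sheaf for the flat topology on $\mathrm{affine}_C$, and consequently also for the étale and the Zariski topology.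
   Context: All algebras are associative, unital, finitely generated $\mathbb{C}$-algebras; $\mathrm{Alg}_{\mathbb{C}}(-,-)$ is the set of $\mathbb{C}$-algebra morphisms. An Azumaya algebra $A$ over a commutative ring $C$ is a $C$-algebra that is a faithful finitely generated projective $C$-module such that $A\otimes_C A^{op}\to \mathrm{End}_C(A)$, $a\otimes b\mapsto (r\mapsto arb)$, is an isomorphism; then the center $Z(A)$ is $C$. It is of constant degree $n$ if it has constant rank $n^2$ over $C$. $\mathrm{Azumaya}_{\mathbb{C}}$ is the category of all Azumaya algebras whose center is a finitely presented commutative $\mathbb{C}$-algebra, with center-preserving $\mathbb{C}$-algebra morphisms ($f(Z(A))\subseteq Z(A')$); $\mathrm{Azufine}_{\mathbb{C}}$ is its opposite. For an object $A$, $\mathrm{Azumaya}_A$ is the comma category of objects $B$ equipped with a morphism $A\to B$ in $\mathrm{Azumaya}_{\mathbb{C}}$, with morphisms $B\to B'$ commuting with the structure maps from $A$; $\mathrm{Azufine}_A$ is its opposite (and likewise $\mathrm{Azufine}_C$ for the commutative algebra $C$ viewed as an object of $\mathrm{Azumaya}_{\mathbb{C}}$). $\mathrm{affine}_C$ is the category of affine $C$-schemes of finite presentation, i.e. the opposite of the category of finitely presented commutative $C$-algebras. The flat topology on finitely presented commutative algebras is generated by the covers $\{D\to D_i\}_{i\in I}$ with $I$ finite and $D\to\prod_i D_i$ faithfully flat. The étale topology is generated by the covers $\{D\to D[d_i^{-1}]\to D_i\}_{i\in I}$ with $\sum_i d_iD=D$ and $\mathrm{Spec}(D_i)\to\mathrm{Spec}(D[d_i^{-1}])$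 étale surjections; the Zariski topology by the covers $\{D\to D[d_i^{-1}]\}_{i\in I}$ with $\sum_i d_iD=D$. Sheaves on $\mathrm{Azufine}_{\mathbb{C}}$ are taken with respect to the maximal flat topology, sheaves on $\mathrm{Azufine}_A$ and $\mathrm{Azufine}_C$ with respect to its restriction to the comma categories, and sheaves on $\mathrm{affine}_C$ with respect to the flat topology. The maximal flat topology is described dually: a sieve $L$ on an Azumaya algebra $B$ with center $Z(B)=E$ (a collection of morphisms with source $B$ closed under post-composition) is covering iff the following set is a covering sieve for the flat topology on $E$: all morphisms $f:E\to D$ of finitely presented commutative $\mathbb{C}$-algebras such that $B\otimes_E D$ is of constant degree and $L$ contains at least one morphism $B\to B\otimes_E D\to B'$, where the first map is canonical and the second is a $D$-algebra morphism to an Azumaya algebra $B'$ with center $D$ and of constant degree. *)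

(* Defs.v *)
From HB Require Import structures.
From mathcomp Require Export all_boot all_order all_algebra.
From mathcomp Require Import boolp classical_sets cardinality.
From mathcomp Require Export reals complex.

Set Implicit Arguments.
Unset Strict Implicit.
Unset Printing Implicit Defensive.

Import GRing.Theory.
Local Open Scope ring_scope.
Local Open Scope quotient_scope.

(* MathComp's algType only covers nonzero rings. The zero algebra has to be   *)
(* allowed here (a base change of A can vanish, and the empty family covers   *)
(* the zero ring), so a K-algebra is a possibly zero ring with a central      *)
(* structure morphism.                                                        *)
Record alg (K : comPzRingType) := Alg {
  alg_ring :> pzRingType;
  alg_str : {rmorphism K -> alg_ring};
  alg_central : forall k x, GRing.comm (alg_str k) x
}.

Record alg_hom (K : comPzRingType) (A B : alg K) := AlgHom {
  alg_fun :> {rmorphism A -> B};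
  alg_fun_str : forall k, alg_fun (alg_str A k) = alg_str B k
}.

Lemma rmorph_ext (R S : pzRingType) (f g : {rmorphism R -> S}) :
  f =1 g -> f = g.
Proof.
case: f => f [[f1] [f2]]; case: g => g [[g1] [g2]] /= E.
have {}E : f = g by apply/funext.
subst g.
by rewrite (Prop_irrelevance f1 g1) (Prop_irrelevance f2 g2).
Qed.

Lemma alg_hom_ext K (A B : alg K) (f g : alg_hom A B) : f =1 g -> f = g.
Proof.
case: f => f pf; case: g => g pg /= /rmorph_ext E; subst g.
by rewrite (Prop_irrelevance pf pg).
Qed.

Definition alg_id K (A : alg K) : alg_hom A A :=
  @AlgHom K A A [the {rmorphism A -> A} of idfun] (fun=> erefl).

Lemma alg_comp_str K (A B D : alg K) (g : alg_hom B D) (f : alg_hom A B) k :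
  (g \o f) (alg_str A k) = alg_str D k.
Proof. by rewrite /= !alg_fun_str. Qed.

Definition alg_comp K (A B D : alg K) (g : alg_hom B D) (f : alg_hom A B) :
    alg_hom A D :=
  @AlgHom K A D [the {rmorphism A -> D} of g \o f] (alg_comp_str g f).

Definition finitely_generated (K : comPzRingType) (A : alg K) : Prop :=
  exists s : seq A, forall S : A -> Prop,
    (forall k, S (alg_str A k)) ->
    (forall x y, S x -> S y -> S (x + y)) ->
    (forall x y, S x -> S y -> S (x * y)) ->
    (forall x, x \in s -> S x) ->
    forall x, S x.

Lemma self_central (K : comPzRingType) (k x : K) : GRing.comm (idfun k) x.
Proof. exact: mulrC. Qed.

Definition self_alg (K : comPzRingType) : alg K :=
  @Alg K K [the {rmorphism K -> K} of idfun] (@self_central K).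

Lemma comm_alg_central (K D : comPzRingType) (f : {rmorphism K -> D}) k x :
  GRing.comm (f k) x.
Proof. exact: mulrC. Qed.

Definition comm_alg (K D : comPzRingType) (f : {rmorphism K -> D}) : alg K :=
  @Alg K D f (comm_alg_central f).

Lemma res_central (K E : comPzRingType) (f : {rmorphism K -> E}) (A : alg E)
  k (x : A) : GRing.comm ((alg_str A \o f) k) x.
Proof. exact: alg_central. Qed.

Definition res_alg (K E : comPzRingType) (f : {rmorphism K -> E}) (A : alg E) :
    alg K :=
  @Alg K A [the {rmorphism K -> A} of alg_str A \o f] (@res_central K E f A).

Section Opposite.
Variables (K : comPzRingType) (A : alg K).

Definition op_str (k : K) : A^c := alg_str A k.

Fact op_str_zmod : zmod_morphism op_str.
Proof. by move=> x y; rewrite /op_str rmorphB. Qed.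

Fact op_str_monoid : monoid_morphism op_str.
Proof. by split=> [|x y]; rewrite /op_str ?rmorph1 // mulrC rmorphM. Qed.

HB.instance Definition _ := GRing.isZmodMorphism.Build K A^c op_str op_str_zmod.
HB.instance Definition _ :=
  GRing.isMonoidMorphism.Build K A^c op_str op_str_monoid.

Fact op_central k (x : A^c) : GRing.comm (op_str k) x.
Proof. exact/esym/(alg_central k (x : A)). Qed.

Definition op_alg : alg K := @Alg K A^c [the {rmorphism K -> A^c} of op_str]
  op_central.
End Opposite.

(* The carrier of A, seen as a K-module through its structure morphism.       *)
Definition as_mod (K : comPzRingType) (A : alg K) : Type := A.

Section AsMod.
Variables (K : comPzRingType) (A : alg K).
Definition as_mod_scale (k : K) (x : A) : A := alg_str A k * x.
HB.instance Definition _ := GRing.Zmodule.on (as_mod A).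

Fact as_mod_scaleA a b (v : as_mod A) :
  as_mod_scale a (as_mod_scale b v) = as_mod_scale (a * b) v.
Proof. by rewrite /as_mod_scale rmorphM mulrA. Qed.
Fact as_mod_scale1 : left_id 1 (as_mod_scale : K -> as_mod A -> as_mod A).
Proof. by move=> v; rewrite /as_mod_scale rmorph1 mul1r. Qed.
Fact as_mod_scaleDr :
  right_distributive (as_mod_scale : K -> as_mod A -> as_mod A) +%R.
Proof. by move=> k u v; rewrite /as_mod_scale mulrDr. Qed.
Fact as_mod_scaleDl (v : as_mod A) : {morph as_mod_scale^~ v : a b / a + b}.
Proof. by move=> a b; rewrite /as_mod_scale rmorphD mulrDl. Qed.
HB.instance Definition _ := GRing.Zmodule_isLmodule.Build K (as_mod A)
  as_mod_scaleA as_mod_scale1 as_mod_scaleDr as_mod_scaleDl.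

Lemma as_mod_scaleE k (x : as_mod A) : k *: x = alg_str A k * (x : A) :> A.
Proof. by []. Qed.
End AsMod.

Record balanced (K : comPzRingType) (M N : lmodType K) (V : zmodType)
    (b : M -> N -> V) : Prop := Balanced {
  balancedDl : forall m m' n, b (m + m') n = b m n + b m' n;
  balancedDr : forall m n n', b m (n + n') = b m n + b m n';
  balancedZ : forall k m n, b (k *: m) n = b m (k *: n)
}.

Section Tensor.
Variables (K : comPzRingType) (M N : lmodType K).

(* A list [:: (m1, n1); ...] stands for the formal sum of the mi (x) ni; two  *)
(* formal sums are identified when every balanced biadditive map takes the    *)
(* same value on them, so that tlift below is the universal property.         *)
Definition tsum (V : zmodType) (b : M -> N -> V) (s : seq (M * N)) : V :=
  \sum_(p <- s) b p.1 p.2.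

Definition tensor_rel (s t : seq (M * N)) : bool :=
  `[< forall (V : zmodType) (b : M -> N -> V),
        balanced b -> tsum b s = tsum b t >].

Fact tensor_rel_refl : reflexive tensor_rel.
Proof. by move=> s; apply/asboolP. Qed.
Fact tensor_rel_sym : symmetric tensor_rel.
Proof.
by move=> s t; apply/asboolP/asboolP => h V b hb; rewrite (h V b hb).
Qed.
Fact tensor_rel_trans : transitive tensor_rel.
Proof.
move=> t s u /asboolP h1 /asboolP h2; apply/asboolP => V b hb.
by rewrite (h1 V b hb) (h2 V b hb).
Qed.

Canonical tensor_equiv :=
  EquivRel tensor_rel tensor_rel_refl tensor_rel_sym tensor_rel_trans.

Definition tensor : Type := {eq_quot tensor_equiv}.
HB.instance Definition _ := Choice.on tensor.

Definition tclass (s : seq (M * N)) : tensor := \pi_({eq_quot tensor_equiv}) s.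
Definition tens (m : M) (n : N) : tensor := tclass [:: (m, n)].

Definition trepr (t : tensor) : seq (M * N) :=
  repr (t : {eq_quot tensor_equiv}).

Definition tlift (V : zmodType) (b : M -> N -> V) (t : tensor) : V :=
  tsum b (trepr t).

Lemma tclassP s t : (forall (V : zmodType) (b : M -> N -> V),
  balanced b -> tsum b s = tsum b t) -> tclass s = tclass t.
Proof. by move=> h; apply/eqmodP/asboolP. Qed.

Lemma treprK : cancel trepr tclass.
Proof. by move=> t; rewrite /tclass /trepr reprK. Qed.

Lemma tlift_class (V : zmodType) (b : M -> N -> V) :
  balanced b -> forall s, tlift b (tclass s) = tsum b s.
Proof.
move=> hb s; have /eqmodP/asboolP h := treprK (tclass s).
exact: h.
Qed.

Lemma tsum_cat (V : zmodType) (b : M -> N -> V) s t :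
  tsum b (s ++ t) = tsum b s + tsum b t.
Proof. by rewrite /tsum big_cat. Qed.

Lemma tsum_opp (V : zmodType) (b : M -> N -> V) s : balanced b ->
  tsum b [seq (- p.1, p.2) | p <- s] = - tsum b s.
Proof.
move=> hb; have bN m n : b (- m) n = - b m n.
  apply/eqP; rewrite -addr_eq0 -(balancedDl hb) addNr.
  by apply/eqP/(addrI (b 0 n)); rewrite -(balancedDl hb) !addr0.
by rewrite /tsum big_map -sumrN; apply: eq_bigr => p _; rewrite bN.
Qed.

Definition tzero : tensor := tclass [::].
Definition tadd (x y : tensor) : tensor := tclass (trepr x ++ trepr y).
Definition topp (x : tensor) : tensor :=
  tclass [seq (- p.1, p.2) | p <- trepr x].

Lemma tadd_class s t : tadd (tclass s) (tclass t) = tclass (s ++ t).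
Proof.
apply: tclassP => V b hb.
by rewrite !tsum_cat -!/(tlift b _) !(tlift_class hb).
Qed.

Fact taddA : associative tadd.
Proof.
move=> x y z; rewrite -(treprK x) -(treprK y) -(treprK z).
by rewrite !tadd_class catA.
Qed.
Fact taddC : commutative tadd.
Proof.
move=> x y; apply: tclassP => V b hb.
by rewrite !tsum_cat addrC.
Qed.
Fact tadd0 : left_id tzero tadd.
Proof. by move=> x; rewrite -(treprK x) /tzero tadd_class. Qed.
Fact taddN : left_inverse tzero topp tadd.
Proof.
move=> x; rewrite -{2}(treprK x) tadd_class; apply: tclassP => V b hb.
by rewrite tsum_cat tsum_opp // addNr /tsum big_nil.
Qed.

HB.instance Definition _ := GRing.isZmodule.Build tensor taddA taddC tadd0 taddN.

Lemma tclassD s t : tclass (s ++ t) = tclass s + tclass t.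
Proof. by rewrite -tadd_class. Qed.

Lemma tclassE s : tclass s = \sum_(p <- s) tens p.1 p.2.
Proof.
elim: s => [|[m n] s IH]; first by rewrite big_nil.
by rewrite big_cons -IH -tclassD.
Qed.

Lemma tensor_ind (P : tensor -> Prop) :
  P 0 -> (forall m n, P (tens m n)) -> (forall x y, P x -> P y -> P (x + y)) ->
  forall x, P x.
Proof.
move=> P0 Pt PD x; rewrite -(treprK x) tclassE.
by elim: (trepr x) => [|p s IH]; rewrite ?big_nil // big_cons; apply: PD.
Qed.

Lemma tens_balanced : balanced tens.
Proof.
split=> [m m' n|m n n'|k m n]; rewrite /tens -?tclassD; apply: tclassP => V b hb;
  rewrite /tsum !big_cons !big_nil /= ?addr0.
- exact: balancedDl.
- exact: balancedDr.
- exact: balancedZ.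
Qed.

Section Lift.
Variables (V : zmodType) (b : M -> N -> V) (hb : balanced b).

Lemma tlift_tens m n : tlift b (tens m n) = b m n.
Proof. by rewrite tlift_class // /tsum big_seq1. Qed.

Lemma tliftD : {morph tlift b : x y / x + y}.
Proof.
move=> x y; rewrite -(treprK x) -(treprK y) -tclassD.
by rewrite !tlift_class // tsum_cat.
Qed.

Lemma tlift0 : tlift b 0 = 0.
Proof. by apply: (addrI (tlift b 0)); rewrite -tliftD !addr0. Qed.
End Lift.
End Tensor.

Section TensorMap.
Variables (K : comPzRingType) (M M' N N' : lmodType K).
Variables (f : {linear M -> M'}) (g : {linear N -> N'}).

Definition tmap : tensor M N -> tensor M' N' :=
  tlift (fun m n => tens (f m) (g n)).

Lemma tmap_balanced : balanced (fun m n => tens (f m) (g n)).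
Proof.
have [tl tr tz] := @tens_balanced K M' N'.
by split=> *; rewrite ?linearD ?linearZ ?tl ?tr ?tz.
Qed.

Lemma tmap_tens m n : tmap (tens m n) = tens (f m) (g n).
Proof. exact/tlift_tens/tmap_balanced. Qed.

Lemma tmapD : {morph tmap : x y / x + y}.
Proof. exact/tliftD/tmap_balanced. Qed.
End TensorMap.

Definition tring (K : comPzRingType) (A B : alg K) : Type :=
  tensor (as_mod A) (as_mod B).

Section TensorRing.
Variables (K : comPzRingType) (A B : alg K).
Local Notation T := (tensor (as_mod A) (as_mod B)).
HB.instance Definition _ := GRing.Zmodule.on (tring A B).

Definition tten (a : A) (b : B) : tring A B :=
  @tens K (as_mod A) (as_mod B) a b.

Lemma ttenDl a a' b : tten (a + a') b = tten a b + tten a' b.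
Proof. exact: (balancedDl (@tens_balanced K (as_mod A) (as_mod B))). Qed.
Lemma ttenDr a b b' : tten a (b + b') = tten a b + tten a b'.
Proof. exact: (balancedDr (@tens_balanced K (as_mod A) (as_mod B))). Qed.
Lemma ttenZ k a b : tten (alg_str A k * a) b = tten a (alg_str B k * b).
Proof. exact: (balancedZ (@tens_balanced K (as_mod A) (as_mod B))). Qed.

Lemma tring_ind (P : tring A B -> Prop) :
  P 0 -> (forall a b, P (tten a b)) -> (forall x y, P x -> P y -> P (x + y)) ->
  forall x, P x.
Proof. exact (@tensor_ind K (as_mod A) (as_mod B) P). Qed.

Definition tmul1 (a : A) (b : B) : tring A B -> tring A B :=
  @tlift K (as_mod A) (as_mod B) (tring A B) (fun a' b' => tten (a * (a' : A)) (b * (b' : B))).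

Lemma tmul1_balanced (a : A) (b : B) :
  @balanced K (as_mod A) (as_mod B) (tring A B)
    (fun a' b' => tten (a * (a' : A)) (b * (b' : B))).
Proof.
split=> [x y n|m x y|k m n].
- by rewrite mulrDr ttenDl.
- by rewrite mulrDr ttenDr.
- rewrite !as_mod_scaleE mulrA -(alg_central k a) -mulrA ttenZ.
  by rewrite mulrA (alg_central k b) -mulrA.
Qed.

Lemma tmul1_tens a b a' b' : tmul1 a b (tten a' b') = tten (a * a') (b * b').
Proof. exact: (tlift_tens (tmul1_balanced a b) _ _). Qed.
Lemma tmul1D a b : {morph tmul1 a b : x y / x + y}.
Proof. exact: (tliftD (tmul1_balanced a b)). Qed.
Lemma tmul10 a b : tmul1 a b 0 = 0.
Proof. exact: (tlift0 (tmul1_balanced a b)). Qed.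

Definition tmul (x y : tring A B) : tring A B :=
  @tlift K (as_mod A) (as_mod B) (tring A B) (fun a b => tmul1 a b y) x.

Lemma tmul_balanced y :
  @balanced K (as_mod A) (as_mod B) (tring A B) (fun a b => tmul1 a b y).
Proof.
elim/tring_ind: y => [|a' b'|x y [l1 r1 z1] [l2 r2 z2]].
- by split=> *; rewrite !tmul10 ?addr0.
- split=> *; rewrite !tmul1_tens.
  + by rewrite mulrDl ttenDl.
  + by rewrite mulrDl ttenDr.
  + by rewrite !as_mod_scaleE -!mulrA ttenZ.
- split=> *; rewrite !tmul1D.
  + by rewrite l1 l2 addrACA.
  + by rewrite r1 r2 addrACA.
  + by rewrite z1 z2.
Qed.

Lemma tmul_tens a b y : tmul (tten a b) y = tmul1 a b y.
Proof. exact: (tlift_tens (tmul_balanced y) _ _). Qed.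

Lemma tmulE a b a' b' : tmul (tten a b) (tten a' b') = tten (a * a') (b * b').
Proof. by rewrite tmul_tens tmul1_tens. Qed.

Fact tmulDl : left_distributive tmul +%R.
Proof. by move=> x y z; exact: (tliftD (tmul_balanced z) x y). Qed.

Lemma tmul0l y : tmul 0 y = 0.
Proof. exact: (tlift0 (tmul_balanced y)). Qed.

Lemma tmul0r x : tmul x 0 = 0.
Proof.
elim/tring_ind: x => [|a b|x y hx hy]; first exact: tmul0l.
  by rewrite tmul_tens tmul10.
by rewrite tmulDl hx hy addr0.
Qed.

Fact tmulDr : right_distributive tmul +%R.
Proof.
move=> x y z; elim/tring_ind: x => [|a b|x x' hx hx'].
- by rewrite !tmul0l addr0.
- by rewrite !tmul_tens tmul1D.
- by rewrite !tmulDl hx hx' addrACA.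
Qed.

Fact tmulA : associative tmul.
Proof.
move=> x y z; elim/tring_ind: x => [|a b|x x' hx hx']; first by rewrite !tmul0l.
  elim/tring_ind: y => [|a' b'|y y' hy hy'].
  - by rewrite !(tmul0l, tmul0r).
  - elim/tring_ind: z => [|a'' b''|z z' hz hz']; first by rewrite !tmul0r.
      by rewrite !tmulE !mulrA.
    by rewrite !tmulDr hz hz'.
  - by rewrite !(tmulDl, tmulDr) hy hy'.
by rewrite !tmulDl hx hx'.
Qed.

Fact tmul1l : left_id (tten 1 1) tmul.
Proof.
move=> x; elim/tring_ind: x => [|a b|x y hx hy]; first exact: tmul0r.
  by rewrite tmulE !mul1r.
by rewrite tmulDr hx hy.
Qed.
Fact tmul1r : right_id (tten 1 1) tmul.
Proof.
move=> x; elim/tring_ind: x => [|a b|x y hx hy]; first exact: tmul0l.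
  by rewrite tmulE !mulr1.
by rewrite tmulDl hx hy.
Qed.

HB.instance Definition _ := GRing.Zmodule_isPzRing.Build (tring A B)
  tmulA tmul1l tmul1r tmulDl tmulDr.

Lemma ttenM a b a' b' : tten a b * tten a' b' = tten (a * a') (b * b').
Proof. exact: tmulE. Qed.
Lemma tten1 : tten 1 1 = 1 :> tring A B.
Proof. by []. Qed.

Lemma ttenBl a a' b : tten (a - a') b = tten a b - tten a' b.
Proof. by apply/eqP; rewrite eq_sym subr_eq -ttenDl subrK. Qed.
Lemma ttenBr a b b' : tten a (b - b') = tten a b - tten a b'.
Proof. by apply/eqP; rewrite eq_sym subr_eq -ttenDr subrK. Qed.

Definition tinl (a : A) : tring A B := tten a 1.
Definition tinr (b : B) : tring A B := tten 1 b.
Fact tinl_zmod : zmod_morphism tinl.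
Proof. by move=> x y; exact: ttenBl. Qed.
Fact tinl_monoid : monoid_morphism tinl.
Proof. by split=> // x y; rewrite /tinl ttenM mulr1. Qed.
Fact tinr_zmod : zmod_morphism tinr.
Proof. by move=> x y; exact: ttenBr. Qed.
Fact tinr_monoid : monoid_morphism tinr.
Proof. by split=> // x y; rewrite /tinr ttenM mulr1. Qed.
HB.instance Definition _ :=
  GRing.isZmodMorphism.Build A (tring A B) tinl tinl_zmod.
HB.instance Definition _ :=
  GRing.isMonoidMorphism.Build A (tring A B) tinl tinl_monoid.
HB.instance Definition _ :=
  GRing.isZmodMorphism.Build B (tring A B) tinr tinr_zmod.
HB.instance Definition _ :=
  GRing.isMonoidMorphism.Build B (tring A B) tinr tinr_monoid.
End TensorRing.

Section TensorAlg.
Variables (K E : comPzRingType) (A B : alg K) (s : {rmorphism E -> B}).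
Hypothesis s_central : forall e x, GRing.comm (s e) x.

Fact tensor_alg_central e (x : tring A B) : GRing.comm ((@tinr K A B \o s) e) x.
Proof.
rewrite /GRing.comm /=; elim/tring_ind: x => [|a b|x y hx hy].
- by rewrite mulr0 mul0r.
- by rewrite /tinr !ttenM mulr1 mul1r s_central.
- by rewrite mulrDr mulrDl hx hy.
Qed.

Definition tensor_alg : alg E :=
  @Alg E (tring A B) [the {rmorphism E -> tring A B} of @tinr K A B \o s]
    tensor_alg_central.
End TensorAlg.

Definition base_change (K D : comPzRingType) (A : alg K)
    (f : {rmorphism K -> D}) : alg D :=
  @tensor_alg K D A (comm_alg f) [the {rmorphism D -> D} of idfun]
    (@self_central D).

Section TensorRingMap.
Variables (K : comPzRingType) (A B B' : alg K) (g : alg_hom B B').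

Definition alg_lin (x : as_mod B) : as_mod B' := g x.
Fact alg_lin_linear : linear alg_lin.
Proof.
by move=> k x y; rewrite /alg_lin !as_mod_scaleE rmorphD rmorphM alg_fun_str.
Qed.
HB.instance Definition _ :=
  GRing.isLinear.Build K (as_mod B) (as_mod B') *:%R alg_lin alg_lin_linear.

Definition tring_map (x : tring A B) : tring A B' :=
  tmap [the {linear as_mod A -> as_mod A} of idfun]
       [the {linear as_mod B -> as_mod B'} of alg_lin] x.

Lemma tring_map_tten a b : tring_map (tten a b) = tten a (g b).
Proof. exact: tmap_tens. Qed.
Lemma tring_mapD : {morph tring_map : x y / x + y}.
Proof. exact: tmapD. Qed.
Lemma tring_map0 : tring_map 0 = 0.
Proof. by apply: (addrI (tring_map 0)); rewrite -tring_mapD !addr0. Qed.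
Fact tring_map_zmod : zmod_morphism tring_map.
Proof.
by move=> x y; apply/eqP; rewrite eq_sym subr_eq -tring_mapD subrK.
Qed.
Fact tring_map_monoid : monoid_morphism tring_map.
Proof.
split=> [|x y]; first by rewrite -tten1 tring_map_tten rmorph1.
elim/tring_ind: x => [|a b|x x' hx hx'].
- by rewrite mul0r !tring_map0 mul0r.
- elim/tring_ind: y => [|a' b'|y y' hy hy'].
  + by rewrite mulr0 !tring_map0 mulr0.
  + by rewrite ttenM !tring_map_tten ttenM rmorphM.
  + by rewrite mulrDr !tring_mapD mulrDr hy hy'.
- by rewrite mulrDl !tring_mapD mulrDl hx hx'.
Qed.
HB.instance Definition _ :=
  GRing.isZmodMorphism.Build (tring A B) (tring A B') tring_map tring_map_zmod.
HB.instance Definition _ :=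
  GRing.isMonoidMorphism.Build (tring A B) (tring A B') tring_map
    tring_map_monoid.
End TensorRingMap.

Lemma tring_map_id (K : comPzRingType) (A B : alg K) (g : alg_hom B B) :
  g =1 id -> tring_map (A := A) g =1 id.
Proof.
move=> hg; apply: tring_ind => [|a b|x y hx hy]; first exact: tring_map0.
  by rewrite tring_map_tten hg.
by rewrite tring_mapD hx hy.
Qed.

Lemma tring_map_comp (K : comPzRingType) (A B B' B'' : alg K)
    (g : alg_hom B' B'') (f : alg_hom B B') (h : alg_hom B B'') :
  h =1 g \o f -> forall x, tring_map (A := A) h x = tring_map g (tring_map f x).
Proof.
move=> hE; apply: tring_ind => [|a b|x y hx hy]; first by rewrite !tring_map0.
  by rewrite !tring_map_tten hE.
by rewrite !tring_mapD hx hy.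
Qed.

Record prime_ideal (K : comPzRingType) (p : K -> Prop) : Prop := PrimeIdeal {
  prime_ideal0 : p 0;
  prime_idealD : forall x y, p x -> p y -> p (x + y);
  prime_idealM : forall x y, p y -> p (x * y);
  prime_ideal1 : ~ p 1;
  prime_idealP : forall x y, p (x * y) -> p x \/ p y
}.

(* i : K -> L is a localization at the multiplicative set S.                  *)
Record is_localization (K L : comPzRingType) (S : K -> Prop)
    (i : {rmorphism K -> L}) : Prop := IsLocalization {
  loc_unit : forall s, S s -> exists u, u * i s = 1;
  loc_frac : forall x, exists a s, S s /\ x * i s = i a;
  loc_eq0 : forall a, i a = 0 -> exists s, S s /\ s * a = 0
}.

Definition powers (K : comPzRingType) (d x : K) : Prop :=
  exists n : nat, x = d ^+ n.

Definition surjective_on_Spec (K L : comPzRingType) (f : {rmorphism K -> L}) :=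
  forall p : K -> Prop, prime_ideal p ->
    exists q : L -> Prop, prime_ideal q /\ (forall x, q (f x) <-> p x).

(* Polynomials over K in n variables, as formal sums of terms c X^m; MathComp *)
(* polynomial rings would exclude the zero ring.                              *)
Definition npoly (K : comPzRingType) (n : nat) : Type :=
  seq (K * {ffun 'I_n -> nat}).
HB.instance Definition _ K n := Equality.on (npoly K n).

Definition npoly_eval (K L : comPzRingType) (f : {rmorphism K -> L}) (n : nat)
    (x : 'I_n -> L) (p : npoly K n) : L :=
  \sum_(t <- p) f t.1 * \prod_(i < n) x i ^+ t.2 i.

(* L = K[x_1, ..., x_n] / (rels): the x_i generate L and rels is a finite set *)
(* of defining relations between them.                                        *)
Definition finitely_presented (K L : comPzRingType) (f : {rmorphism K -> L}) :=
  exists (n : nat) (x : 'I_n -> L) (rels : seq (npoly K n)),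
    [/\ forall y, exists p, y = npoly_eval f x p,
        forall r, r \in rels -> npoly_eval f x r = 0 &
        forall (T : comPzRingType) (g : {rmorphism K -> T}) (z : 'I_n -> T),
          (forall r, r \in rels -> npoly_eval g z r = 0) ->
          exists h : {rmorphism L -> T},
            (forall k, h (f k) = g k) /\ (forall i, h (x i) = z i)].

Definition flat (K : comPzRingType) (N : lmodType K) : Prop :=
  forall (M M' : lmodType K) (u : {linear M -> M'}), injective u ->
    injective (tmap u [the {linear N -> N} of idfun]).

Definition faithfully_flat (K : comPzRingType) (N : lmodType K) : Prop :=
  flat N /\
  forall M : lmodType K, (forall t : tensor M N, t = 0) -> forall m : M, m = 0.

Definition ring_flat (K L : comPzRingType) (f : {rmorphism K -> L}) : Prop :=
  flat (as_mod (comm_alg f)).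
Definition ring_faithfully_flat (K L : comPzRingType)
    (f : {rmorphism K -> L}) : Prop :=
  faithfully_flat (as_mod (comm_alg f)).

(* Two lifts along a square-zero thickening T -> T' that agree on K coincide. *)
Definition formally_unramified (K L : comPzRingType) (f : {rmorphism K -> L}) :=
  forall (T T' : comPzRingType) (q : {rmorphism T -> T'}),
    (forall y, exists x, q x = y) ->
    (forall x y, q x = 0 -> q y = 0 -> x * y = 0) ->
    forall g h : {rmorphism L -> T},
      (forall k, g (f k) = h (f k)) -> (forall x, q (g x) = q (h x)) ->
      forall x, g x = h x.

(* Etale as flat, unramified and of finite presentation (EGA IV 17.6.2).      *)
Record etale (K L : comPzRingType) (f : {rmorphism K -> L}) : Prop := Etale {
  etale_fp : finitely_presented f;
  etale_flat : ring_flat f;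
  etale_unramified : formally_unramified f
}.

Definition prod_ring (I : Type) (D : I -> comPzRingType) : Type :=
  forall i, D i.

Section ProdRing.
Variables (I : Type) (D : I -> comPzRingType).
Local Notation P := (prod_ring D).
HB.instance Definition _ := gen_eqMixin P.
HB.instance Definition _ := gen_choiceMixin P.

Definition prod_zero : P := fun i => 0.
Definition prod_opp (x : P) : P := fun i => - x i.
Definition prod_add (x y : P) : P := fun i => x i + y i.
Definition prod_one : P := fun i => 1.
Definition prod_mul (x y : P) : P := fun i => x i * y i.

Fact prod_addA : associative prod_add.
Proof. by move=> x y z; apply: functional_extensionality_dep => i; exact: addrA. Qed.
Fact prod_addC : commutative prod_add.
Proof. by move=> x y; apply: functional_extensionality_dep => i; exact: addrC. Qed.
Fact prod_add0 : left_id prod_zero prod_add.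
Proof. by move=> x; apply: functional_extensionality_dep => i; exact: add0r. Qed.
Fact prod_addN : left_inverse prod_zero prod_opp prod_add.
Proof. by move=> x; apply: functional_extensionality_dep => i; exact: addNr. Qed.
HB.instance Definition _ :=
  GRing.isZmodule.Build P prod_addA prod_addC prod_add0 prod_addN.

Fact prod_mulA : associative prod_mul.
Proof. by move=> x y z; apply: functional_extensionality_dep => i; exact: mulrA. Qed.
Fact prod_mulC : commutative prod_mul.
Proof. by move=> x y; apply: functional_extensionality_dep => i; exact: mulrC. Qed.
Fact prod_mul1 : left_id prod_one prod_mul.
Proof. by move=> x; apply: functional_extensionality_dep => i; exact: mul1r. Qed.
Fact prod_mulDl : left_distributive prod_mul prod_add.
Proof. by move=> x y z; apply: functional_extensionality_dep => i; exact: mulrDl. Qed.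
HB.instance Definition _ :=
  GRing.Zmodule_isComPzRing.Build P prod_mulA prod_mulC prod_mul1 prod_mulDl.
End ProdRing.

Section ProdMap.
Variables (K : comPzRingType) (I : Type) (D : I -> comPzRingType).
Variable f : forall i, {rmorphism K -> D i}.

Definition prod_map (k : K) : prod_ring D := fun i => f i k.
Fact prod_map_zmod : zmod_morphism prod_map.
Proof.
by move=> x y; apply: functional_extensionality_dep => i; exact: rmorphB.
Qed.
Fact prod_map_monoid : monoid_morphism prod_map.
Proof.
split=> [|x y]; apply: functional_extensionality_dep => i.
  exact: rmorph1.
exact: rmorphM.
Qed.
HB.instance Definition _ :=
  GRing.isZmodMorphism.Build K (prod_ring D) prod_map prod_map_zmod.
HB.instance Definition _ :=
  GRing.isMonoidMorphism.Build K (prod_ring D) prod_map prod_map_monoid.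
End ProdMap.

Definition fg_projective (K : comPzRingType) (M : lmodType K) : Prop :=
  exists (n : nat) (i : {linear M -> 'rV[K]_n}) (p : {linear 'rV[K]_n -> M}),
    cancel i p.

Definition faithful (K : comPzRingType) (M : lmodType K) : Prop :=
  forall k : K, (forall m : M, k *: m = 0) -> k = 0.

Section Sandwich.
Variables (K : comPzRingType) (A : alg K).

Definition sandwich_fun (t : tring A (op_alg A)) (r : as_mod A) : as_mod A :=
  @tlift K (as_mod A) (as_mod (op_alg A)) (as_mod A)
    (fun a b => (a : A) * (r : A) * (b : A)) t.

Lemma sandwich_balanced (r : A) :
  @balanced K (as_mod A) (as_mod (op_alg A)) (as_mod A)
    (fun a b => (a : A) * r * (b : A)).
Proof.
split=> [x y b|a x y|k a b].
- by rewrite !mulrDl.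
- by rewrite mulrDr.
- have -> : (k *: b : as_mod (op_alg A)) = (b : A) * alg_str A k :> A by [].
  rewrite as_mod_scaleE -(alg_central k (b : A)) !mulrA.
  by rewrite -(alg_central k (a * r)) mulrA.
Qed.

Lemma sandwich_tten a (b : A) r :
  sandwich_fun (tten a (b : op_alg A)) r = (a : A) * (r : A) * b.
Proof. exact: (tlift_tens (sandwich_balanced r) _ _). Qed.

Fact sandwich_linear t : linear (sandwich_fun t).
Proof.
move=> k x y; elim/tring_ind: t => [|a b|t u ht hu].
- by rewrite /sandwich_fun !(tlift0 (sandwich_balanced _)) scaler0 addr0.
- rewrite !sandwich_tten !as_mod_scaleE mulrDr mulrDl !mulrA.
  by rewrite (alg_central k a).
- rewrite /sandwich_fun !(tliftD (sandwich_balanced _)) -!/(sandwich_fun _ _).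
  by rewrite ht hu scalerDr addrACA.
Qed.
HB.instance Definition _ t := GRing.isLinear.Build K (as_mod A) (as_mod A) *:%R
  (sandwich_fun t) (sandwich_linear t).

Definition sandwich (t : tring A (op_alg A)) : {linear as_mod A -> as_mod A} :=
  [the {linear as_mod A -> as_mod A} of sandwich_fun t].
End Sandwich.

Record azumaya (K : comPzRingType) (A : alg K) : Prop := Azumaya {
  azumaya_faithful : faithful (as_mod A);
  azumaya_projective : fg_projective (as_mod A);
  azumaya_iso : bijective (@sandwich K A)
}.

(* A has constant rank r: for every prime p and localization L of K at p, the *)
(* L-module A (x)_K L is free of rank r.                                      *)
Definition constant_rank (K : comPzRingType) (A : alg K) (r : nat) : Prop :=
  forall (p : K -> Prop) (L : comPzRingType) (i : {rmorphism K -> L}),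
    prime_ideal p -> is_localization (fun x => ~ p x) i ->
    exists h : {linear as_mod (base_change A i) -> 'rV[L]_r}, bijective h.

Definition constant_degree (K : comPzRingType) (A : alg K) : Prop :=
  exists n : nat, constant_rank A (n ^ 2).

Lemma linear_ext (K : comPzRingType) (M N : lmodType K)
  (f g : {linear M -> N}) : f =1 g -> f = g.
Proof.
case: f => f [[f1] [f2]]; case: g => g [[g1] [g2]] /= E.
have {}E : f = g by apply/funext.
subst g.
by rewrite (Prop_irrelevance f1 g1) (Prop_irrelevance f2 g2).
Qed.

Section SelfAzumaya.
Variable K : comPzRingType.

Definition self_row (x : as_mod (self_alg K)) : 'rV[K]_1 := (x : K)%:M.
Fact self_row_linear : linear self_row.
Proof. by move=> k x y; apply/rowP=> i; rewrite !ord1 !mxE !mulr1n. Qed.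
HB.instance Definition _ := GRing.isLinear.Build K (as_mod (self_alg K)) 'rV[K]_1
  *:%R self_row self_row_linear.

Definition row_self (x : 'rV[K]_1) : as_mod (self_alg K) := x 0 0.
Fact row_self_linear : linear row_self.
Proof. by move=> k x y; rewrite /row_self !mxE. Qed.
HB.instance Definition _ := GRing.isLinear.Build K 'rV[K]_1 (as_mod (self_alg K))
  *:%R row_self row_self_linear.

Lemma self_azumaya : azumaya (self_alg K).
Proof.
split.
- by move=> k /(_ (1 : K)); rewrite as_mod_scaleE /= mulr1.
- exists 1%N, [the {linear _ -> _} of self_row], [the {linear _ -> _} of row_self].
  by move=> x /=; rewrite /row_self /self_row mxE eqxx mulr1n.
- exists (fun g : {linear as_mod (self_alg K) -> as_mod (self_alg K)} =>
      @tten K (self_alg K) (op_alg (self_alg K)) (g (1 : K)) (1 : K)).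
  + move=> t /=; elim/tring_ind: t => [|a b|t u ht hu].
    * rewrite /sandwich_fun (tlift0 (sandwich_balanced _)).
      by rewrite -[X in tten X _](subrr (0 : K)) ttenBl subrr.
    * rewrite sandwich_tten mulr1 [a * _ in LHS]mulrC.
      have -> : (b : K) * (a : K) = alg_str (self_alg K) b * a by [].
      by rewrite ttenZ; congr tten; exact: mulr1.
    * rewrite /sandwich_fun (tliftD (sandwich_balanced _)).
      rewrite -!/(sandwich_fun _ _).
      by rewrite -[RHS](congr2 +%R ht hu) -ttenDl.
  + move=> g; apply: linear_ext => r /=.
    rewrite sandwich_tten mulr1.
    have e : r = (r : K) *: ((1 : K) : as_mod (self_alg K)).
      by rewrite as_mod_scaleE /= mulr1.
    by rewrite [in RHS]e linearZ /= as_mod_scaleE /= mulrC.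
Qed.
End SelfAzumaya.

Record category := Category {
  ob :> Type;
  hom : ob -> ob -> Type;
  idm : forall X, hom X X;
  comp : forall X Y Z, hom Y Z -> hom X Y -> hom X Z;
  comp_idl : forall X Y (f : hom X Y), comp (idm Y) f = f;
  comp_idr : forall X Y (f : hom X Y), comp f (idm X) = f;
  comp_assoc : forall X Y Z W (h : hom Z W) (g : hom Y Z) (f : hom X Y),
    comp h (comp g f) = comp (comp h g) f
}.
Arguments hom {c} _ _.
Arguments idm {c} _.
Arguments comp {c X Y Z} _ _.

Definition op (C : category) : category :=
  @Category C (fun X Y => @hom C Y X) (@idm C) (fun X Y Z g f => comp f g)
    (fun X Y f => comp_idr f) (fun X Y f => comp_idl f)
    (fun X Y Z W h g f => esym (comp_assoc f g h)).

Record functor (C D : category) := Functor {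
  fob :> C -> D;
  fmap : forall X Y, hom X Y -> hom (fob X) (fob Y);
  fmap_id : forall X, fmap (idm X) = idm (fob X);
  fmap_comp : forall X Y Z (g : hom Y Z) (f : hom X Y),
    fmap (comp g f) = comp (fmap g) (fmap f)
}.
Arguments fmap {C D} _ {X Y} _.

Definition op_functor (C D : category) (F : functor C D) :
    functor (op C) (op D) :=
  @Functor (op C) (op D) F (fun X Y f => @fmap C D F Y X f)
    (fun X => fmap_id F X) (fun X Y Z g f => @fmap_comp C D F Z Y X f g).

Record presheaf (C : category) := Presheaf {
  sections :> C -> Type;
  restr : forall X Y, @hom C Y X -> sections X -> sections Y;
  restr_id : forall X (x : sections X), restr (idm X) x = x;
  restr_comp : forall X Y Z (f : hom Y X) (g : hom Z Y) (x : sections X),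
    restr (comp f g) x = restr g (restr f x)
}.
Arguments restr {C} _ {X Y} _ _.

Section Precomp.
Variables (C D : category) (F : functor C D) (P : presheaf D).
Lemma precomp_id X (x : P (F X)) : restr P (fmap F (idm X)) x = x.
Proof. by rewrite fmap_id restr_id. Qed.
Lemma precomp_comp (X Y Z : C) (f : hom Y X) (g : hom Z Y) (x : P (F X)) :
  restr P (fmap F (comp f g)) x = restr P (fmap F g) (restr P (fmap F f) x).
Proof. by rewrite fmap_comp restr_comp. Qed.
Definition precomp : presheaf C :=
  @Presheaf C (fun X => P (F X)) (fun X Y f => restr P (fmap F f))
    precomp_id precomp_comp.
End Precomp.

Section Sites.
Variable C : category.

Definition arrows (X : C) : Type := forall Y : C, hom Y X -> Prop.

Definition is_sieve (X : C) (S : arrows X) : Prop :=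
  forall (Y Z : C) (f : hom Y X) (g : hom Z Y), S Y f -> S Z (comp f g).

Definition pullback_sieve (X Y : C) (f : hom Y X) (S : arrows X) : arrows Y :=
  fun Z g => S Z (comp f g).

Definition covering : Type := forall X : C, arrows X -> Prop.

Record is_topology (J : covering) : Prop := IsTopology {
  top_sieve : forall X S, J X S -> is_sieve S;
  top_max : forall X, J X (fun _ _ => True);
  top_pullback : forall (X Y : C) (f : hom Y X) S,
    J X S -> J Y (pullback_sieve f S);
  top_trans : forall X S R, J X S -> is_sieve R ->
    (forall Y (f : hom Y X), S Y f -> J Y (pullback_sieve f R)) -> J X R
}.

Definition covers : Type :=
  forall (X : C) (I : Type) (Y : I -> C), (forall i, hom (Y i) X) -> Prop.

Definition sieve_of_family (X : C) (I : Type) (Y : I -> C)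
    (f : forall i, hom (Y i) X) : arrows X :=
  fun Z h => exists (i : I) (g : hom Z (Y i)), h = comp (f i) g.

Definition generated (K : covers) : covering := fun X S =>
  forall J, is_topology J ->
    (forall X I Y (f : forall i : I, hom (Y i) X), K X I Y f ->
       J X (sieve_of_family f)) ->
    J X S.

Definition matching (F : presheaf C) (X : C) (S : arrows X)
    (x : forall Y (f : hom Y X), S Y f -> F Y) : Prop :=
  forall (Y Z : C) (f : hom Y X) (g : hom Z Y) (Sf : S Y f)
    (Sfg : S Z (comp f g)),
    restr F g (x Y f Sf) = x Z (comp f g) Sfg.

Definition is_sheaf (J : covering) (F : presheaf C) : Prop :=
  forall (X : C) (S : arrows X), J X S ->
  forall x : (forall Y (f : hom Y X), S Y f -> F Y), matching x ->
    exists! a : F X, forall Y (f : hom Y X) (Sf : S Y f), restr F f a = x Y f Sf.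
End Sites.

(* S covers X when the sieve generated by the image of S covers U X; for the  *)
(* forgetful functor U of a slice category this is the restricted topology.   *)
Definition induced (C D : category) (U : functor C D) (J : covering D) :
    covering C :=
  fun X S => is_sieve S /\
    J (U X) (fun Z h => exists (Y : C) (f : hom Y X) (g : hom Z (U Y)),
      S Y f /\ h = comp (fmap U f) g).

Section Under.
Variables (C : category) (A : C).

Record under_ob := UnderOb { under_cod : C; under_str : hom A under_cod }.

Record under_hom (X Y : under_ob) := UnderHom {
  under_fun : hom (under_cod X) (under_cod Y);
  under_comm : comp under_fun (under_str X) = under_str Y
}.

Lemma under_hom_ext X Y (f g : under_hom X Y) :
  under_fun f = under_fun g -> f = g.
Proof.
case: f => f pf; case: g => g pg /= E; subst g.
by rewrite (Prop_irrelevance pf pg).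
Qed.

Definition under_id X : under_hom X X := UnderHom (comp_idl (under_str X)).

Lemma under_comp_comm X Y Z (g : under_hom Y Z) (f : under_hom X Y) :
  comp (comp (under_fun g) (under_fun f)) (under_str X) = under_str Z.
Proof. by rewrite -comp_assoc !under_comm. Qed.

Definition under_comp X Y Z (g : under_hom Y Z) (f : under_hom X Y) :
  under_hom X Z := UnderHom (under_comp_comm g f).

Definition under : category.
Proof.
refine (@Category under_ob under_hom under_id under_comp _ _ _) => *.
- exact/under_hom_ext/comp_idl.
- exact/under_hom_ext/comp_idr.
- exact/under_hom_ext/comp_assoc.
Defined.

Definition under_forget : functor under C :=
  @Functor under C under_cod (@under_fun) (fun=> erefl)
    (fun _ _ _ _ _ => erefl).
End Under.

Record fpcalg (K : comPzRingType) := FpCAlg {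
  fp_ring :> comPzRingType;
  fp_str : {rmorphism K -> fp_ring};
  fp_presented : finitely_presented fp_str
}.

Definition fp_alg (K : comPzRingType) (D : fpcalg K) : alg K :=
  comm_alg (fp_str D).

Definition fpCAlg (K : comPzRingType) : category.
Proof.
refine (@Category (fpcalg K) (fun D D' => alg_hom (fp_alg D) (fp_alg D'))
  (fun D => alg_id (fp_alg D)) (fun _ _ _ g f => alg_comp g f) _ _ _) => *;
  exact: alg_hom_ext.
Defined.

Definition affine (K : comPzRingType) : category := op (fpCAlg K).

Section Covers.
Variable K : comPzRingType.

Definition fp_hom (X Y : affine K) (f : hom Y X) :
    {rmorphism fp_ring X -> fp_ring Y} := alg_fun f.

Definition flat_covers : covers (affine K) := fun X I Y f =>
  finite_set [set: I] /\
  ring_faithfully_flat [the {rmorphism fp_ring X -> _}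
    of prod_map (fun i => fp_hom (f i))].

(* The family may be infinite: 1 is a finite combination of the d_i.          *)
Definition unit_ideal (D : comPzRingType) (I : Type) (d : I -> D) : Prop :=
  exists (s : seq I) (c : I -> D), \sum_(i <- s) c i * d i = 1.

Definition etale_covers : covers (affine K) := fun X I Y f =>
  exists (d : I -> fp_ring X) (L : I -> comPzRingType)
    (l : forall i, {rmorphism fp_ring X -> L i})
    (g : forall i, {rmorphism L i -> fp_ring (Y i)}),
    unit_ideal d /\
    forall i, [/\ is_localization (powers (d i)) (l i), etale (g i),
                  surjective_on_Spec (g i)
                & forall x, fp_hom (f i) x = g i (l i x)].

Definition zariski_covers : covers (affine K) := fun X I Y f =>
  exists d : I -> fp_ring X,
    unit_ideal d /\
    forall i, is_localization (powers (d i)) (fp_hom (f i)).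

Definition flat_topology : covering (affine K) := generated flat_covers.
Definition etale_topology : covering (affine K) := generated etale_covers.
Definition zariski_topology : covering (affine K) := generated zariski_covers.
End Covers.

(* An object is an algebra B that is Azumaya over a finitely presented        *)
(* K-algebra E; the structure map identifies E with the center of B.          *)
Record azob (K : comPzRingType) := AzOb {
  az_center : fpcalg K;
  az_alg : alg az_center;
  az_azumaya : azumaya az_alg
}.

Definition az_res (K : comPzRingType) (B : azob K) : alg K :=
  res_alg (fp_str (az_center B)) (az_alg B).

Definition central (B : pzRingType) (z : B) : Prop :=
  forall b, GRing.comm z b.

Record az_hom (K : comPzRingType) (B B' : azob K) := AzHom {
  az_fun :> alg_hom (az_res B) (az_res B');
  az_fun_center : forall z, central z -> central (az_fun z)
}.

Section AzumayaCat.
Variable K : comPzRingType.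
Implicit Types B : azob K.

Lemma az_hom_ext B B' (f g : az_hom B B') : f =1 g -> f = g.
Proof.
case: f => f pf; case: g => g pg /= /(@alg_hom_ext _ _ _ f g) E; subst g.
by rewrite (Prop_irrelevance pf pg).
Qed.

Definition az_id B : az_hom B B := @AzHom K B B (alg_id _) (fun z cz => cz).

Lemma az_comp_center B B' B'' (g : az_hom B' B'') (f : az_hom B B')
  (z : az_res B) : central z -> central (alg_comp g f z).
Proof. by move=> cz; exact/az_fun_center/az_fun_center. Qed.

Definition az_comp B B' B'' (g : az_hom B' B'') (f : az_hom B B') :
  az_hom B B'' := AzHom (az_comp_center g f).

Definition Azumaya_cat : category.
Proof.
refine (@Category (azob K) (@az_hom K) az_id az_comp _ _ _) => *;
  exact: az_hom_ext.
Defined.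
End AzumayaCat.

Definition Azufine (K : comPzRingType) : category := op (Azumaya_cat K).

Definition comm_az (K : comPzRingType) (D : fpcalg K) : azob K :=
  AzOb (self_azumaya D).

Definition Azumaya_under (K : comPzRingType) (A : azob K) : category :=
  @under (Azumaya_cat K) A.
Definition Azufine_under (K : comPzRingType) (A : azob K) : category :=
  op (Azumaya_under A).
Definition Azufine_forget (K : comPzRingType) (A : azob K) :
    functor (Azufine_under A) (Azufine K) :=
  op_functor (@under_forget (Azumaya_cat K) A).

Section MaximalFlat.
Variable K : comPzRingType.

(* The morphisms E -> D such that B (x)_E D is of constant degree and some    *)
(* B -> B (x)_E D -> B' is in L, with B' Azumaya of constant degree with      *)
(* center D.                                                                  *)
Definition maximal_flat_arrows (B : azob K) (L : @arrows (Azufine K) B) :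
    @arrows (affine K) (az_center B) :=
  fun (D : affine K) f =>
    constant_degree (base_change (az_alg B) (fp_hom f)) /\
    exists (B' : alg (fp_ring D)) (azB' : azumaya B')
      (g : alg_hom (base_change (az_alg B) (fp_hom f)) B')
      (h : az_hom B (@AzOb K D B' azB')),
      [/\ constant_degree B', forall b, h b = g (@tinl _ (az_alg B) _ b) & L _ h].

Definition maximal_flat_topology : covering (Azufine K) := fun B L =>
  is_sieve L /\
  is_sieve (maximal_flat_arrows L) /\
  @flat_topology K (az_center B) (maximal_flat_arrows L).

Definition maximal_flat_under (A : azob K) : covering (Azufine_under A) :=
  induced (Azufine_forget A) maximal_flat_topology.
End MaximalFlat.

Section TensorFunctor.
Variables (K : comPzRingType) (A : azob K).
Local Notation C := (az_center A).
Local Notation AzC := (Azumaya_under (comm_az C)).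

Section Objects.
Variable B : AzC.
Local Notation E := (az_center (under_cod B)).

Lemma under_ring_central (c : C) (x : az_alg (under_cod B)) :
  GRing.comm (alg_fun (az_fun (under_str B)) c) x.
Proof. by apply: (@az_fun_center _ _ _ (under_str B) c) => y; exact: mulrC. Qed.

Definition under_alg : alg C :=
  @Alg C (az_alg (under_cod B)) (alg_fun (az_fun (under_str B)))
    under_ring_central.

Definition az_tensor : alg E :=
  @tensor_alg C E (az_alg A) under_alg (alg_str (az_alg (under_cod B)))
    (@alg_central _ (az_alg (under_cod B))).
End Objects.

Section Morphisms.
Variables (B B' : AzC) (g : hom B B').

Lemma under_alg_hom_str (c : C) :
  alg_fun (az_fun (under_fun g)) (alg_str (under_alg B) c) =
  alg_str (under_alg B') c.
Proof. by rewrite /= -(under_comm g). Qed.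

Definition under_alg_hom : alg_hom (under_alg B) (under_alg B') :=
  @AlgHom C (under_alg B) (under_alg B') (alg_fun (az_fun (under_fun g)))
    under_alg_hom_str.

Definition az_tensor_map :
    {rmorphism tring (az_alg A) (under_alg B) ->
               tring (az_alg A) (under_alg B')} :=
  [the {rmorphism _ -> _} of tring_map under_alg_hom].
End Morphisms.

(* What makes A (x)_C - a functor to Azumaya_A: A (x)_C B is Azumaya over the *)
(* center of B, and id (x) g preserves centers.                               *)
Definition az_tensor_defined : Prop :=
  (forall B, azumaya (az_tensor B)) /\
  (forall (B B' : AzC) (g : hom B B') z,
     central z -> central (az_tensor_map g z)).

Hypothesis defined : az_tensor_defined.

Definition az_tensor_cod (B : AzC) : azob K := AzOb (defined.1 B).

Section Structure.
Variable B : AzC.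
Lemma az_tensor_inl_str k :
  tinl (under_alg B) (alg_str (az_res A) k) = alg_str (az_res (az_tensor_cod B)) k.
Proof.
rewrite /= /tinl /tinr -[X in tten X _]mulr1.
rewrite (@ttenZ C (az_alg A) (under_alg B)) mulr1.
by congr tten; exact: (alg_fun_str (az_fun (under_str B)) k).
Qed.

Definition az_tensor_inl : alg_hom (az_res A) (az_res (az_tensor_cod B)) :=
  @AlgHom K (az_res A) (az_res (az_tensor_cod B))
    [the {rmorphism az_alg A -> _} of @tinl C (az_alg A) (under_alg B)]
    az_tensor_inl_str.

Lemma az_tensor_inl_center z : central z -> central (az_tensor_inl z).
Proof.
move=> cz x; rewrite /GRing.comm /=.
move: x; apply: tring_ind => [|a b|x y hx hy].
- by rewrite mulr0 mul0r.
- by rewrite /tinl !ttenM mulr1 mul1r cz.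
- by rewrite mulrDr mulrDl hx hy.
Qed.

Definition az_tensor_ob : Azumaya_under A :=
  @UnderOb (Azumaya_cat K) A (az_tensor_cod B) (AzHom az_tensor_inl_center).
End Structure.

Section Arrow.
Variables (B B' : AzC) (g : hom B B').

Lemma az_tensor_map_str k :
  az_tensor_map g (alg_str (az_res (az_tensor_cod B)) k) =
  alg_str (az_res (az_tensor_cod B')) k.
Proof.
rewrite /= /tinr tring_map_tten; congr tten.
exact: (alg_fun_str (az_fun (under_fun g)) k).
Qed.

Definition az_tensor_arr : az_hom (az_tensor_cod B) (az_tensor_cod B') :=
  @AzHom K (az_tensor_cod B) (az_tensor_cod B')
    (@AlgHom K (az_res (az_tensor_cod B)) (az_res (az_tensor_cod B'))
      (az_tensor_map g) az_tensor_map_str)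
    (@defined.2 B B' g).

Lemma az_tensor_arr_comm :
  @comp (Azumaya_cat K) _ _ _ az_tensor_arr (under_str (az_tensor_ob B)) =
  under_str (az_tensor_ob B').
Proof.
apply: az_hom_ext => a /=.
by rewrite /tinl tring_map_tten rmorph1.
Qed.

Definition az_tensor_hom : hom (az_tensor_ob B) (az_tensor_ob B') :=
  @UnderHom (Azumaya_cat K) A (az_tensor_ob B) (az_tensor_ob B') az_tensor_arr
    az_tensor_arr_comm.
End Arrow.

Definition tensor_functor : functor AzC (Azumaya_under A).
Proof.
refine (@Functor AzC (Azumaya_under A) az_tensor_ob az_tensor_hom _ _).
- move=> B; apply: under_hom_ext; apply: az_hom_ext.
  exact: tring_map_id.
- move=> B B' B'' g f; apply: under_hom_ext; apply: az_hom_ext.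
  exact: tring_map_comp.
Defined.
End TensorFunctor.

Section Inclusion.
Variables (K : comPzRingType) (C : fpcalg K).

Definition res_str (D : fpcalg C) : {rmorphism K -> D} :=
  [the {rmorphism K -> D} of fp_str D \o fp_str C].

(* What makes a finitely presented C-algebra an object of the category of     *)
(* finitely presented K-algebras.                                             *)
Definition fp_res_defined : Prop :=
  forall D : fpcalg C, finitely_presented (res_str D).

Hypothesis defined : fp_res_defined.

Definition fp_res (D : fpcalg C) : fpcalg K := FpCAlg (defined D).

Lemma comm_az_central (D : fpcalg K) (z : az_res (comm_az D)) : central z.
Proof. by move=> x; exact: mulrC. Qed.

Lemma incl_str_str (D : fpcalg C) k :
  fp_str D (alg_str (az_res (comm_az C)) k) =
  alg_str (az_res (comm_az (fp_res D))) k.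
Proof. by []. Qed.

Definition incl_str (D : fpcalg C) : az_hom (comm_az C) (comm_az (fp_res D)) :=
  @AzHom K (comm_az C) (comm_az (fp_res D))
    (@AlgHom K (az_res (comm_az C)) (az_res (comm_az (fp_res D))) (fp_str D)
      (incl_str_str D))
    (fun z _ => comm_az_central (fp_str D z : az_res (comm_az (fp_res D)))).

Definition incl_ob (D : fpcalg C) : Azumaya_under (comm_az C) :=
  @UnderOb (Azumaya_cat K) (comm_az C) (comm_az (fp_res D)) (incl_str D).

Lemma incl_arr_str (D D' : fpCAlg C) (f : hom D D') k :
  alg_fun f (alg_str (az_res (comm_az (fp_res D))) k) =
  alg_str (az_res (comm_az (fp_res D'))) k.
Proof. exact: (alg_fun_str f (fp_str C k)). Qed.

Definition incl_arr (D D' : fpCAlg C) (f : hom D D') :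
    az_hom (comm_az (fp_res D)) (comm_az (fp_res D')) :=
  @AzHom K (comm_az (fp_res D)) (comm_az (fp_res D'))
    (@AlgHom K (az_res (comm_az (fp_res D))) (az_res (comm_az (fp_res D')))
      (alg_fun f) (incl_arr_str f))
    (fun z _ => comm_az_central (alg_fun f z : az_res (comm_az (fp_res D')))).

Lemma incl_arr_comm (D D' : fpCAlg C) (f : hom D D') :
  @comp (Azumaya_cat K) _ _ _ (incl_arr f) (incl_str D) = incl_str D'.
Proof. by apply: az_hom_ext => c; exact: (alg_fun_str f c). Qed.

Definition incl_hom (D D' : fpCAlg C) (f : hom D D') :
  hom (incl_ob D) (incl_ob D') :=
  @UnderHom (Azumaya_cat K) (comm_az C) (incl_ob D) (incl_ob D') (incl_arr f)
    (incl_arr_comm f).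

Definition inclusion : functor (fpCAlg C) (Azumaya_under (comm_az C)).
Proof.
refine (@Functor (fpCAlg C) (Azumaya_under (comm_az C)) incl_ob incl_hom _ _).
- by move=> D; apply: under_hom_ext; exact: az_hom_ext.
- by move=> D D' D'' g f; apply: under_hom_ext; exact: az_hom_ext.
Defined.
End Inclusion.

Definition Rep (K : comPzRingType) (R : alg K) : presheaf (Azufine K).
Proof.
refine (@Presheaf (Azufine K) (fun B : azob K => alg_hom R (az_res B))
  (fun (B B' : azob K) (g : az_hom B B') x => alg_comp g x) _ _) => *;
  exact: alg_hom_ext.
Defined.

Section RepA.
Variables (K : comPzRingType) (R : alg K) (A : azob K).
Local Notation C := (az_center A).

Definition fiber (D : fpcalg C) : alg K :=
  res_alg (res_str D) (base_change (az_alg A) (fp_str D)).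

Lemma fiber_hom_str (D D' : fpcalg C) (f : alg_hom (fp_alg D) (fp_alg D')) k :
  @tring_map C (az_alg A) _ _ f (alg_str (fiber D) k) = alg_str (fiber D') k.
Proof.
rewrite /= /tinr tring_map_tten; congr tten.
exact: (alg_fun_str f (fp_str C k)).
Qed.

Definition fiber_hom (D D' : fpcalg C) (f : alg_hom (fp_alg D) (fp_alg D')) :
    alg_hom (fiber D) (fiber D') :=
  @AlgHom K (fiber D) (fiber D')
    [the {rmorphism tring (az_alg A) (fp_alg D) ->
                    tring (az_alg A) (fp_alg D')} of tring_map f]
    (fiber_hom_str f).

Definition Rep_at : presheaf (affine C).
Proof.
refine (@Presheaf (affine C) (fun D : fpcalg C => alg_hom R (fiber D))
  (fun (D D' : fpcalg C) (f : alg_hom (fp_alg D) (fp_alg D')) x =>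
     alg_comp (fiber_hom f) x) _ _).
- move=> D x; apply: alg_hom_ext => r.
  exact: tring_map_id.
- move=> D D' D'' f g x; apply: alg_hom_ext => r.
  exact: tring_map_comp.
Defined.
End RepA.

(* The three functors Sh(Azufine_K) -> Sh(Azufine_A) -> Sh(Azufine_C) ->      *)
(* Sh(affine_C), on the underlying presheaves.                                *)
Definition restrict_to_A (K : comPzRingType) (A : azob K)
    (F : presheaf (Azufine K)) : presheaf (Azufine_under A) :=
  precomp (Azufine_forget A) F.

Definition tensor_with_A (K : comPzRingType) (A : azob K)
    (defT : az_tensor_defined A) (F : presheaf (Azufine_under A)) :
    presheaf (Azufine_under (comm_az (az_center A))) :=
  precomp (op_functor (tensor_functor defT)) F.

Definition restrict_to_affine (K : comPzRingType) (C : fpcalg K)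
    (defI : fp_res_defined C) (F : presheaf (Azufine_under (comm_az C))) :
    presheaf (affine C) :=
  precomp (op_functor (inclusion defI)) F.

(* Main.v *)
(* An Azumaya algebra is handled through a dual basis (x_j, l_j) and elements  *)
(* e_j of A (x) A^op acting as a |-> l_j(a); such data characterize Azumaya   *)
(* algebras and pass to tensor products. Flat covers give sheaves because of   *)
(* faithfully flat descent, and etale and Zariski covers are covering for the  *)
(* flat topology because localizations are flat and a flat map that is         *)
(* surjective on spectra is faithfully flat.                                   *)
(*                                                                             *)
(* A functor restricts sheaves to sheaves when covers go to covers and any two *)
(* factorizations of an arrow through its image are joined by a span. For the  *)
(* functor A (x)_C -, the span comes from the centralizer of A (the double     *)
(* centralizer theorem). That it preserves covers needs A to have constant     *)
(* degree locally: expanding det (P + (1 - P)) = 1 in the rows, P a projection *)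
(* matrix onto A, covers Spec C by loci where A is free, and the rank is a     *)
(* square at a complex point, which exists by the Nullstellensatz: there A is  *)
(* the endomorphism ring of a minimal left ideal.                              *)
(*                                                                             *)
(* For Rep_R on a maximal flat cover of B, two algebras B_1 and B_2 under B    *)
(* map compatibly to one algebra: B_2 is the product of B and the centralizer  *)
(* of B in B_2, hence maps to B_1 (x) B_2. So the coordinates of the sections  *)
(* at r in R, taken in a dual basis of B, do not depend on the chosen algebra; *)
(* they are compatible functions on a flat cover of the center of B and        *)
(* descend.                                                                    *)

Require Import Defs.
From HB Require Import structures.
From mathcomp Require Import perm ring boolp classical_sets cardinality.

Set Implicit Arguments.
Unset Strict Implicit.
Unset Printing Implicit Defensive.

Import GRing.Theory.
Local Open Scope ring_scope.

(** Everything rests on one property of an Azumaya algebra A. Suppose that a ring T receives A with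
    the scalars of A acting centrally. Then the enveloping elements e_j project T onto the
    centralizer of A ([bimod_actC]), and the sum of the x_j e_j is the identity
    ([bimod_act_decomp]). So T is A times its centralizer. [azumaya_has_data] and [data_azumaya]
    translate between Azumaya algebras and such data. Tensor products ([tensor_azumaya]) and
    centralizers ([centralizer_azumaya]) of Azumaya algebras are then again Azumaya.

    Each of the three functors on sheaves is precomposition with a functor of sites, and
    [sheaf_condition_precomp] asks two things of it: the image of a cover is a cover, and two
    factorizations of an arrow through the image come from a common one. Forgetting the map from A
    is immediate ([forget_span]). For commutative algebras the common factorization is a pushout
    ([inclusion_span]). For A (x)_C - it is the centralizer of A ([tensor_span]). There,
    [tensor_cover] needs A to have constant degree locally, which is [azumaya_locally_square]. A
    determinant expansion makes A free locally. The rank is a square because it can be read at a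
    complex point ([nullstellensatz]), where A is a matrix algebra ([azumaya_rank_square]).

    For [Rep_sheaf], the values of a matching family on two algebras under B are compared in one
    algebra that receives both ([merge_exists]). Their coordinates in a dual basis of B are
    therefore compatible functions on a flat cover of the center of B. These descend by
    [structure_sheaf], that is, by faithfully flat descent for rings ([ff_descent]). Finally
    [Rep_image] identifies the composite, and [etale_le_flat] and [zariski_le_flat] pass to the
    coarser topologies. *)

(** * Sheaf conditions and generated topologies *)

Section Sheaves.
Variable C : category.

Definition sheaf_condition (F : presheaf C) (X : C) (S : arrows X) : Prop :=
  forall x : (forall Y (f : hom Y X), S Y f -> F Y), matching x ->
    exists! a : F X, forall Y (f : hom Y X) (Sf : S Y f), restr F f a = x Y f Sf.

Lemma arrows_ext (X : C) (S T : arrows X) :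
  (forall Y f, S Y f <-> T Y f) -> S = T.
Proof.
move=> h; apply: functional_extensionality_dep => Y.
by apply: functional_extensionality_dep => f; apply/propext.
Qed.

Lemma pullback_sieve_comp (X Y Z : C) (f : hom Y X) (g : hom Z Y) S :
  pullback_sieve g (pullback_sieve f S) = pullback_sieve (comp f g) S.
Proof.
by apply: arrows_ext => W h; rewrite /pullback_sieve comp_assoc.
Qed.

Lemma is_sieve_pullback (X Y : C) (f : hom Y X) S :
  is_sieve S -> is_sieve (pullback_sieve f S).
Proof.
by move=> sS Z W g h; rewrite /pullback_sieve comp_assoc => /sS; apply.
Qed.

Lemma pullback_sieve_in (X Y : C) (f : hom Y X) S :
  is_sieve S -> S Y f -> pullback_sieve f S = fun _ _ => True.
Proof. by move=> sS Sf; apply: arrows_ext => Z g; split=> // _; apply: sS. Qed.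

Lemma pullback_sieve_id (X : C) (S : arrows X) : pullback_sieve (idm X) S = S.
Proof. by apply: arrows_ext => Y f; rewrite /pullback_sieve comp_idl. Qed.

Lemma sieve_of_familyP (X : C) I (Y : I -> C) (f : forall i, hom (Y i) X) :
  is_sieve (sieve_of_family f).
Proof.
by move=> Z W h k [i [g ->]]; exists i, (comp g k); rewrite comp_assoc.
Qed.

Lemma topology_sup (J : covering C) (X : C) (S T : arrows X) : is_topology J ->
  J X S -> is_sieve T -> (forall Y f, S Y f -> T Y f) -> J X T.
Proof.
move=> tJ JS sT ST; apply: (top_trans tJ JS) => // Y f /ST Tf.
by rewrite pullback_sieve_in //; apply: top_max.
Qed.

Lemma generated_cover (K : covers C) X I Y (f : forall i : I, hom (Y i) X) :
  K X I Y f -> generated K (sieve_of_family f).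
Proof. by move=> Kf J tJ; apply. Qed.

Lemma sieves_topology : is_topology (@is_sieve C).
Proof. by split=> //; move=> X Y f S; exact: is_sieve_pullback. Qed.

Lemma generated_topology (K : covers C) : is_topology (generated K).
Proof.
split.
- move=> X S /(_ _ sieves_topology); apply=> *; exact: sieve_of_familyP.
- by move=> X J tJ _; exact: (top_max tJ).
- by move=> X Y f S gS J tJ h; apply: (top_pullback tJ); exact: gS.
- move=> X S R gS sR gR J tJ h; apply: (top_trans tJ (gS J tJ h)) => // Y f Sf.
  exact: gR.
Qed.

Section Universal.
Variable F : presheaf C.

Lemma sheaf_condition_max (X : C) :
  sheaf_condition F (fun Y (f : hom Y X) => True).
Proof.
move=> x mx; exists (x X (idm X) I); split.
- move=> Y f []; rewrite (mx X Y (idm X) f I I).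
  by move: (comp_idl f) => e; rewrite e.
- by move=> a /(_ _ (idm X) I) <-; rewrite restr_id.
Qed.

(** This is the finest topology for which F is a sheaf. A generated topology lies inside it as soon
    as its generating families do. *)
Definition universally_sheaf : covering C := fun X S =>
  is_sieve S /\ forall Y (f : hom Y X), sheaf_condition F (pullback_sieve f S).

Lemma universally_sheafW X (S : arrows X) :
  universally_sheaf S -> sheaf_condition F S.
Proof. by move=> [_ /(_ X (idm X))]; rewrite pullback_sieve_id. Qed.

Lemma section_eq (X : C) (S : arrows X)
    (x : forall Y (f : hom Y X), S Y f -> F Y) Y (f g : hom Y X) Sf Sg :
  f = g -> x Y f Sf = x Y g Sg.
Proof. by move=> e; subst g; rewrite (Prop_irrelevance Sf Sg). Qed.

(** The family on R is first glued over the source of each arrow of S. The resulting sections match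
    because the pullbacks of R separate sections, so they glue along S. *)
Lemma sheaf_condition_trans (X : C) (S R : arrows X) :
  universally_sheaf S -> is_sieve R ->
  (forall Y (f : hom Y X), S Y f -> universally_sheaf (pullback_sieve f R)) ->
  sheaf_condition F R.
Proof.
move=> uS sR SR x mx.
have glue Y (f : hom Y X) (Sf : S Y f) : {a : F Y |
    forall Z (g : hom Z Y) (Rfg : R Z (comp f g)),
      restr F g a = x Z (comp f g) Rfg}.
  apply: cid; pose y Z g (Rg : pullback_sieve f R g) := x Z (comp f g) Rg.
  have my : matching y.
    move=> Z W g h Rg Rgh; rewrite /y (mx _ _ _ _ _ (sR _ _ _ h Rg)).
    by apply: section_eq; rewrite comp_assoc.
  by have [a [ha _]] := universally_sheafW (SR Y f Sf) my; exists a.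
(* Separatedness: both a and b glue the matching family of restrictions of a. *)
have sep Y (T : arrows Y) (a b : F Y) : universally_sheaf T ->
    (forall Z (g : hom Z Y), T Z g -> restr F g a = restr F g b) -> a = b.
  move=> uT ab; pose y Z g (_ : T Z g) := restr F g a.
  have my : matching y by move=> Z W g h Rg Rgh; rewrite /y restr_comp.
  have [c [_ hc]] := universally_sheafW uT my.
  by rewrite -(hc a) // -(hc b) // => Z g Tg; rewrite /y ab.
pose y Y f (Sf : S Y f) := sval (glue Y f Sf).
have my : matching y.
  move=> Y Z f g Sf Sfg; apply: (sep _ _ _ _ (SR _ _ Sfg)) => W h Rfgh.
  rewrite /y; case: (glue _ _ Sf) => c hc; case: (glue _ _ Sfg) => d hd /=.
  rewrite -restr_comp (hd _ _ Rfgh).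
  have R' : R W (comp f (comp g h)) by rewrite comp_assoc.
  by rewrite (hc _ _ R'); apply: section_eq; rewrite comp_assoc.
have [a [ha ua]] := universally_sheafW uS my; exists a; split=> [Y f Rf|b hb].
  have uSf : universally_sheaf (pullback_sieve f S).
    split=> [|Z g]; first by apply: is_sieve_pullback; exact: uS.1.
    by rewrite pullback_sieve_comp; exact: uS.2.
  apply: (sep _ _ _ _ uSf) => Z g Sg; rewrite -restr_comp (ha _ _ Sg) /y.
  case: (glue _ _ _) => /= c hc; rewrite (mx _ _ _ _ _ (sR _ _ _ g Rf)).
  have R' : R Z (comp (comp f g) (idm Z)) by rewrite comp_idr; exact: sR.
  by rewrite -[c]restr_id (hc _ _ R'); apply: section_eq; exact: comp_idr.
apply: ua => Y f Sf; apply: (sep _ _ _ _ (SR _ _ Sf)) => Z g Rfg.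
by rewrite -restr_comp (hb _ _ Rfg) /y; case: (glue _ _ _) => c ->.
Qed.

Lemma universally_sheaf_topology : is_topology universally_sheaf.
Proof.
split.
- by move=> X S [].
- by move=> X; split=> // Y f; exact: sheaf_condition_max.
- move=> X Y f S [sS uS]; split; first exact: is_sieve_pullback.
  by move=> Z g; rewrite pullback_sieve_comp.
- move=> X S R uS sR SR; split=> // Y f.
  apply: (@sheaf_condition_trans _ (pullback_sieve f S)).
  + split; first by apply: is_sieve_pullback; exact: uS.1.
    by move=> Z g; rewrite pullback_sieve_comp; exact: uS.2.
  + exact: is_sieve_pullback.
  + by move=> Z g Sfg; rewrite pullback_sieve_comp; exact: SR.
Qed.

(** The hypothesis puts the generating sieves in [universally_sheaf], which is a topology and so
    contains all generated covers. *)
Lemma sheaf_generated (K : covers C) :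
  (forall X I Y (f : forall i : I, hom (Y i) X), K X I Y f ->
     forall Z (g : hom Z X),
     sheaf_condition F (pullback_sieve g (sieve_of_family f))) ->
  is_sheaf (generated K) F.
Proof.
move=> hK X S gS; apply: (@universally_sheafW X S).
apply: gS => [|Y I Z f Kf]; first exact: universally_sheaf_topology.
by split; [exact: sieve_of_familyP | exact: hK].
Qed.

Lemma is_sheafW (J J' : covering C) :
  (forall X S, J' X S -> J X S) -> is_sheaf J F -> is_sheaf J' F.
Proof. by move=> JJ' sF X S /JJ'; exact: sF. Qed.
End Universal.

Lemma generated_le (K : covers C) (J : covering C) : is_topology J ->
  (forall X I Y (f : forall i : I, hom (Y i) X), K X I Y f ->
    J X (sieve_of_family f)) ->
  forall X S, @generated C K X S -> J X S.
Proof. by move=> tJ h X S; apply. Qed.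
End Sheaves.

(** * Sheaves under precomposition with a functor of sites *)

Section Precomposition.
Variables (C D : category) (U : functor C D) (F : presheaf D).

Definition image_sieve (X : C) (S : arrows X) : arrows (U X) :=
  fun Z h => exists (Y : C) (f : hom Y X) (g : hom Z (U Y)),
    S Y f /\ h = comp (fmap U f) g.

Lemma image_sieveP X (S : arrows X) : is_sieve (image_sieve S).
Proof.
move=> Y Z _ h [W [f [g [Sf ->]]]]; exists W, f, (comp g h).
by rewrite comp_assoc.
Qed.

(* The last hypothesis says that the category of factorizations of an arrow   *)
(* through the image of S has enough spans coming from C.                     *)
Lemma sheaf_condition_precomp (J : covering D) (X : C) (S : arrows X) :
  is_sheaf J F -> is_sieve S -> J (U X) (image_sieve S) ->
  (forall Z Y Y' (f : hom Y X) (f' : hom Y' X) (g : hom Z (U Y))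
     (g' : hom Z (U Y')), S Y f -> S Y' f' ->
     comp (fmap U f) g = comp (fmap U f') g' ->
     exists W (a : hom W Y) (a' : hom W Y') (m : hom Z (U W)),
     [/\ comp f a = comp f' a', g = comp (fmap U a) m
       & g' = comp (fmap U a') m]) ->
  sheaf_condition (precomp U F) S.
Proof.
move=> sF sS JS span x mx.
(* Through the span both sides become the restriction along m of one section over W. Hence the
   family extends to the image sieve without ambiguity. *)
have indep Z Y Y' f f' (g : hom Z (U Y)) (g' : hom Z (U Y')) Sf Sf' :
    comp (fmap U f) g = comp (fmap U f') g' ->
    restr F g (x Y f Sf) = restr F g' (x Y' f' Sf').
  move=> /(span _ _ _ _ _ _ _ Sf Sf') [W [a [a' [m [e -> ->]]]]].
  rewrite !restr_comp; congr restr.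
  rewrite -[LHS]/(restr (precomp U F) a _) -[RHS]/(restr (precomp U F) a' _).
  rewrite (mx _ _ _ _ _ (sS _ _ _ a Sf)) (mx _ _ _ _ _ (sS _ _ _ a' Sf')).
  exact: (@section_eq _ (precomp U F)).
have ext Z (h : hom Z (U X)) (Sh : image_sieve S h) : {b : F Z |
    forall Y (f : hom Y X) (g : hom Z (U Y)) (Sf : S Y f),
      h = comp (fmap U f) g -> b = restr F g (x Y f Sf)}.
  apply: cid; case: Sh => Y [f [g [Sf ->]]]; exists (restr F g (x Y f Sf)).
  by move=> Y' f' g' Sf'; exact: indep.
pose y Z h (Sh : image_sieve S h) := sval (ext Z h Sh).
have my : matching y.
  move=> Y Z h k Sh Shk; rewrite /y.
  case: (ext _ _ Sh) => b hb; case: (ext _ _ Shk) => c hc /=.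
  case: Sh hb => W [f [g [Sf eh]]] /(_ _ _ _ Sf eh) ->; rewrite -restr_comp.
  by rewrite (hc _ f (comp g k) Sf) // eh comp_assoc.
have [a [ha ua]] := sF _ _ JS y my; exists a; split=> [Y f Sf|b hb].
  have Sf' : image_sieve S (fmap U f).
    by exists Y, f, (idm _); rewrite comp_idr.
  rewrite -[LHS]/(restr F (fmap U f) a) (ha _ _ Sf') /y.
  case: (ext _ _ _) => /= b /(_ Y f (idm _) Sf) ->; rewrite ?restr_id //.
  by rewrite comp_idr.
apply: ua => Z h Sh; rewrite /y; case: (ext _ _ Sh) => c hc /=.
case: Sh hc => Y [f [g [Sf eh]]] /(_ _ _ _ Sf eh) ->.
by rewrite eh restr_comp; congr restr; exact: hb.
Qed.
End Precomposition.
Arguments image_sieve {C D} U {X} S _ _.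

(** * Bundled morphisms from functions and their laws *)

Section MorphismConstructors.
Variables (U V : zmodType) (f : U -> V).

(** The law is an argument of the alias so that a morphism structure can be attached to it. The ring
    and linear versions follow the same pattern. *)
Definition as_additive (fD : {morph f : x y / x + y}) : U -> V := f.

Section Additive.
Hypothesis fD : {morph f : x y / x + y}.
Fact as_additive_zmod : zmod_morphism (as_additive fD).
Proof.
by move=> x y; apply/eqP; rewrite eq_sym subr_eq /as_additive -fD subrK.
Qed.
HB.instance Definition _ :=
  GRing.isZmodMorphism.Build U V (as_additive fD) as_additive_zmod.
Definition additive_of : {additive U -> V} :=
  [the {additive U -> V} of as_additive fD].
End Additive.
End MorphismConstructors.

Section RingMorphismConstructor.
Variables (U V : pzRingType) (f : U -> V).

Definition as_rmorph (fD : {morph f : x y / x + y})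
  (fM : {morph f : x y / x * y}) (f1 : f 1 = 1) : U -> V := f.

Hypotheses (fD : {morph f : x y / x + y}) (fM : {morph f : x y / x * y})
  (f1 : f 1 = 1).
HB.instance Definition _ := GRing.isZmodMorphism.Build U V (as_rmorph fD fM f1)
  (as_additive_zmod fD).
Fact as_rmorph_monoid : monoid_morphism (as_rmorph fD fM f1).
Proof. by split. Qed.
HB.instance Definition _ := GRing.isMonoidMorphism.Build U V
  (as_rmorph fD fM f1) as_rmorph_monoid.
Definition rmorph_of : {rmorphism U -> V} :=
  [the {rmorphism U -> V} of as_rmorph fD fM f1].
End RingMorphismConstructor.

Section LinearConstructor.
Variables (K : pzRingType) (U V : lmodType K) (f : U -> V).

Definition as_linear (fD : {morph f : x y / x + y})
  (fZ : forall k, {morph f : x / k *: x}) : U -> V := f.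

Hypotheses (fD : {morph f : x y / x + y}) (fZ : forall k, {morph f : x / k *: x}).
Fact as_linear_linear : linear (as_linear fD fZ).
Proof. by move=> k x y; rewrite /as_linear fD fZ. Qed.
HB.instance Definition _ := GRing.isLinear.Build K U V *:%R (as_linear fD fZ)
  as_linear_linear.
Definition linear_of : {linear U -> V} :=
  [the {linear U -> V} of as_linear fD fZ].
End LinearConstructor.

(** * Maps out of tensor products; determinants modulo an ideal *)

Section TensorLift.
Variables (K : comPzRingType) (A B : alg K).

Lemma tten_suml I (r : seq I) (F : I -> A) b :
  tten (\sum_(i <- r) F i) b = \sum_(i <- r) tten (F i) b :> tring A B.
Proof.
elim/big_rec2: _ => [|i _ y _ <-]; last by rewrite -ttenDl.
by rewrite -[X in tten X _](subrr 0) ttenBl subrr.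
Qed.

Lemma tten_sumr I (r : seq I) (F : I -> B) a :
  tten a (\sum_(i <- r) F i) = \sum_(i <- r) tten a (F i) :> tring A B.
Proof.
elim/big_rec2: _ => [|i _ y _ <-]; last by rewrite -ttenDr.
by rewrite -[X in tten _ X](subrr 0) ttenBr subrr.
Qed.

Lemma tten0l b : tten 0 b = 0 :> tring A B.
Proof. by rewrite -[X in tten X _](subrr 0) ttenBl subrr. Qed.

Lemma tring_eq (V : nmodType) (f g : {additive tring A B -> V}) :
  (forall a b, f (tten a b) = g (tten a b)) -> f =1 g.
Proof.
move=> fg; elim/tring_ind => [|//|x y fx fy]; first by rewrite !raddf0.
by rewrite !raddfD fx fy.
Qed.

Lemma tring_repr (t : tring A B) :
  exists s : seq (A * B), t = \sum_(p <- s) tten p.1 p.2.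
Proof.
elim/tring_ind: t => [|a b|x y [s ->] [s' ->]].
- by exists [::]; rewrite big_nil.
- by exists [:: (a, b)]; rewrite big_seq1.
- by exists (s ++ s'); rewrite big_cat.
Qed.

Lemma tring_additive (V : zmodType) (b : A -> B -> V) :
  (forall x x' y, b (x + x') y = b x y + b x' y) ->
  (forall x y y', b x (y + y') = b x y + b x y') ->
  (forall k x y, b (alg_str A k * x) y = b x (alg_str B k * y)) ->
  exists f : {additive tring A B -> V}, forall x y, f (tten x y) = b x y.
Proof.
move=> bl br bz; have hb : @balanced K (as_mod A) (as_mod B) V b by split.
exists (additive_of (tliftD hb)) => x y; exact: (tlift_tens hb).
Qed.

(** The target may be noncommutative as long as the two images commute, as happens for an algebra
    and its centralizer. *)
Lemma tring_lift (T : pzRingType) (f : {rmorphism A -> T})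
    (g : {rmorphism B -> T}) :
  (forall k, f (alg_str A k) = g (alg_str B k)) ->
  (forall a b, GRing.comm (f a) (g b)) ->
  exists h : {rmorphism tring A B -> T}, forall a b, h (tten a b) = f a * g b.
Proof.
move=> fg fgC.
have [||k x y|h hE] := @tring_additive T (fun a b => f a * g b).
- by move=> *; rewrite rmorphD mulrDl.
- by move=> *; rewrite rmorphD mulrDr.
- by rewrite !rmorphM -fg !mulrA -!rmorphM (alg_central k x).
have h1 : h 1 = 1 by rewrite -tten1 hE !rmorph1 mulr1.
have hM : {morph h : x y / x * y}.
  move=> x y; elim/tring_ind: x => [|a b|x x' hx hx'].
  - by rewrite mul0r raddf0 mul0r.
  - elim/tring_ind: y => [|a' b'|y y' hy hy'].
    + by rewrite mulr0 raddf0 mulr0.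
    + rewrite ttenM !hE !rmorphM -!mulrA; congr (_ * _).
      by rewrite !mulrA (fgC a' b).
    + by rewrite mulrDr !raddfD mulrDr hy hy'.
  - by rewrite mulrDl !raddfD mulrDl hx hx'.
by exists (rmorph_of (@raddfD _ _ h) hM h1).
Qed.

Lemma tringC (T : pzRingType) (f : {rmorphism tring A B -> T}) z :
  (forall a, GRing.comm z (f (tten a 1))) ->
  (forall b, GRing.comm z (f (tten 1 b))) -> forall t, GRing.comm z (f t).
Proof.
move=> zA zB; elim/tring_ind => [|a b|x y hx hy].
- by rewrite raddf0; exact: commr0.
- have -> : tten a b = tten a 1 * tten 1 b :> tring A B.
    by rewrite ttenM mulr1 mul1r.
  by rewrite rmorphM; exact: commrM.
- by rewrite raddfD; exact: commrD.
Qed.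
End TensorLift.

Section IdealCongruence.
Variables (K : comPzRingType) (I : K -> Prop).
Hypotheses (I0 : I 0) (ID : forall x y, I x -> I y -> I (x + y)).
Hypothesis IM : forall x y, I y -> I (x * y).

(** In the Leibniz formula the products are compared one factor at a time. This serves the
    determinant trick in [azumaya_split]. *)
Lemma det_congruence n (M N : 'M[K]_n) :
  (forall j k, I (M j k - N j k)) -> I (\det M - \det N).
Proof.
move=> MN; rewrite -sumrB; elim/big_rec: _ => // s x _; apply: ID; move: (s : {perm 'I_n}) => {}s.
rewrite -mulrBr; apply: IM; elim/big_rec2: _ => [|i x' y _ h].
  by rewrite subrr.
have -> : M i (s i) * y - N i (s i) * x' =
    y * (M i (s i) - N i (s i)) + N i (s i) * (y - x').
  by rewrite !mulrBr [y * M _ _]mulrC [y * N _ _]mulrC addrA subrK.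
by apply: ID; apply: IM.
Qed.
End IdealCongruence.

(** * Azumaya algebras through dual bases and enveloping elements *)

Section BimoduleAction.
Variables (A T : pzRingType) (h : A -> T).
(** The list represents an element of A (x) A^op, acting on T as an A-bimodule through h. *)
Definition bimod_act (s : seq (A * A)) (y : T) : T :=
  \sum_(p <- s) h p.1 * y * h p.2.

Lemma bimod_actD s : {morph bimod_act s : x y / x + y}.
Proof.
move=> x y; rewrite -big_split; apply: eq_bigr => p _.
by rewrite mulrDr mulrDl.
Qed.
End BimoduleAction.

Local Notation opten A := (@tten _ A (op_alg A)).

(* The x_j and l_j form a dual basis; e_j is the element of A (x) A^op acting *)
(* as a |-> l_j(a) 1, and m splits the inclusion K -> A.                      *)
Record azumaya_data (K : comPzRingType) (A : alg K) := AzumayaData {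
  ad_index : finType;
  ad_x : ad_index -> A;
  ad_e : ad_index -> seq (A * A);
  ad_l : ad_index -> {additive A -> K};
  ad_m : {additive A -> K};
  ad_eC : forall b j,
    \sum_(p <- ad_e j) opten A (b * p.1) p.2 =
    \sum_(p <- ad_e j) opten A p.1 (p.2 * b : A) :> tring A (op_alg A);
  ad_xe : \sum_j \sum_(p <- ad_e j) opten A (ad_x j * p.1) p.2 =
    1 :> tring A (op_alg A);
  ad_el : forall j a, bimod_act idfun (ad_e j) a = alg_str A (ad_l j a);
  ad_lZ : forall j k a, ad_l j (alg_str A k * a) = k * ad_l j a;
  ad_mZ : forall k a, ad_m (alg_str A k * a) = k * ad_m a;
  ad_m1 : ad_m 1 = 1
}.

Arguments ad_x {K A} _ _.
Arguments ad_e {K A} _ _.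
Arguments ad_l {K A} _ _.
Arguments ad_eC {K A} _ _ _.
Arguments ad_xe {K A} _.

Section SandwichSum.
Variables (K : comPzRingType) (A : alg K).

Lemma ttenM_op (a a' b b' : A) :
  opten A a b * opten A a' b' = opten A (a * a') (b' * b : A).
Proof. by rewrite ttenM. Qed.

Lemma sandwich_funD (r : as_mod A) :
  {morph (fun t => @sandwich_fun K A t r) : t u / t + u}.
Proof. by move=> t u; rewrite /sandwich_fun (tliftD (sandwich_balanced _)). Qed.

Lemma sandwich_fun0 (r : as_mod A) : @sandwich_fun K A 0 r = 0.
Proof. by rewrite /sandwich_fun (tlift0 (sandwich_balanced _)). Qed.

Lemma sandwich_fun_sum I (s : seq I) (F : I -> tring A (op_alg A)) r :
  sandwich_fun (\sum_(i <- s) F i) r = \sum_(i <- s) sandwich_fun (F i) r.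
Proof. exact: (big_morph _ (sandwich_funD r) (sandwich_fun0 r)). Qed.
End SandwichSum.

Section FromAzumaya.
Variables (K : comPzRingType) (A : alg K).
Hypothesis azA : azumaya A.

Lemma sandwich_inj (t u : tring A (op_alg A)) :
  sandwich_fun t =1 sandwich_fun u -> t = u.
Proof. by move=> tu; apply: (bij_inj (azumaya_iso azA)); exact: linear_ext. Qed.

Lemma azumaya_endomorphism (f : A -> A) : {morph f : x y / x + y} ->
  (forall k a, f (alg_str A k * a) = alg_str A k * f a) ->
  exists s : seq (A * A), forall a, bimod_act idfun s a = f a.
Proof.
move=> fD fZ; have [g gK Kg] := azumaya_iso azA.
have fD' : {morph (f : as_mod A -> as_mod A) : x y / x + y} by exact: fD.
have fZ' k : {morph (f : as_mod A -> as_mod A) : a / k *: a} by move=> a; exact: fZ.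
have [s hs] := tring_repr (g (linear_of fD' fZ')).
exists s => a; have := Kg (linear_of fD' fZ').
move=> /(congr1 (fun f : {linear as_mod A -> as_mod A} => f a)) /=.
rewrite hs sandwich_fun_sum /as_linear => <-.
by apply: eq_bigr => -[u v] _; rewrite sandwich_tten.
Qed.

(** Let I be the trace ideal, generated by the values of the l_j. Since A = I A, the determinant
    trick gives an element congruent to 1 modulo I that annihilates A. It is 0 because A is
    faithful, so 1 = sum l_j(y_j) and m(a) = sum l_j(a y_j) is the splitting. *)
Lemma azumaya_split n (x : 'I_n -> A) (l : 'I_n -> {additive A -> K}) :
  (forall j k a, l j (alg_str A k * a) = k * l j a) ->
  (forall a, a = \sum_j alg_str A (l j a) * x j) ->
  exists m : {additive A -> K},
    (forall k a, m (alg_str A k * a) = k * m a) /\ m 1 = 1.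
Proof.
move=> lZ lx.
pose I (k : K) := exists y : 'I_n -> A, k = \sum_j l j (y j).
have I0 : I 0 by exists (fun=> 0); rewrite big1 // => j _; rewrite raddf0.
have ID k k' : I k -> I k' -> I (k + k').
  move=> [y ->] [y' ->]; exists (fun j => y j + y' j).
  by rewrite -big_split; apply: eq_bigr => j _; rewrite raddfD.
have IM k k' : I k' -> I (k * k').
  move=> [y ->]; exists (fun j => alg_str A k * y j).
  by rewrite mulr_sumr; apply: eq_bigr => j _; rewrite lZ.
(* M kills the vector of the x_j by the dual basis property, so det M kills every x_j by Cramer's
   rule. *)
pose M := 1%:M - \matrix_(j < n, k < n) l k (x j) : 'M[K]_n.
have I1 : I (\det M - \det (1%:M : 'M[K]_n)).
  apply: det_congruence => // j k; rewrite !mxE addrAC subrr add0r -mulN1r.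
  apply: IM; exists (fun i => if i == k then x j else 0).
  rewrite (bigD1 k) //= eqxx big1 ?addr0 // => i /negPf ->.
  by rewrite raddf0.
have Mx k : \sum_j alg_str A (M k j) * x j = 0.
  under eq_bigr do rewrite !mxE rmorphB mulrBl.
  rewrite sumrB -lx (bigD1 k) //= big1 ?eqxx ?rmorph1 ?mul1r ?addr0 ?subrr //.
  by move=> i /negPf; rewrite eq_sym => ->; rewrite rmorph0 mul0r.
have detx j : alg_str A (\det M) * x j = 0.
  transitivity (\sum_k alg_str A ((\adj M *m M) j k) * x k).
    rewrite mul_adj_mx (bigD1 j) //= mxE eqxx mulr1n big1 ?addr0 // => k.
    by rewrite eq_sym mxE => /negPf ->; rewrite rmorph0 mul0r.
  under eq_bigr do rewrite mxE rmorph_sum mulr_suml.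
  rewrite exchange_big big1 // => k _.
  under eq_bigr do rewrite rmorphM -mulrA.
  by rewrite -mulr_sumr Mx mulr0.
have det0 : \det M = 0.
  apply: (azumaya_faithful azA) => a; rewrite as_mod_scaleE (lx a) mulr_sumr.
  rewrite big1 // => j _.
  by rewrite mulrA (alg_central (\det M)) -mulrA detx mulr0.
move: I1; rewrite det0 det1 => /(IM (-1)); rewrite sub0r mulrNN mulr1 => -[y y1].
have mD : {morph (fun a => \sum_j l j (a * y j)) : a b / a + b}.
  by move=> a b; rewrite -big_split; apply: eq_bigr => j _; rewrite mulrDl raddfD.
exists (additive_of mD); split=> [k a|].
  rewrite /= /as_additive mulr_sumr; apply: eq_bigr => j _.
  by rewrite -mulrA lZ.
by rewrite /= /as_additive y1; apply: eq_bigr => j _; rewrite mul1r.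
Qed.

(** The identities [ad_eC] and [ad_xe] can be tested on A because the sandwich map is injective. The
    first holds since l_j(a) 1 is central, the second since the dual basis recovers a. *)
Lemma azumaya_has_data : inhabited (azumaya_data A).
Proof.
have [n [i [p ip]]] := azumaya_projective azA.
pose x (j : 'I_n) : A := p (delta_mx 0 j).
have lD (j : 'I_n) : {morph (fun a : A => (i a : 'rV[K]_n) 0 j) : a b / a + b}.
  by move=> a b; rewrite [i _](raddfD i) mxE.
pose l j := additive_of (lD j).
have lZ j k a : l j (alg_str A k * a) = k * l j a.
  rewrite -[LHS]/((i (k *: (a : as_mod A)) : 'rV[K]_n) 0 j).
  by rewrite linearZ_LR mxE.
have lx (a : A) : a = \sum_j alg_str A (l j a) * x j.
  rewrite -[LHS]ip [i a]row_sum_delta (raddf_sum p); apply: eq_bigr => j _.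
  exact: (linearZ_LR p).
have [m [mZ m1]] := azumaya_split lZ lx.
have e j : {s : seq (A * A) |
    forall a, bimod_act idfun s a = alg_str A (l j a)}.
  apply: cid; apply: azumaya_endomorphism => [a b|k a].
    by rewrite !raddfD.
  by rewrite lZ rmorphM.
constructor; apply: (@AzumayaData K A _ x (fun j => sval (e j)) l m) => //.
- move=> b j; case: (e j) => s hs /=; apply: sandwich_inj => a.
  rewrite !sandwich_fun_sum.
  transitivity (b * bimod_act idfun s a).
    rewrite mulr_sumr; apply: eq_bigr => -[u v] _.
    by rewrite sandwich_tten /= !mulrA.
  transitivity (bimod_act idfun s a * b).
    by rewrite hs; exact/esym/alg_central.
  rewrite mulr_suml; apply: eq_bigr => -[u v] _.
  by rewrite sandwich_tten /= !mulrA.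
- apply: sandwich_inj => a; rewrite sandwich_fun_sum -tten1 sandwich_tten.
  rewrite mul1r mulr1 [RHS]lx; apply: eq_bigr => j _.
  case: (e j) => s hs /=; rewrite alg_central -hs mulr_sumr sandwich_fun_sum.
  by apply: eq_bigr => -[u v] _; rewrite sandwich_tten /= !mulrA.
- by move=> j a; case: (e j).
Qed.
End FromAzumaya.

Record dual_basis (K : comPzRingType) (A : alg K) (J : finType) (x : J -> A)
    (l : J -> {additive A -> K}) : Prop := DualBasis {
  db_lZ : forall j k a, l j (alg_str A k * a) = k * l j a;
  db_decomp : forall a, a = \sum_j alg_str A (l j a) * x j
}.

Lemma dual_basis_ord (K : comPzRingType) (A : alg K) (J : finType) (x : J -> A) l :
  dual_basis x l -> @dual_basis K A 'I_#|J| (x \o enum_val) (l \o enum_val).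
Proof.
move=> [lZ lx]; split=> [j k a|a]; first exact: lZ.
by rewrite [LHS]lx [LHS](reindex _ (onW_bij _ (enum_val_bij J))).
Qed.

Lemma dual_basis_projective (K : comPzRingType) (A : alg K) (J : finType)
    (x : J -> A) l : dual_basis x l -> fg_projective (as_mod A).
Proof.
move=> /dual_basis_ord [mZ my]; pose y := x \o @enum_val J predT.
pose m := l \o @enum_val J predT.
pose i (a : as_mod A) : 'rV[K]_#|J| := \row_j m j a.
have iD : {morph i : a b / a + b}.
  by move=> a b; apply/rowP=> j; rewrite !mxE raddfD.
have iZ k : {morph i : a / k *: a}.
  by move=> a; apply/rowP=> j; rewrite !mxE as_mod_scaleE mZ.
pose p (v : 'rV[K]_#|J|) : as_mod A := \sum_j alg_str A (v 0 j) * y j.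
have pD : {morph p : a b / a + b}.
  move=> a b; rewrite /p -big_split; apply: eq_bigr => j _.
  by rewrite mxE rmorphD mulrDl.
have pZ k : {morph p : a / k *: a}.
  move=> a; rewrite /p as_mod_scaleE mulr_sumr; apply: eq_bigr => j _.
  by rewrite mxE rmorphM mulrA.
exists #|J|, (linear_of iD iZ), (linear_of pD pZ) => a.
rewrite /= /as_linear /p [RHS](my a); apply: eq_bigr => j _.
by rewrite mxE.
Qed.

Section Data.
Variables (K : comPzRingType) (A : alg K) (d : azumaya_data A).

Section Action.
Variables (T : pzRingType) (h : {rmorphism A -> T}) (y : T).
Hypothesis hy : forall k, GRing.comm (h (alg_str A k)) y.

Lemma op_additive : exists f : {additive tring A (op_alg A) -> T},
  forall a b : A, f (opten A a b) = h a * y * h b.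
Proof.
apply: (@tring_additive K A (op_alg A) T (fun a (b : A) => h a * y * h b)).
- by move=> *; rewrite rmorphD !mulrDl.
- by move=> *; rewrite rmorphD mulrDr.
- move=> k a b; rewrite -[alg_str (op_alg A) k * b]/((b : A) * alg_str A k).
  rewrite (alg_central k a) -(alg_central k (b : A)) !rmorphM -!mulrA.
  by congr (_ * _); rewrite !mulrA hy.
Qed.

(** The map a (x) b -> h(a) y h(b) is well defined because scalars commute with y. Applied to b e_j
    = e_j b, it shows that e_j y centralizes A. *)
Lemma bimod_actC b j :
  GRing.comm (h b) (bimod_act h (ad_e d j) y).
Proof.
have [f hf] := op_additive; have /(congr1 f) := ad_eC d b j.
rewrite !raddf_sum /GRing.comm /bimod_act mulr_sumr mulr_suml => e.
transitivity (\sum_(p <- ad_e d j) f (opten A (b * p.1) p.2)).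
  by apply: eq_bigr => p _; rewrite hf rmorphM !mulrA.
by rewrite e; apply: eq_bigr => p _; rewrite hf rmorphM !mulrA.
Qed.

(** This is the identity sum x_j e_j = 1 applied to y. Together with [bimod_actC] it writes T as A
    times the centralizer of A. *)
Lemma bimod_act_decomp :
  \sum_j h (ad_x d j) * bimod_act h (ad_e d j) y = y.
Proof.
have [f hf] := op_additive; have /(congr1 f) := ad_xe d.
rewrite -tten1 hf !rmorph1 mul1r mulr1 raddf_sum => e; rewrite -[RHS]e.
apply: eq_bigr => j _; rewrite raddf_sum mulr_sumr.
by apply: eq_bigr => p _; rewrite hf rmorphM !mulrA.
Qed.
End Action.

Lemma bimod_act_lin (T : pzRingType) (h : {rmorphism A -> T}) (z : T) a j :
  (forall b, GRing.comm (h b) z) ->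
  bimod_act h (ad_e d j) (h a * z) = h (alg_str A (ad_l d j a)) * z.
Proof.
move=> hz; rewrite -ad_el rmorph_sum mulr_suml; apply: eq_bigr => p _.
by rewrite !rmorphM -!mulrA -(hz p.2).
Qed.

Lemma bimod_act_morph (T : pzRingType) (h : {rmorphism A -> T}) a j :
  bimod_act h (ad_e d j) (h a) = h (alg_str A (ad_l d j a)).
Proof.
rewrite -[h a]mulr1 bimod_act_lin ?mulr1 // => b; exact: commr1.
Qed.

Lemma ad_decomp a : a = \sum_j alg_str A (ad_l d j a) * ad_x d j.
Proof.
rewrite -[LHS](@bimod_act_decomp _ idfun) => [|k]; last exact: alg_central.
by apply: eq_bigr => j _; rewrite ad_el /= alg_central.
Qed.

Lemma ad_str_inj : injective (alg_str A).
Proof.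
move=> k k' e; rewrite -[k]mulr1 -[k']mulr1 -(ad_m1 d) -!ad_mZ.
by rewrite !mulr1 e.
Qed.

Lemma ad_l_inj a b : (forall j, ad_l d j a = ad_l d j b) -> a = b.
Proof.
by move=> ab; rewrite [a]ad_decomp [b]ad_decomp; apply: eq_bigr => j _; rewrite ab.
Qed.

Lemma data_dual_basis : dual_basis (ad_x d) (ad_l d).
Proof. split; [exact: ad_lZ | exact: ad_decomp]. Qed.

(** The inverse of the sandwich map sends phi to sum phi(x_j) e_j. On the map given by a (x) b this
    yields sum a x_j b e_j; moving b across e_j leaves (a (x) b) sum x_j e_j = a (x) b. *)
Lemma data_azumaya : azumaya A.
Proof.
split.
- move=> k /(_ (1 : A)); rewrite as_mod_scaleE mulr1 => k0.
  by apply: ad_str_inj; rewrite k0 rmorph0.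
- exact/dual_basis_projective/data_dual_basis.
- pose g (phi : {linear as_mod A -> as_mod A}) : tring A (op_alg A) :=
    \sum_j \sum_(p <- ad_e d j) opten A ((phi (ad_x d j) : A) * p.1) p.2.
  have gD t u : g (sandwich (t + u)) = g (sandwich t) + g (sandwich u).
    rewrite -big_split; apply: eq_bigr => j _.
    rewrite -big_split; apply: eq_bigr => p _.
    by rewrite /= sandwich_funD mulrDl ttenDl.
  exists g => [t|phi].
  + elim/tring_ind: t => [|a b|t u ht hu]; last by rewrite gD ht hu.
      by apply: (addrI (g (sandwich 0))); rewrite -gD !addr0.
    transitivity (opten A a b *
        \sum_j \sum_(p <- ad_e d j) opten A (ad_x d j * p.1) p.2).
      rewrite mulr_sumr; apply: eq_bigr => j _; rewrite mulr_sumr.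
      transitivity (opten A (a * ad_x d j) (1 : A) *
         \sum_(p <- ad_e d j) opten A ((b : A) * p.1) p.2).
        rewrite mulr_sumr; apply: eq_bigr => p _.
        by rewrite ttenM_op /= sandwich_tten !mulrA mulr1.
      rewrite ad_eC mulr_sumr; apply: eq_bigr => p _.
      by rewrite !ttenM_op mulr1 !mulrA.
    by rewrite ad_xe mulr1.
  + apply: linear_ext => a; rewrite /= sandwich_fun_sum [in RHS](ad_decomp a).
    rewrite (raddf_sum phi); apply: eq_bigr => j _; rewrite sandwich_fun_sum.
    rewrite [RHS](linearZ_LR phi (ad_l d j a) (ad_x d j)) as_mod_scaleE.
    rewrite alg_central -ad_el mulr_sumr.
    by apply: eq_bigr => p _; rewrite sandwich_tten /= !mulrA.
Qed.

(** The map a -> m(a) 1 is a sum of maps a -> p a q. On a central z it therefore equals z times its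
    value at 1, which is z. *)
Lemma ad_center z : central z -> z = alg_str A (ad_m d z).
Proof.
have [||s hs] := @azumaya_endomorphism _ A data_azumaya
  (fun a => alg_str A (ad_m d a)) _ _.
- by move=> a b; rewrite !raddfD.
- by move=> k a; rewrite ad_mZ rmorphM.
move=> cz; rewrite -hs; transitivity (z * bimod_act idfun s 1).
  by rewrite hs ad_m1 rmorph1 mulr1.
rewrite mulr_sumr; apply: eq_bigr => p _.
by rewrite /= mulr1 mulrA cz.
Qed.
End Data.

(** * Tensor products and base change of Azumaya algebras *)

Section TensorData.
Variables (C E : comPzRingType) (A : alg C) (B : alg E).
Variables (s : {rmorphism C -> B}).
Hypothesis s_central : forall c x, GRing.comm (s c) x.

Let BC : alg C := @Alg C B s s_central.
Let T : alg E := @tensor_alg C E A BC (alg_str B) (@alg_central _ B).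

Variable c : C -> E.
Hypothesis sc : forall x, s x = alg_str B (c x).

Lemma tensor_str e a b :
  alg_str T e * tten a b = @tten C A BC a (alg_str B e * b) :> T.
Proof. by rewrite [LHS](@ttenM C A BC) mul1r. Qed.

Lemma tensor_scale x a b :
  @tten C A BC (alg_str A x * a) b = alg_str T (c x) * tten a b.
Proof. by rewrite (@ttenZ C A BC) tensor_str /= sc. Qed.

Lemma tensor_functional (l : {additive A -> C}) (l' : {additive B -> E}) :
  injective (alg_str B) ->
  (forall x a, l (alg_str A x * a) = x * l a) ->
  (forall e b, l' (alg_str B e * b) = e * l' b) ->
  exists f : {additive T -> E},
    (forall a b, f (@tten C A BC a b) = c (l a) * l' b) /\
    (forall e t, f (alg_str T e * t) = e * f t).
Proof.
move=> inj lZ l'Z.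
have [f fE] : exists f : {additive tring A BC -> E},
    forall a b, f (tten a b) = c (l a) * l' b.
  apply: (@tring_additive C A BC E (fun a b => c (l a) * l' b)).
  - move=> a a' b; rewrite raddfD -mulrDl; congr (_ * _); apply: inj.
    by rewrite rmorphD -!sc rmorphD.
  - by move=> a b b'; rewrite raddfD mulrDr.
  - move=> x a b; rewrite lZ /= sc l'Z mulrA; congr (_ * _); apply: inj.
    by rewrite mulrC rmorphM -!sc -rmorphM mulrC.
exists f; split=> // e t; elim/tring_ind: t => [|a b|t u ht hu].
- by rewrite mulr0 raddf0 mulr0.
- by rewrite tensor_str !fE l'Z mulrCA.
- by rewrite mulrDr !raddfD mulrDr ht hu.
Qed.

Lemma tensor_dual_basis (J J' : finType) (x : J -> A) l (x' : J' -> B) l' :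
  injective (alg_str B) -> dual_basis x l -> dual_basis x' l' ->
  exists f : J * J' -> {additive T -> E},
    (forall jk a b, f jk (@tten C A BC a b) = c (l jk.1 a) * l' jk.2 b) /\
    @dual_basis E T _ (fun jk => @tten C A BC (x jk.1) (x' jk.2)) f.
Proof.
move=> inj [lZ lx] [l'Z l'x].
have /choice [f hf] (jk : J * J') :=
  tensor_functional inj (lZ jk.1) (l'Z jk.2).
exists f; split=> [jk|]; first by case: (hf jk).
split=> [jk|t]; first by case: (hf jk).
elim/tring_ind: t => [|a b|t u ht hu].
- by rewrite big1 // => jk _; rewrite raddf0 rmorph0 mul0r.
- pose G j k := alg_str T (f (j, k) (@tten C A BC a b)) * @tten C A BC (x j) (x' k).
  transitivity (\sum_j \sum_k G j k); last first.
    by rewrite [LHS]pair_bigA; apply: eq_bigr => -[].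
  rewrite [in LHS](lx a) [in LHS](l'x b) (@tten_suml C A BC).
  apply: eq_bigr => j _; rewrite (@tten_sumr C A BC); apply: eq_bigr => k _.
  by rewrite /G (hf (j, k)).1 rmorphM -mulrA tensor_str -tensor_scale.
- rewrite [in LHS]ht [in LHS]hu -big_split; apply: eq_bigr => jk _.
  by rewrite raddfD rmorphD mulrDl.
Qed.

Variables (dA : azumaya_data A) (dB : azumaya_data B).

(** Freezing the factors from B lets identities in A (x) A^op be used inside the enveloping algebra
    of T. *)
Lemma mix_left (u u' : B) :
  exists f : {additive tring A (op_alg A) -> tring T (op_alg T)},
  forall a a' : A,
    f (opten A a a') = opten T (@tten C A BC a u) (@tten C A BC a' u').
Proof.
apply: (@tring_additive C A (op_alg A) _
  (fun a a' => opten T (@tten C A BC a u) (@tten C A BC a' u'))).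
- by move=> *; rewrite (@ttenDl C A BC) ttenDl.
- by move=> *; rewrite (@ttenDl C A BC) (@ttenDr E T (op_alg T)).
- move=> x a a'; rewrite tensor_scale ttenZ; congr tten.
  rewrite -[alg_str (op_alg A) x * a']/((a' : A) * alg_str A x).
  by rewrite -(alg_central x (a' : A)) tensor_scale [RHS]alg_central.
Qed.

Lemma mix_right (a a' : A) :
  exists f : {additive tring B (op_alg B) -> tring T (op_alg T)},
  forall u u' : B,
    f (opten B u u') = opten T (@tten C A BC a u) (@tten C A BC a' u').
Proof.
apply: (@tring_additive E B (op_alg B) _
  (fun u u' => opten T (@tten C A BC a u) (@tten C A BC a' u'))).
- by move=> *; rewrite (@ttenDr C A BC) ttenDl.
- by move=> *; rewrite (@ttenDr C A BC) (@ttenDr E T (op_alg T)).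
- move=> x u u'; rewrite -tensor_str ttenZ; congr tten.
  rewrite -[alg_str (op_alg B) x * u']/((u' : B) * alg_str B x).
  by rewrite -(alg_central x (u' : B)) -tensor_str [RHS]alg_central.
Qed.

(** The data multiply: the pair (j, k) gets the product of e_j for A and e_k for B. Each identity is
    proved on one factor at a time with [mix_left] and [mix_right]. *)
Lemma tensor_has_data : inhabited (azumaya_data T).
Proof.
have [f [fE [fZ fx]]] := tensor_dual_basis (ad_str_inj dB)
  (data_dual_basis dA) (data_dual_basis dB).
have [m [mE mZ]] := tensor_functional (ad_str_inj dB) (ad_mZ dA) (ad_mZ dB).
pose e (jk : ad_index dA * ad_index dB) : seq (T * T) :=
  [seq (@tten C A BC p.1 q.1, @tten C A BC p.2 q.2)
    | p <- ad_e dA jk.1, q <- ad_e dB jk.2].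
have eE (V : zmodType) (F : T * T -> V) jk : \sum_(r <- e jk) F r =
    \sum_(p <- ad_e dA jk.1) \sum_(q <- ad_e dB jk.2)
      F (@tten C A BC p.1 q.1, @tten C A BC p.2 q.2).
  exact: big_allpairs_dep.
have sweepA u u' a j :
    \sum_(p <- ad_e dA j) opten T (@tten C A BC (a * p.1) u) (@tten C A BC p.2 u') =
    \sum_(p <- ad_e dA j) opten T (@tten C A BC p.1 u) (@tten C A BC (p.2 * a) u').
  have [g hg] := mix_left u u'; have /(congr1 g) := ad_eC dA a j.
  rewrite !raddf_sum; under eq_bigr do rewrite hg.
  by under [in RHS]eq_bigr do rewrite hg.
have sweepB a a' u k :
    \sum_(p <- ad_e dB k) opten T (@tten C A BC a (u * p.1)) (@tten C A BC a' p.2) =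
    \sum_(p <- ad_e dB k) opten T (@tten C A BC a p.1) (@tten C A BC a' (p.2 * u)).
  have [g hg] := mix_right a a'; have /(congr1 g) := ad_eC dB u k.
  rewrite !raddf_sum; under eq_bigr do rewrite hg.
  by under [in RHS]eq_bigr do rewrite hg.
pose x jk : T := @tten C A BC (ad_x dA jk.1) (ad_x dB jk.2).
constructor; apply: (@AzumayaData E T _ x e f m) => //.
- move=> t jk; rewrite !eE; elim/tring_ind: t => [|a b|t u ht hu].
  + apply: eq_bigr => p _; apply: eq_bigr => q _.
    by rewrite mul0r mulr0 tten0l -[X in opten T _ X](subrr 0)
      (@ttenBr E T (op_alg T)) subrr.
  + transitivity (\sum_(p <- ad_e dA jk.1) \sum_(q <- ad_e dB jk.2)
      opten T (@tten C A BC (a * p.1) q.1) (@tten C A BC p.2 (q.2 * b))).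
      apply: eq_bigr => p _; rewrite -sweepB; apply: eq_bigr => q _.
      by rewrite /= [tten a b * _](@ttenM C A BC).
    rewrite exchange_big [RHS]exchange_big; apply: eq_bigr => q _ /=.
    rewrite sweepA; apply: eq_bigr => p _.
    by rewrite [_ * tten a b](@ttenM C A BC).
  + transitivity (\sum_(p <- ad_e dA jk.1) \sum_(q <- ad_e dB jk.2)
      (opten T (t * @tten C A BC p.1 q.1) (@tten C A BC p.2 q.2) +
       opten T (u * @tten C A BC p.1 q.1) (@tten C A BC p.2 q.2))).
      apply: eq_bigr => p _; apply: eq_bigr => q _.
      by rewrite mulrDl ttenDl.
    under eq_bigr do rewrite big_split.
    rewrite big_split /= ht hu -big_split; apply: eq_bigr => p _.
    rewrite -big_split; apply: eq_bigr => q _.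
    by rewrite /= [in RHS]mulrDr; exact/esym/(@ttenDr E T (op_alg T)).
- pose G j k : tring T (op_alg T) := \sum_(p <- e (j, k))
    opten T ((@tten C A BC (ad_x dA j) (ad_x dB k) : T) * p.1) p.2.
  transitivity (\sum_j \sum_k G j k).
    by rewrite pair_bigA; apply: eq_bigr => -[].
  rewrite exchange_big /G /=; transitivity (\sum_k \sum_(q <- ad_e dB k)
      opten T (@tten C A BC 1 (ad_x dB k * q.1)) (@tten C A BC 1 q.2)).
    apply: eq_bigr => k _.
    transitivity (\sum_j \sum_(q <- ad_e dB k) \sum_(p <- ad_e dA j)
        opten T (x (j, k) * @tten C A BC p.1 q.1) (@tten C A BC p.2 q.2)).
      by apply: eq_bigr => j _; rewrite eE exchange_big.
    rewrite exchange_big; apply: eq_bigr => q _.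
    have [g hg] := mix_left (ad_x dB k * q.1) q.2.
    have /(congr1 g) := ad_xe dA; rewrite -tten1 hg => <-.
    rewrite raddf_sum; apply: eq_bigr => j _; rewrite raddf_sum.
    apply: eq_bigr => p _; rewrite hg /=; congr tten.
    by rewrite [LHS](@ttenM C A BC).
  have [g hg] := mix_right 1 1.
  have /(congr1 g) := ad_xe dB; rewrite -tten1 hg => e1.
  rewrite -[RHS]/(opten T (@tten C A BC 1 1) (@tten C A BC 1 1)) -e1.
  rewrite raddf_sum; apply: eq_bigr => k _; rewrite raddf_sum.
  by apply: eq_bigr => q _; rewrite hg.
- move=> jk t; rewrite /bimod_act eE; elim/tring_ind: t => [|a b|t u ht hu].
  + rewrite raddf0 rmorph0 big1 // => p _; rewrite big1 // => q _.
    by rewrite mulr0 mul0r.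
  + transitivity (@tten C A BC (bimod_act idfun (ad_e dA jk.1) a)
        (bimod_act idfun (ad_e dB jk.2) b)).
      rewrite (@tten_suml C A BC); apply: eq_bigr => p _.
      rewrite (@tten_sumr C A BC); apply: eq_bigr => q _ /=.
      by rewrite !(@ttenM C A BC).
    by rewrite !ad_el fE rmorphM -[X in tten X _]mulr1 tensor_scale.
  + rewrite raddfD rmorphD -ht -hu -big_split; apply: eq_bigr => p _.
    rewrite -big_split; apply: eq_bigr => q _.
    by rewrite /= mulrDr mulrDl.
- by rewrite -tten1 mE !ad_m1 mulr1; apply: (ad_str_inj dB); rewrite -sc !rmorph1.
Qed.
End TensorData.

Lemma str_central (K : comPzRingType) (A : alg K) k : central (alg_str A k).
Proof. by move=> x; exact: alg_central. Qed.

Lemma tten_central (K : comPzRingType) (A B : alg K) (z : B) :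
  central z -> central (@tten K A B 1 z).
Proof.
move=> cz; apply: (@tringC K A B _ [the {rmorphism _ -> _} of idfun]) => [a|b] /=.
  by rewrite /GRing.comm !ttenM !mulr1 !mul1r.
by rewrite /GRing.comm !ttenM !mulr1 cz.
Qed.

Section TensorAzumaya.
Variables (C E : comPzRingType) (A : alg C) (B : alg E) (s : {rmorphism C -> B}).
Hypothesis s_central : forall c x, GRing.comm (s c) x.
Let BC : alg C := @Alg C B s s_central.
Let T : alg E := @tensor_alg C E A BC (alg_str B) (@alg_central _ B).

(** The image of s is central, and the center of the Azumaya algebra B is E, embedded in B. *)
Lemma center_map : azumaya B -> exists c : {rmorphism C -> E},
  forall x, s x = alg_str B (c x).
Proof.
move=> /azumaya_has_data [dB].
have sc x : s x = alg_str B (ad_m dB (s x)) by apply: ad_center => y; exact: s_central.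
have inj := ad_str_inj dB.
have cD : {morph (fun x => ad_m dB (s x)) : x y / x + y}.
  by move=> x y; rewrite !raddfD.
have cM : {morph (fun x => ad_m dB (s x)) : x y / x * y}.
  by move=> x y; apply: inj; rewrite [RHS]rmorphM -!sc [LHS]rmorphM.
have c1 : ad_m dB (s 1) = 1 by rewrite rmorph1 ad_m1.
by exists (rmorph_of cD cM c1).
Qed.

Lemma tensor_azumaya : azumaya A -> azumaya B -> azumaya T.
Proof.
move=> /azumaya_has_data [dA] azB; have [c sc] := center_map azB.
have [dB] := azumaya_has_data azB.
have [d] := @tensor_has_data C E A B s s_central c sc dA dB.
exact: data_azumaya d.
Qed.
End TensorAzumaya.

Section BaseChange.
Variables (K D : comPzRingType) (A : alg K) (f : {rmorphism K -> D}).

Lemma base_change_azumaya : azumaya A -> azumaya (base_change A f).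
Proof.
move=> azA; have := @tensor_azumaya K D A (self_alg D) f (comm_alg_central f).
by move=> /(_ azA (self_azumaya D)).
Qed.

Lemma base_change_str e a b :
  alg_str (base_change A f) e * tten a b = @tten K A (Defs.comm_alg f) a (e * b).
Proof. by rewrite [LHS](@ttenM K A (Defs.comm_alg f)) mul1r. Qed.

Lemma base_change_dual_basis (J : finType) (x : J -> A) l : dual_basis x l ->
  exists fl : J -> {additive base_change A f -> D},
    (forall j a b, fl j (@tten K A (Defs.comm_alg f) a b) = f (l j a) * b) /\
    @dual_basis D (base_change A f) _ (fun j => @tten K A (Defs.comm_alg f) (x j) 1) fl.
Proof.
move=> [lZ lx].
have fl j : exists g : {additive base_change A f -> D},
    forall a b, g (@tten K A (Defs.comm_alg f) a b) = f (l j a) * b.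
  apply: (@tring_additive K A (Defs.comm_alg f) D (fun a b => f (l j a) * b)).
  - by move=> *; rewrite !raddfD mulrDl.
  - by move=> *; rewrite mulrDr.
  - by move=> k a b; rewrite lZ rmorphM /= -mulrA mulrCA.
have {fl} /choice [g hg] := fl; exists g; split=> //; split=> [j e t|t].
  elim/tring_ind: t => [|a b|t u ht hu].
  - by rewrite mulr0 raddf0 mulr0.
  - by rewrite base_change_str !hg mulrCA.
  - by rewrite mulrDr !raddfD mulrDr ht hu.
elim/tring_ind: t => [|a b|t u ht hu].
- by rewrite big1 // => j _; rewrite raddf0 rmorph0 mul0r.
- rewrite [in LHS](lx a) tten_suml; apply: eq_bigr => j _.
  by rewrite (@ttenZ K A (Defs.comm_alg f)) base_change_str hg mulr1.
- rewrite [in LHS]ht [in LHS]hu -big_split; apply: eq_bigr => j _.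
  by rewrite raddfD rmorphD mulrDl.
Qed.
End BaseChange.

(** A central element of A (x) B is a scalar 1 (x) e with e in the center of B, so its image 1 (x)
    g(e) is central. *)
Lemma azumaya_tensor_defined (K : comPzRingType) (A : azob K) :
  az_tensor_defined A.
Proof.
have azT (B : Azumaya_under (comm_az (az_center A))) : azumaya (az_tensor B).
  by apply: tensor_azumaya; exact: az_azumaya.
split=> // B B' g z cz; have [d] := azumaya_has_data (azT B).
rewrite (ad_center d cz) [az_tensor_map _ _](@tring_map_tten _ _ _ _ (under_alg_hom g)).
apply: tten_central; apply: (@az_fun_center _ _ _ (under_fun g)).
exact: (@str_central _ (az_alg (under_cod B))).
Qed.

(** * Finite presentation: composition, pushouts, cancellation *)

Section PolynomialFunctions.
Variables (K : comPzRingType) (n : nat).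

(** Polynomials here are bare lists of terms. Working with their values over all K-algebras T allows
    sums and products to be formed before a representing list is chosen. *)
Definition polynomial_function
    (phi : forall T : comPzRingType, {rmorphism K -> T} -> ('I_n -> T) -> T) :=
  exists p : npoly K n, forall (T : comPzRingType) (g : {rmorphism K -> T}) z,
    phi T g z = npoly_eval g z p.

Lemma polyfun_npoly p : polynomial_function (fun T g z => npoly_eval g z p).
Proof. by exists p. Qed.

Lemma polyfun_const c : polynomial_function (fun T g z => g c).
Proof.
exists [:: (c, [ffun=> 0%N])] => T g z; rewrite /npoly_eval big_seq1 big1 ?mulr1 //.
by move=> i _; rewrite ffunE.
Qed.

Lemma polyfun_var i : polynomial_function (fun T g z => z i).
Proof.
exists [:: (1, [ffun j => nat_of_bool (j == i)])] => T g z.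
rewrite /npoly_eval big_seq1 rmorph1 mul1r (bigD1 i) //= ffunE eqxx expr1.
by rewrite big1 ?mulr1 // => j /negPf ji; rewrite ffunE ji.
Qed.

Lemma polyfunD phi psi : polynomial_function phi -> polynomial_function psi ->
  polynomial_function (fun T g z => phi T g z + psi T g z).
Proof.
move=> [p hp] [q hq]; exists (p ++ q) => T g z.
by rewrite hp hq /npoly_eval big_cat.
Qed.

Lemma polyfunM phi psi : polynomial_function phi -> polynomial_function psi ->
  polynomial_function (fun T g z => phi T g z * psi T g z).
Proof.
move=> [p hp] [q hq].
pose mul (t u : K * {ffun 'I_n -> nat}) :=
  (t.1 * u.1, [ffun i => (t.2 i + u.2 i)%N]).
exists (allpairs mul p q : npoly K n).
move=> T g z; rewrite hp hq /npoly_eval [RHS]big_allpairs_dep mulr_suml.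
apply: eq_bigr => t _; rewrite mulr_sumr; apply: eq_bigr => u _ /=.
rewrite rmorphM mulrACA -big_split; congr (_ * _).
by apply: eq_bigr => i _; rewrite ffunE exprD.
Qed.

Lemma polyfun_sum I (r : seq I)
    (phi : I -> forall T : comPzRingType, {rmorphism K -> T} -> ('I_n -> T) -> T) :
  (forall i, polynomial_function (phi i)) ->
  polynomial_function (fun T g z => \sum_(i <- r) phi i T g z).
Proof.
move=> hphi; elim: r => [|i r [p hp]].
  by exists [::] => T g z; rewrite /npoly_eval !big_nil.
have [q hq] := polyfunD (hphi i) (ex_intro _ p hp).
by exists q => T g z; rewrite big_cons hq.
Qed.

Lemma polyfun_prod I (r : seq I)
    (phi : I -> forall T : comPzRingType, {rmorphism K -> T} -> ('I_n -> T) -> T) :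
  (forall i, polynomial_function (phi i)) ->
  polynomial_function (fun T g z => \prod_(i <- r) phi i T g z).
Proof.
move=> hphi; elim: r => [|i r [p hp]].
  by have [p hp] := polyfun_const 1; exists p => T g z; rewrite big_nil -hp rmorph1.
have [q hq] := polyfunM (hphi i) (ex_intro _ p hp).
by exists q => T g z; rewrite big_cons hq.
Qed.

Lemma polyfunX phi k : polynomial_function phi ->
  polynomial_function (fun T g z => phi T g z ^+ k).
Proof.
move=> hphi; elim: k => [|k IH].
  by have [p hp] := polyfun_const 1; exists p => T g z; rewrite expr0 -hp rmorph1.
have [p hp] := polyfunM hphi IH.
by exists p => T g z; rewrite exprS hp.
Qed.

Lemma polyfun_eval m (x : 'I_m -> 'I_n) (p : npoly K m) :
  polynomial_function (fun T g z => npoly_eval g (z \o x) p).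
Proof.
apply: polyfun_sum => t; apply: polyfunM; first exact: polyfun_const.
by apply: polyfun_prod => i; apply: polyfunX; exact: polyfun_var.
Qed.
End PolynomialFunctions.

Lemma npoly_eval_morph (K L M : comPzRingType) (f : {rmorphism K -> L})
    (g : {rmorphism L -> M}) (h : {rmorphism K -> M}) n (x : 'I_n -> L) y p :
  (forall k, h k = g (f k)) -> (forall i, y i = g (x i)) ->
  npoly_eval h y p = g (npoly_eval f x p).
Proof.
move=> hE yE; rewrite rmorph_sum; apply: eq_bigr => t _.
rewrite rmorphM rmorph_prod hE; congr (_ * _); apply: eq_bigr => i _.
by rewrite rmorphXn yE.
Qed.

(** Generators are those of L and of M. Relations are those of L, and those of M with each
    coefficient in L replaced by a polynomial in the generators of L. *)
Lemma fp_comp (K L M : comPzRingType) (f : {rmorphism K -> L})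
    (g : {rmorphism L -> M}) : finitely_presented f -> finitely_presented g ->
  finitely_presented [the {rmorphism K -> M} of g \o f].
Proof.
move=> [n [x [r [genx relx unix]]]] [m [y [s [geny rely uniy]]]].
have [P hP] := choice genx.
set gf := [the {rmorphism K -> M} of g \o f].
pose w (i : 'I_(n + m)) : M :=
  match split i with inl j => g (x j) | inr k => y k end.
have wl j : w (lshift m j) = g (x j) by rewrite /w (unsplitK (inl j)).
have wr j : w (rshift n j) = y j by rewrite /w (unsplitK (inr j)).
(* The polynomial q with its coefficients lifted to K: the first n variables feed the chosen lifts
   [P], the last m are those of q. *)
pose phi (q : npoly L m) (T : comPzRingType) (h : {rmorphism K -> T})
    (z : 'I_(n + m) -> T) := \sum_(t <- q)
  npoly_eval h (z \o lshift m) (P t.1) * \prod_(i < m) z (rshift n i) ^+ t.2 i.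
have hphi q : polynomial_function (phi q).
  apply: polyfun_sum => t; apply: polyfunM; first exact: polyfun_eval.
  by apply: polyfun_prod => i; apply: polyfunX; exact: polyfun_var.
have phiE q (T : comPzRingType) (h : {rmorphism K -> T}) (k : {rmorphism L -> T}) z :
    (forall c, h c = k (f c)) -> (forall j, z (lshift m j) = k (x j)) ->
    phi q T h z = npoly_eval k (z \o @rshift n m) (q : npoly L m).
  move=> hk zk; apply: eq_bigr => t _; congr (_ * _).
  by rewrite [in RHS](hP t.1); exact: npoly_eval_morph.
have [Q hQ] := choice hphi.
have [R hR] := choice (fun p : npoly K n => polyfun_eval (lshift m) p).
exists (n + m)%N, w, (map R r ++ map Q s); split.
- move=> c; have [p ->] := geny c; exists (Q p).
  rewrite -hQ (phiE p M gf g) //; apply: eq_bigr => t _.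
  by congr (_ * _); apply: eq_bigr => i _; rewrite /= wr.
- move=> q; rewrite mem_cat => /orP[] /mapP [p pr ->].
    rewrite -hR; transitivity (g (npoly_eval f x p)).
      exact: npoly_eval_morph.
    by rewrite relx // rmorph0.
  rewrite -hQ (phiE p M gf g) // -(rely p) //; apply: eq_bigr => t _.
  by congr (_ * _); apply: eq_bigr => i _; rewrite /= wr.
- move=> T h z hz.
  have hzl p : p \in r -> npoly_eval h (z \o lshift m) p = 0.
    by move=> pr; rewrite hR hz // mem_cat map_f.
  have [k [kf kx]] := unix T h _ hzl.
  have hzr p : p \in s -> npoly_eval k (z \o @rshift n m) p = 0.
    by move=> ps; rewrite -(phiE p T h k z) // hQ hz // mem_cat map_f ?orbT.
  have [l [lg ly]] := uniy T k _ hzr.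
  exists l; split=> [c|i]; first by rewrite /= lg kf.
  by case: (split_ordP i) => j ->; rewrite ?wl ?wr ?ly // lg kx.
Qed.

Section Pushout.
Variables (K L E : comPzRingType) (f : {rmorphism K -> L}) (g : {rmorphism K -> E}).

Definition pushout : Type := tring (Defs.comm_alg f) (Defs.comm_alg g).
HB.instance Definition _ := GRing.PzRing.on pushout.
Fact pushout_mulC : commutative (@GRing.mul pushout).
Proof.
move=> x; elim/tring_ind: x => [|a b|x x' hx hx'] y.
- by rewrite mul0r mulr0.
- elim/tring_ind: y => [|a' b'|y y' hy hy'].
  + by rewrite mul0r mulr0.
  + by rewrite [LHS]ttenM [RHS]ttenM mulrC [b * b']mulrC.
  + by rewrite mulrDr mulrDl hy hy'.
- by rewrite mulrDr mulrDl hx hx'.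
Qed.
HB.instance Definition _ :=
  GRing.PzSemiRing_hasCommutativeMul.Build pushout pushout_mulC.

Definition pushl : {rmorphism L -> pushout} :=
  [the {rmorphism Defs.comm_alg f -> tring (Defs.comm_alg f) (Defs.comm_alg g)}
    of @tinl K (Defs.comm_alg f) (Defs.comm_alg g)].
Definition pushr : {rmorphism E -> pushout} :=
  [the {rmorphism Defs.comm_alg g -> tring (Defs.comm_alg f) (Defs.comm_alg g)}
    of @tinr K (Defs.comm_alg f) (Defs.comm_alg g)].

Lemma push_comm k : pushl (f k) = pushr (g k).
Proof.
have := @ttenZ K (Defs.comm_alg f) (Defs.comm_alg g) k 1 1.
by rewrite !mulr1.
Qed.

Lemma push_ind (P : pushout -> Prop) : (forall a b, P (pushl a * pushr b)) ->
  (forall x y, P x -> P y -> P (x + y)) -> forall x, P x.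
Proof.
move=> Pt PD; apply: tring_ind => //.
  by have := Pt 0 0; rewrite rmorph0 mul0r.
move=> a b; have := Pt a b.
by rewrite [_ * _](@ttenM K (Defs.comm_alg f) (Defs.comm_alg g)) mulr1 mul1r.
Qed.

Lemma push_lift (T : pzRingType) (h : {rmorphism L -> T}) (k : {rmorphism E -> T}) :
  (forall c, h (f c) = k (g c)) -> (forall a b, GRing.comm (h a) (k b)) ->
  exists u : {rmorphism pushout -> T},
    (forall a, u (pushl a) = h a) /\ (forall b, u (pushr b) = k b).
Proof.
move=> hk hkC.
have [u uE] := @tring_lift K (Defs.comm_alg f) (Defs.comm_alg g) T h k hk hkC.
exists u; split=> [a|b]; first by rewrite [LHS]uE rmorph1 mulr1.
by rewrite [LHS]uE rmorph1 mul1r.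
Qed.

End Pushout.

(** The same generators and relations present the base change. W enters only through generation and
    its universal property, so the two legs of a pushout may be exchanged. *)
Lemma fp_cobase (K L E W : comPzRingType) (f : {rmorphism K -> L})
    (g : {rmorphism K -> E}) (l : {rmorphism L -> W}) (r : {rmorphism E -> W}) :
  (forall k, l (f k) = r (g k)) ->
  (forall P : W -> Prop, (forall a b, P (l a * r b)) ->
    (forall x y, P x -> P y -> P (x + y)) -> forall x, P x) ->
  (forall (T : comPzRingType) (h : {rmorphism L -> T}) (k : {rmorphism E -> T}),
    (forall c, h (f c) = k (g c)) -> exists u : {rmorphism W -> T},
      (forall a, u (l a) = h a) /\ (forall b, u (r b) = k b)) ->
  finitely_presented f -> finitely_presented r.
Proof.
move=> lr ind lift [n [x [rs [genx relx unix]]]].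
pose G (p : npoly K n) : npoly E n := [seq (g t.1, t.2) | t <- (p : seq _)].
have GE (T : comPzRingType) (h : {rmorphism E -> T}) z p :
    npoly_eval h z (G p) = npoly_eval [the {rmorphism K -> T} of h \o g] z p.
  by rewrite /npoly_eval /G big_map.
exists n, (l \o x), (map G rs); split.
- apply: ind => [a b|y z [p ->] [q ->]].
    have [p ->] := genx a.
    have [q hq] := polyfunM (polyfun_npoly (G p)) (polyfun_const n b).
    exists q; rewrite -hq GE; congr (_ * _); exact/esym/npoly_eval_morph.
  have [q' hq] := polyfunD (polyfun_npoly p) (polyfun_npoly q).
  by exists q'; rewrite -hq.
- move=> q /mapP [p pr ->]; rewrite GE.
  transitivity (l (npoly_eval f x p)).
    exact: npoly_eval_morph.
  by rewrite relx // rmorph0.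
- move=> T h z hz.
  have [|k [kf kx]] := unix T [the {rmorphism K -> T} of h \o g] z.
    by move=> p pr; rewrite -GE hz // map_f.
  have [u [ul ur]] := lift T k h kf.
  by exists u; split=> // i; rewrite /= ul kx.
Qed.

Section PushoutPresentation.
Variables (K L E : comPzRingType) (f : {rmorphism K -> L}) (g : {rmorphism K -> E}).

Lemma fp_pushl : finitely_presented g -> finitely_presented (pushl f g).
Proof.
apply: (@fp_cobase _ _ _ _ g f (pushr f g) (pushl f g)) => [k|P Pt|T h k hk].
- by rewrite push_comm.
- by apply: push_ind => a b; rewrite mulrC.
- have [a b|u [ul ur]] := push_lift (fun c => esym (hk c)); first exact: mulrC.
  by exists u.
Qed.
End PushoutPresentation.

(** Over X, present Y by its generators and relations over K together with finitely many relations
    x_j = q_j(y), which express the generators of X in terms of those of Y. *)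
Lemma fp_cancel (K X Y : comPzRingType) (f : {rmorphism K -> X})
    (h : {rmorphism X -> Y}) (k : {rmorphism K -> Y}) :
  (forall c, k c = h (f c)) ->
  finitely_presented f -> finitely_presented k -> finitely_presented h.
Proof.
move=> hk [n [x [r [genx _ _]]]] [m [y [s [geny rely uniy]]]].
have [q hq] := choice (fun j => geny (h (x j))).
pose F (p : npoly K m) : npoly X m := [seq (f t.1, t.2) | t <- (p : seq _)].
have FE (T : comPzRingType) (u : {rmorphism X -> T}) z p :
    npoly_eval u z (F p) = npoly_eval [the {rmorphism K -> T} of u \o f] z p.
  by rewrite /npoly_eval /F big_map.
have kF p : npoly_eval h y (F p) = npoly_eval k y p.
  by rewrite FE; apply: eq_bigr => t _; rewrite /= hk.
have /choice [R hR] j : exists p : npoly X m,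
    forall (T : comPzRingType) (u : {rmorphism X -> T}) z,
    npoly_eval u z p = u (x j) - npoly_eval u z (F (q j)).
  have c1 := polyfunM (polyfun_const m (-1)) (polyfun_npoly (F (q j))).
  have [p hp] := polyfunD (polyfun_const m (x j)) c1.
  by exists p => T u z; rewrite -hp rmorphN rmorph1 mulN1r.
exists m, y, (map F s ++ map R (enum 'I_n)); split.
- by move=> c; have [p ->] := geny c; exists (F p); rewrite kF.
- move=> p; rewrite mem_cat => /orP[] /mapP [t ts ->]; last first.
    by rewrite hR kF -hq subrr.
  by rewrite kF rely.
- move=> T u z hz.
  have [|v [vk vy]] := uniy T [the {rmorphism K -> T} of u \o f] z.
    by move=> p ps; rewrite -FE hz // mem_cat map_f.
  exists v; split=> // c; have [p ->] := genx c; rewrite !rmorph_sum.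
  apply: eq_bigr => t _; rewrite !rmorphM -hk vk; congr (_ * _).
  rewrite !rmorph_prod; apply: eq_bigr => j _; rewrite !rmorphXn; congr (_ ^+ _).
  rewrite hq; transitivity (npoly_eval u z (F (q j))).
    by rewrite FE; apply/esym/npoly_eval_morph.
  have Rj : R j \in map F s ++ map R (enum 'I_n).
    by rewrite mem_cat map_f ?orbT // mem_enum.
  by have /eqP := hz _ Rj; rewrite hR subr_eq0 => /eqP ->.
Qed.

(** * Localization of possibly zero commutative rings *)

Record mult_closed (K : comPzRingType) (S : K -> Prop) : Prop := MultClosed {
  mult_closed1 : S 1;
  mult_closedM : forall x y, S x -> S y -> S (x * y)
}.

Lemma powers_closed (K : comPzRingType) (d : K) : mult_closed (powers d).
Proof.
split; first by exists 0%N.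
by move=> _ _ [n ->] [m ->]; exists (n + m)%N; rewrite exprD.
Qed.

Section Localization.
Variables (K : comPzRingType) (S : K -> Prop) (mS : mult_closed S).

Let den : Type := {x : K | `[< S x >]}.
Let denP (s : den) : S (val s). Proof. by case: s => x /= /asboolP. Qed.
Let mkden x (Sx : S x) : den := exist _ x (asboolT Sx).

Local Open Scope quotient_scope.

Definition frac_rel (p q : K * den) : bool :=
  `[< exists u, S u /\ u * (p.1 * val q.2) = u * (q.1 * val p.2) >].

Fact frac_rel_refl : reflexive frac_rel.
Proof. by move=> p; apply/asboolP; exists 1; split=> //; exact: mult_closed1. Qed.
Fact frac_rel_sym : symmetric frac_rel.
Proof. by move=> p q; apply/asboolP/asboolP => -[u [Su e]]; exists u. Qed.
Fact frac_rel_trans : transitive frac_rel.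
Proof.
move=> q p r /asboolP [u [Su e]] /asboolP [v [Sv e']]; apply/asboolP.
exists (u * v * val q.2); split.
  by apply: (mult_closedM mS) (denP _); exact: mult_closedM.
have -> : u * v * val q.2 * (p.1 * val r.2) =
  u * (p.1 * val q.2) * (v * val r.2) by ring.
have -> : u * v * val q.2 * (r.1 * val p.2) =
  v * (r.1 * val q.2) * (u * val p.2) by ring.
by rewrite e -e'; ring.
Qed.

Canonical frac_equiv := EquivRel frac_rel frac_rel_refl frac_rel_sym frac_rel_trans.

Definition fractions : Type := {eq_quot frac_equiv}.
HB.instance Definition _ := Choice.on fractions.

Definition frac (a s : K) (Ss : S s) : fractions :=
  \pi_({eq_quot frac_equiv}) (a, mkden Ss).

Lemma frac_eq a b s t (Ss : S s) (St : S t) :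
  frac a Ss = frac b St <-> exists u, S u /\ u * (a * t) = u * (b * s).
Proof. by split=> [/eqmodP/asboolP|h]; last by apply/eqmodP/asboolP. Qed.

Lemma fracP x : exists a s (Ss : S s), x = frac a Ss.
Proof.
rewrite -[x](@reprK _ {eq_quot frac_equiv}); case: (repr _) => a s.
exists a, (val s), (denP s); congr (\pi_ _ (_, _)); exact: val_inj.
Qed.

Let num (x : fractions) : K := (repr (x : {eq_quot frac_equiv})).1.
Let dnm (x : fractions) : K := val (repr (x : {eq_quot frac_equiv})).2.
Let dnmP x : S (dnm x). Proof. exact: denP. Qed.
Let fracK x : frac (num x) (dnmP x) = x.
Proof.
rewrite -[RHS](@reprK _ {eq_quot frac_equiv}) /frac /num; congr (\pi_ _ _).
by rewrite [RHS]surjective_pairing; congr (_, _); exact: val_inj.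
Qed.

Let SM := mult_closedM mS.

Definition frac_add x y : fractions :=
  frac (num x * dnm y + num y * dnm x) (SM (dnmP x) (dnmP y)).
Definition frac_mul x y : fractions :=
  frac (num x * num y) (SM (dnmP x) (dnmP y)).
Definition frac_opp x : fractions := frac (- num x) (dnmP x).
Definition frac0 : fractions := frac 0 (mult_closed1 mS).
Definition frac1 : fractions := frac 1 (mult_closed1 mS).

Lemma frac_addE a b s t (Ss : S s) (St : S t) :
  frac_add (frac a Ss) (frac b St) = frac (a * t + b * s) (SM Ss St).
Proof.
rewrite /frac_add; have /frac_eq [u [Su e]] := fracK (frac a Ss).
have /frac_eq [v [Sv e']] := fracK (frac b St).
apply/frac_eq; exists (u * v); split; first exact: SM.
set x := num _ in e *; set y := dnm _ in e *.
set z := num _ in e' *; set w := dnm _ in e' *.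
have -> : u * v * ((x * w + z * y) * (s * t)) =
  u * (x * s) * (v * w * t) + v * (z * t) * (u * y * s) by ring.
by rewrite e e'; ring.
Qed.

Lemma frac_mulE a b s t (Ss : S s) (St : S t) :
  frac_mul (frac a Ss) (frac b St) = frac (a * b) (SM Ss St).
Proof.
rewrite /frac_mul; have /frac_eq [u [Su e]] := fracK (frac a Ss).
have /frac_eq [v [Sv e']] := fracK (frac b St).
apply/frac_eq; exists (u * v); split; first exact: SM.
set x := num _ in e *; set y := dnm _ in e *.
set z := num _ in e' *; set w := dnm _ in e' *.
have -> : u * v * (x * z * (s * t)) = u * (x * s) * (v * (z * t)) by ring.
by rewrite e e'; ring.
Qed.

Let fracW a b s t (Ss : S s) (St : S t) :
  a * t = b * s -> frac a Ss = frac b St.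
Proof.
by move=> e; apply/frac_eq; exists 1; rewrite e; split=> //; exact: mult_closed1.
Qed.

Fact frac_addA : associative frac_add.
Proof.
move=> x y z; have [a [s [Ss ->]]] := fracP x; have [b [t [St ->]]] := fracP y.
have [c [r [Sr ->]]] := fracP z; rewrite !frac_addE; apply: fracW; ring.
Qed.
Fact frac_addC : commutative frac_add.
Proof.
move=> x y; have [a [s [Ss ->]]] := fracP x; have [b [t [St ->]]] := fracP y.
by rewrite !frac_addE; apply: fracW; ring.
Qed.
Fact frac_add0 : left_id frac0 frac_add.
Proof.
move=> x; have [a [s [Ss ->]]] := fracP x.
by rewrite frac_addE; apply: fracW; ring.
Qed.
Fact frac_addN : left_inverse frac0 frac_opp frac_add.
Proof.
move=> x; rewrite -{2}(fracK x) frac_addE; apply: fracW; ring.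
Qed.
HB.instance Definition _ :=
  GRing.isZmodule.Build fractions frac_addA frac_addC frac_add0 frac_addN.

Fact frac_mulA : associative frac_mul.
Proof.
move=> x y z; have [a [s [Ss ->]]] := fracP x; have [b [t [St ->]]] := fracP y.
have [c [r [Sr ->]]] := fracP z; rewrite !frac_mulE; apply: fracW; ring.
Qed.
Fact frac_mulC : commutative frac_mul.
Proof.
move=> x y; have [a [s [Ss ->]]] := fracP x; have [b [t [St ->]]] := fracP y.
by rewrite !frac_mulE; apply: fracW; ring.
Qed.
Fact frac_mul1 : left_id frac1 frac_mul.
Proof.
move=> x; have [a [s [Ss ->]]] := fracP x.
by rewrite frac_mulE; apply: fracW; ring.
Qed.
Fact frac_mulDl : left_distributive frac_mul frac_add.
Proof.
move=> x y z; have [a [s [Ss ->]]] := fracP x; have [b [t [St ->]]] := fracP y.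
have [c [r [Sr ->]]] := fracP z.
by rewrite !(frac_mulE, frac_addE); apply: fracW; ring.
Qed.
HB.instance Definition _ := GRing.Zmodule_isComPzRing.Build fractions
  frac_mulA frac_mulC frac_mul1 frac_mulDl.

Let to_frac (a : K) : fractions := frac a (mult_closed1 mS).
Fact to_fracD : {morph to_frac : x y / x + y}.
Proof. by move=> x y; rewrite [RHS]frac_addE; apply: fracW; ring. Qed.
Fact to_fracM : {morph to_frac : x y / x * y}.
Proof. by move=> x y; rewrite [RHS]frac_mulE; apply: fracW; ring. Qed.
Definition frac_str : {rmorphism K -> fractions} :=
  rmorph_of to_fracD to_fracM erefl.

Lemma fractionsP : is_localization S frac_str.
Proof.
split.
- move=> s Ss; exists (frac 1 Ss).
  by rewrite [LHS]frac_mulE; apply: fracW; ring.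
- move=> x; have [a [s [Ss ->]]] := fracP x; exists a, s; split=> //.
  by rewrite [LHS]frac_mulE; apply: fracW; ring.
- move=> a /frac_eq [u [Su e]]; exists u; split=> //.
  by rewrite mulr1 mul0r mulr0 in e.
Qed.
End Localization.

Lemma localization_exists (K : comPzRingType) (S : K -> Prop) : mult_closed S ->
  exists (L : comPzRingType) (i : {rmorphism K -> L}), is_localization S i.
Proof.
by move=> mS; exists [the comPzRingType of fractions mS], (frac_str mS); exact: fractionsP.
Qed.

Section LocalizationLift.
Variables (K L : comPzRingType) (S : K -> Prop) (i : {rmorphism K -> L}).
Hypothesis iL : is_localization S i.

Lemma unit_cancel (T : comPzRingType) (u x y z : T) :
  u * z = 1 -> x * z = y * z -> x = y.
Proof.
by move=> uz e; rewrite -[x]mulr1 -[y]mulr1 -uz [u * z]mulrC !mulrA e.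
Qed.

(** The value y at x is pinned down by y g(s) = g(a) for all presentations x = a/s at once. The
    morphism laws then follow by cancelling units. *)
Lemma localization_lift (T : comPzRingType) (g : {rmorphism K -> T}) :
  mult_closed S -> (forall s, S s -> exists u, u * g s = 1) ->
  exists h : {rmorphism L -> T}, forall k, h (i k) = g k.
Proof.
move=> mS gS.
have key x : exists y : T,
    forall a s, S s -> x * i s = i a -> y * g s = g a.
  have [a [s [Ss e]]] := loc_frac iL x; have [u us] := gS s Ss.
  exists (g a * u) => b t St e'; apply: (unit_cancel us).
  have e2 : i (a * t - b * s) = 0.
    by rewrite rmorphB !rmorphM -e -e' mulrAC subrr.
  have [v [Sv e3]] := loc_eq0 iL e2; have [w wv] := gS v Sv.
  have /eqP := congr1 g e3; rewrite mulrBr raddfB raddf0 subr_eq0 => /eqP e4.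
  have -> : g a * u * g t * g s = g a * g t * (u * g s) by ring.
  rewrite us mulr1 -!rmorphM; apply: (unit_cancel wv).
  by rewrite -!rmorphM mulrC e4 mulrC.
have [h hh] := choice key.
have hE a s x : S s -> x * i s = i a -> h x * g s = g a by move=> *; exact: hh.
have hi k : h (i k) = g k.
  have := hE k 1 (i k) (mult_closed1 mS).
  by rewrite !rmorph1 !mulr1; apply.
have hD : {morph h : x y / x + y}.
  move=> x y; have [a [s [Ss e]]] := loc_frac iL x.
  have [b [t [St e']]] := loc_frac iL y.
  have Sst := mult_closedM mS Ss St; have [u us] := gS _ Sst.
  have ex := hE a s x Ss e; have ey := hE b t y St e'.
  apply: (unit_cancel us); rewrite (hE (a * t + b * s)) //.
    by rewrite rmorphD !rmorphM /= -ex -ey; ring.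
  by rewrite rmorphD !rmorphM /= -e -e'; ring.
have hM : {morph h : x y / x * y}.
  move=> x y; have [a [s [Ss e]]] := loc_frac iL x.
  have [b [t [St e']]] := loc_frac iL y.
  have Sst := mult_closedM mS Ss St; have [u us] := gS _ Sst.
  apply: (unit_cancel us); rewrite (hE (a * b)) //.
    by rewrite !rmorphM /= -(hE a s x) // -(hE b t y) //; ring.
  by rewrite !rmorphM /= -e -e'; ring.
have h1 : h 1 = 1 by rewrite -[1](rmorph1 i) hi rmorph1.
by exists (rmorph_of hD hM h1).
Qed.
End LocalizationLift.

Lemma unitX (T : comPzRingType) (u x : T) n : u * x = 1 -> u ^+ n * x ^+ n = 1.
Proof. by move=> e; rewrite -exprMn e expr1n. Qed.

(** L is K[u] modulo the single relation d u - 1. *)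
Lemma localization_fp (K L : comPzRingType) (d : K) (i : {rmorphism K -> L}) :
  is_localization (powers d) i -> finitely_presented i.
Proof.
move=> iL; have pd : powers d d by exists 1%N; rewrite expr1.
have [u ud] := loc_unit iL pd.
have e1 := polyfunM (polyfun_const 1 d) (polyfun_var K (0 : 'I_1)).
have [r hr] := polyfunD e1 (polyfun_const 1 (-1)).
have rE (T : comPzRingType) (g : {rmorphism K -> T}) z :
    npoly_eval g z r = g d * z 0 - 1 by rewrite -hr rmorphN rmorph1.
exists 1%N, (fun=> u), [:: r]; split.
- move=> y; have [a [_ [[n ->] e]]] := loc_frac iL y.
  have [p hp] := polyfunM (polyfun_const 1 a) (polyfunX n (polyfun_var K 0)).
  exists p; rewrite -hp -e -mulrA [i _ * _]mulrC rmorphXn.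
  by rewrite unitX // mulr1.
- by move=> q; rewrite inE => /eqP ->; rewrite rE mulrC ud subrr.
- move=> T g z hz; have := hz r (mem_head _ _); rewrite rE => /eqP.
  rewrite subr_eq0 => /eqP dz.
  have [|s [n ->]|h hi] := localization_lift iL (g := g).
  + exact: powers_closed.
  + by exists (z 0 ^+ n); rewrite rmorphXn unitX // mulrC.
  exists h; split=> // j; rewrite ord1.
  have hd : h u * g d = 1 by rewrite -hi -rmorphM ud rmorph1.
  by rewrite -[h u]mulr1 -dz mulrA hd mul1r.
Qed.

(** * Quotient modules and faithfully flat descent for a ring map *)

Section QuotientModule.
Variables (K : pzRingType) (M : lmodType K) (N : M -> Prop).
Hypotheses (N0 : N 0) (ND : forall x y, N x -> N y -> N (x + y)).
Hypothesis NZ : forall k x, N x -> N (k *: x).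

Local Open Scope quotient_scope.

Let NN x : N x -> N (- x). Proof. by rewrite -scaleN1r; exact: NZ. Qed.

Definition quot_rel (x y : M) : bool := `[< N (x - y) >].
Fact quot_rel_refl : reflexive quot_rel.
Proof. by move=> x; apply/asboolP; rewrite subrr. Qed.
Fact quot_rel_sym : symmetric quot_rel.
Proof. by move=> x y; apply/asboolP/asboolP => /NN; rewrite opprB. Qed.
Fact quot_rel_trans : transitive quot_rel.
Proof.
move=> y x z /asboolP h /asboolP h'; apply/asboolP.
by rewrite -[x](subrK y) -addrA; exact: ND.
Qed.
Canonical quot_equiv := EquivRel quot_rel quot_rel_refl quot_rel_sym quot_rel_trans.

Definition quotient : Type := {eq_quot quot_equiv}.
HB.instance Definition _ := Choice.on quotient.

Definition quot (x : M) : quotient := \pi_({eq_quot quot_equiv}) x.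
Let rep (x : quotient) : M := repr (x : {eq_quot quot_equiv}).
Let repK x : quot (rep x) = x. Proof. exact: reprK. Qed.

Lemma quot_eq x y : quot x = quot y <-> N (x - y).
Proof. by split=> [/eqmodP/asboolP|h] //; apply/eqmodP/asboolP. Qed.

Let rep_quot x : N (rep (quot x) - x). Proof. exact/quot_eq/repK. Qed.

Definition quot_add x y := quot (rep x + rep y).
Definition quot_opp x := quot (- rep x).
Definition quot_scale k x := quot (k *: rep x).

Lemma quot_addE x y : quot_add (quot x) (quot y) = quot (x + y).
Proof. by apply/quot_eq; rewrite opprD addrACA; exact: ND. Qed.
Lemma quot_scaleE k x : quot_scale k (quot x) = quot (k *: x).
Proof. by apply/quot_eq; rewrite -scalerBr; exact: NZ. Qed.
Lemma quotP x : exists y, x = quot y.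
Proof. by exists (rep x). Qed.

Fact quot_addA : associative quot_add.
Proof.
move=> x y z; have [a ->] := quotP x; have [b ->] := quotP y.
by have [c ->] := quotP z; rewrite !quot_addE addrA.
Qed.
Fact quot_addC : commutative quot_add.
Proof. by move=> x y; rewrite /quot_add addrC. Qed.
Fact quot_add0 : left_id (quot 0) quot_add.
Proof. by move=> x; have [a ->] := quotP x; rewrite quot_addE add0r. Qed.
Fact quot_addN : left_inverse (quot 0) quot_opp quot_add.
Proof. by move=> x; rewrite -{2}[x]repK quot_addE addNr. Qed.
HB.instance Definition _ :=
  GRing.isZmodule.Build quotient quot_addA quot_addC quot_add0 quot_addN.

Fact quot_scaleA a b x : quot_scale a (quot_scale b x) = quot_scale (a * b) x.
Proof. by have [y ->] := quotP x; rewrite !quot_scaleE scalerA. Qed.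
Fact quot_scale1 : left_id 1 quot_scale.
Proof. by move=> x; have [y ->] := quotP x; rewrite quot_scaleE scale1r. Qed.
Fact quot_scaleDr : right_distributive quot_scale +%R.
Proof.
move=> k x y; have [a ->] := quotP x; have [b ->] := quotP y.
by rewrite [_ + _]quot_addE !quot_scaleE scalerDr [RHS]quot_addE.
Qed.
Fact quot_scaleDl x : {morph quot_scale^~ x : a b / a + b}.
Proof.
move=> a b; have [y ->] := quotP x.
by rewrite !quot_scaleE scalerDl [RHS]quot_addE.
Qed.
HB.instance Definition _ := GRing.Zmodule_isLmodule.Build K quotient
  quot_scaleA quot_scale1 quot_scaleDr quot_scaleDl.

Fact quotD : {morph quot : x y / x + y}.
Proof. by move=> x y; rewrite -quot_addE. Qed.
Fact quotZ k : {morph quot : x / k *: x}.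
Proof. by move=> x; rewrite -quot_scaleE. Qed.

Lemma quotient_exists : exists (Q : lmodType K) (q : {linear M -> Q}),
  (forall y, exists x, y = q x) /\ (forall x, q x = 0 <-> N x).
Proof.
exists quotient, (linear_of quotD quotZ); split; first exact: quotP.
by move=> x; rewrite [0]/(quot 0); split=> [/quot_eq|h]; rewrite ?subr0 //;
  apply/quot_eq; rewrite subr0.
Qed.
End QuotientModule.

Lemma quotient_lift (K : pzRingType) (M Q V : lmodType K) (q : {linear M -> Q})
    (f : {linear M -> V}) :
  (forall y, exists x, y = q x) -> (forall x, q x = 0 -> f x = 0) ->
  exists g : {linear Q -> V}, forall x, g (q x) = f x.
Proof.
move=> qs qf; have [r hr] := choice qs.
have fr x : f (r (q x)) = f x.
  apply/eqP; rewrite -subr_eq0 -(raddfB f); apply/eqP/qf.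
  by rewrite (linearB q) -hr subrr.
have gD : {morph (f \o r) : x y / x + y}.
  move=> x y; have [a ->] := qs x; have [b ->] := qs y.
  by rewrite /= -(linearD q) !fr linearD.
have gZ k : {morph (f \o r) : x / k *: x}.
  move=> x; have [a ->] := qs x.
  by rewrite /= -(linearZ_LR q) !fr linearZ_LR.
by exists (linear_of gD gZ).
Qed.

(** Q is K modulo the annihilator of m, that is, the submodule K m. *)
Lemma cyclic_module (K : comPzRingType) (M : lmodType K) (m : M) :
  exists (Q : lmodType K) (q : {linear K^o -> Q}) (u : {linear Q -> M}),
    [/\ forall y, exists x, y = q x, injective u & forall k, u (q k) = k *: m].
Proof.
have [||k x|Q [q [qs q0]]] := @quotient_exists K K^o (fun k => k *: m = 0).
- by rewrite scale0r.
- by move=> x y hx hy; rewrite scalerDl hx hy addr0.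
- by move=> h; rewrite -scalerA h scaler0.
have fD : {morph (fun k : K^o => k *: m) : x y / x + y} by move=> *; exact: scalerDl.
have fZ k : {morph (fun k : K^o => k *: m) : x / k *: x}.
  by move=> x; rewrite scalerA.
have [|u hu] := quotient_lift (f := linear_of fD fZ) qs; first by move=> x /q0.
have {}hu k : u (q k) = k *: m by exact: hu.
exists Q, q, u; split=> // a b; have [x ->] := qs a; have [y ->] := qs b.
rewrite !hu => /eqP; rewrite -subr_eq0 -scalerBl => /eqP /q0 e.
by apply/eqP; rewrite -subr_eq0 -linearB e.
Qed.

Section TensorVanishing.
Variables (K : comPzRingType) (M N : lmodType K).

Lemma tens0l n : tens (0 : M) n = 0 :> tensor M N.
Proof.
have /esym/eqP := balancedDl (@tens_balanced K M N) 0 0 n.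
by rewrite addr0 -subr_eq0 addrK => /eqP.
Qed.

Lemma tens0r m : tens m (0 : N) = 0 :> tensor M N.
Proof.
have /esym/eqP := balancedDr (@tens_balanced K M N) m 0 0.
by rewrite addr0 -subr_eq0 addrK => /eqP.
Qed.

Lemma tensZ k m n : tens (k *: m) n = tens m (k *: n) :> tensor M N.
Proof. exact: (balancedZ (@tens_balanced K M N)). Qed.

Lemma tmap0 (M' N' : lmodType K) (f : {linear M -> M'}) (g : {linear N -> N'}) :
  tmap f g 0 = 0.
Proof. by apply: (addrI (tmap f g 0)); rewrite -tmapD !addr0. Qed.
End TensorVanishing.

(** By flatness K m (x) N embeds in M (x) N, where its generators vanish. Hence K m (x) N = 0, and K
    m = 0 by faithfulness. *)
Lemma ff_vanish (K : comPzRingType) (M N : lmodType K) (m : M) :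
  faithfully_flat N -> (forall n : N, tens m n = 0) -> m = 0.
Proof.
move=> [flN faN] mN; have [Q [q [u [qs iu uq]]]] := cyclic_module m.
have Q0 (t : tensor Q N) : t = 0.
  elim/tensor_ind: t => // [y n|x y -> ->]; last by rewrite addr0.
  apply: (flN _ _ u iu); rewrite tmap_tens tmap0 /=; have [k ->] := qs y.
  by rewrite uq tensZ mN.
by rewrite -[m]scale1r -uq (faN _ Q0 (q 1)) linear0.
Qed.

Section RingDescent.
Variables (K P : comPzRingType) (f : {rmorphism K -> P}).
Hypothesis ffP : ring_faithfully_flat f.
Let Pm := as_mod (Defs.comm_alg f).

Lemma ring_ff_vanish (M : lmodType K) (m : M) : tens m (1 : Pm) = 0 -> m = 0.
Proof.
move=> m1; apply: (ff_vanish ffP) => p.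
have hD : {morph (fun x : Pm => (p : P) * x : Pm) : x y / x + y}.
  by move=> x y; exact: mulrDr.
have hZ k : {morph (fun x : Pm => (p : P) * x : Pm) : x / k *: x}.
  by move=> x; exact: mulrCA.
have := congr1 (tmap [the {linear M -> M} of idfun] (linear_of hD hZ)) m1.
by rewrite tmap_tens tmap0 /= /as_linear mulr1.
Qed.

Lemma ff_inj : injective f.
Proof.
apply: raddf_inj => x fx; apply: (@ring_ff_vanish K^o).
rewrite -[x]mulr1 -[x * 1]/(x *: (1 : K^o)) tensZ.
have -> : x *: (1 : Pm) = 0 :> Pm by rewrite as_mod_scaleE /= fx mul0r.
exact: tens0r.
Qed.

(** In (P/K) (x) P the class of d (x) 1 equals that of 1 (x) d, which is 0 because 1 comes from K.
    So d vanishes in P/K by [ring_ff_vanish]. *)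
Lemma ff_descent (d : P) :
  @tten K (Defs.comm_alg f) (Defs.comm_alg f) d 1 =
  @tten K (Defs.comm_alg f) (Defs.comm_alg f) 1 d ->
  exists x, f x = d.
Proof.
move=> hd.
have [||k x|Q [q [qs q0]]] := @quotient_exists K Pm (fun y => exists x, f x = y).
- by exists 0; rewrite rmorph0.
- by move=> _ _ [x <-] [y <-]; exists (x + y); rewrite rmorphD.
- by move=> [y <-]; exists (k * y); rewrite rmorphM.
apply/q0/ring_ff_vanish.
have := congr1 (tmap q [the {linear Pm -> Pm} of idfun]) hd.
rewrite /tten !tmap_tens /= => ->.
have -> : q (1 : Pm) = 0 by apply/q0; exists 1; rewrite rmorph1.
exact: tens0l.
Qed.
End RingDescent.

(** * Finite flat families: descent and base change *)

Section ProductComponents.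
Variables (I : Type) (D : I -> comPzRingType).

Lemma prod_ring_sumE J (r : seq J) (F : J -> prod_ring D) i :
  (\sum_(j <- r) F j) i = \sum_(j <- r) F j i.
Proof. exact: (big_morph (fun q : prod_ring D => q i)). Qed.

(** Extension by zero. The equality i = j is decided classically, and its proof transports x into D
    j. *)
Definition component i (x : D i) : prod_ring D := fun j =>
  match pselect (i = j) with
  | left e => eq_rect i D x j e
  | right _ => 0
  end.

Lemma component_same i (x : D i) : component x i = x.
Proof.
rewrite /component; case: pselect => // e.
by rewrite (Prop_irrelevance e erefl).
Qed.

Lemma component_diff i j (x : D i) : i <> j -> component x j = 0.
Proof. by rewrite /component; case: pselect. Qed.

Lemma componentM i (x : D i) (y : prod_ring D) :
  component x * y = component (x * y i).
Proof.
apply: functional_extensionality_dep => j.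
change (component x j * y j = component (x * y i) j).
have [e|ij] := pselect (i = j); first by subst j; rewrite !component_same.
by rewrite !(component_diff _ ij) mul0r.
Qed.

Lemma componentD i : {morph @component i : x y / x + y}.
Proof.
move=> x y; apply: functional_extensionality_dep => j.
change (component (x + y) j = component x j + component y j).
have [e|ij] := pselect (i = j); first by subst j; rewrite !component_same.
by rewrite !(component_diff _ ij) addr0.
Qed.

End ProductComponents.

Lemma component_sum (I : Type) : finite_set [set: I] ->
  exists s : seq I, forall (D : I -> comPzRingType) (q : prod_ring D),
    q = \sum_(i <- s) component (q i).
Proof.
move=> fI; have [s hs] := (finite_seqP (T := {classic I}) setT).1 fI.
exists (undup s) => D q; apply: functional_extensionality_dep => j.
have js : (j : {classic I}) \in undup s.
  by rewrite mem_undup; have : setT (j : {classic I}) by []; rewrite hs.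
rewrite prod_ring_sumE (bigD1_seq (I := {classic I}) j) ?undup_uniq //=.
rewrite component_same big1 ?addr0 // => i ij; apply: component_diff.
by move=> e; move: ij; rewrite e eqxx.
Qed.

Section RestrictScalars.
Variables (X Z : comPzRingType) (g : {rmorphism X -> Z}).

Definition restrict_scalars (N : lmodType Z) : Type := N.

Section Module.
Variable N : lmodType Z.
HB.instance Definition _ := GRing.Zmodule.on (restrict_scalars N).
Definition restrict_scale (x : X) (n : restrict_scalars N) : restrict_scalars N :=
  g x *: (n : N).
Fact restrict_scaleA a b n :
  restrict_scale a (restrict_scale b n) = restrict_scale (a * b) n.
Proof. by rewrite /restrict_scale scalerA rmorphM. Qed.
Fact restrict_scale1 : left_id 1 restrict_scale.
Proof. by move=> n; rewrite /restrict_scale rmorph1 scale1r. Qed.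
Fact restrict_scaleDr : right_distributive restrict_scale +%R.
Proof. by move=> k u v; exact: scalerDr. Qed.
Fact restrict_scaleDl n : {morph restrict_scale^~ n : a b / a + b}.
Proof. by move=> a b; rewrite /restrict_scale rmorphD scalerDl. Qed.
HB.instance Definition _ := GRing.Zmodule_isLmodule.Build X (restrict_scalars N)
  restrict_scaleA restrict_scale1 restrict_scaleDr restrict_scaleDl.
Definition restrict : lmodType X := restrict_scalars N.
End Module.

Lemma restrict_linear (N N' : lmodType Z) (u : {linear N -> N'}) :
  exists v : {linear restrict N -> restrict N'}, forall n : N, v n = u n.
Proof.
have uD : {morph (u : restrict N -> restrict N') : x y / x + y}.
  by move=> x y; exact: (linearD u).
have uZ k : {morph (u : restrict N -> restrict N') : x / k *: x}.
  by move=> x; exact: (linearZ_LR u).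
by exists (linear_of uD uZ).
Qed.
End RestrictScalars.

Section FlatFamilies.
Variables (X : comPzRingType) (I : Type) (Y : I -> comPzRingType).
Variable f : forall i, {rmorphism X -> Y i}.
Hypothesis finI : finite_set [set: I].

Let P := prod_ring Y.
Let fP : {rmorphism X -> P} := [the {rmorphism X -> P} of prod_map f].
Let Pa : alg X := Defs.comm_alg fP.
Let Ya i : alg X := Defs.comm_alg (f i).

Lemma componentZ i k (x : Y i) :
  component (f i k * x) = fP k * component x :> P.
Proof. by rewrite [RHS]mulrC componentM mulrC. Qed.

Lemma component_tens i j : exists u : {additive pushout (f i) (f j) -> tring Pa Pa},
  forall a b, u (pushl _ _ a * pushr _ _ b) =
    @tten X Pa Pa (component a) (component b).
Proof.
have [u hu] : exists u : {additive tring (Ya i) (Ya j) -> tring Pa Pa},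
    forall a b, u (tten a b) = @tten X Pa Pa (component a) (component b).
  apply: (@tring_additive X (Ya i) (Ya j) _
    (fun a b => @tten X Pa Pa (component (a : Y i)) (component (b : Y j)))).
  - by move=> *; rewrite componentD (@ttenDl X Pa Pa).
  - by move=> *; rewrite componentD (@ttenDr X Pa Pa).
  - by move=> k a b; rewrite !componentZ (@ttenZ X Pa Pa).
exists (additive_of (@raddfD _ _ u)) => a b.
by rewrite -hu /= /as_additive [_ * _](@ttenM X (Ya i) (Ya j)) mulr1 mul1r.
Qed.

(** In P (x) P both sides of the descent condition split into components indexed by pairs (i, j),
    and there the condition is agreement in the pushout of Y_i and Y_j. *)
Lemma flat_family_descent (y : forall i, Y i) : ring_faithfully_flat fP ->
  (forall i j, pushl (f i) (f j) (y i) = pushr (f i) (f j) (y j)) ->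
  exists x, forall i, f i x = y i.
Proof.
move=> ffP hy; have [s hs] := component_sum finI.
have [|x hx] := ff_descent ffP (d := (y : P)); last first.
  by exists x => i; rewrite -[y i](congr1 (fun q : P => q i) hx).
have dij (a b : P) :
    @tten X Pa Pa a b = \sum_(i <- s) \sum_(j <- s)
      @tten X Pa Pa (component (a i)) (component (b j)).
  rewrite [a in LHS]hs [b in LHS]hs tten_suml; apply: eq_bigr => i _.
  by rewrite tten_sumr.
rewrite [LHS]dij [RHS]dij; apply: eq_bigr => i _; apply: eq_bigr => j _.
have [u hu] := component_tens i j.
by rewrite -!hu rmorph1 mulr1 rmorph1 mul1r hy.
Qed.

Lemma flat_family_inj : ring_faithfully_flat fP ->
  forall x y, (forall i, f i x = f i y) -> x = y.
Proof.
move=> ffP x y xy; apply: (ff_inj ffP).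
exact: functional_extensionality_dep.
Qed.

Variables (Z : comPzRingType) (g : {rmorphism X -> Z}).
Let W i : comPzRingType := pushout g (f i).
Let h i : {rmorphism Z -> W i} := pushl g (f i).
Let Q := prod_ring W.
Let hQ : {rmorphism Z -> Q} := [the {rmorphism Z -> Q} of prod_map h].
Let Qm := as_mod (Defs.comm_alg hQ).
Let Pm := as_mod Pa.
Let NX (N : lmodType Z) : lmodType X := restrict g N.

Let compW i (w : W i) : Q := @component I W i w.

Section Exchange.
Variable N : lmodType Z.

Lemma exchange_action : exists act : forall i, N -> {additive W i -> tensor (NX N) Pm},
  forall i n z y, act i n (pushl _ _ z * pushr _ _ y) =
    @tens X (NX N) Pm (z *: n) (component y).
Proof.
have h1 (p : I * N) : {u : {additive W p.1 -> tensor (NX N) Pm} |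
    forall z y, u (pushl _ _ z * pushr _ _ y) =
      @tens X (NX N) Pm (z *: p.2) (component y)}.
  case: p => i n /=; apply: cid.
  have [bl br bz] := @tens_balanced X (NX N) Pm.
  have [u hu] : exists u : {additive tring (Defs.comm_alg g) (Ya i) -> tensor (NX N) Pm},
      forall z y, u (tten z y) = @tens X (NX N) Pm ((z : Z) *: n) (component (y : Y i)).
    apply: (@tring_additive X (Defs.comm_alg g) (Ya i) _
      (fun z y => @tens X (NX N) Pm ((z : Z) *: n) (component (y : Y i)))).
    - by move=> z z' y; rewrite scalerDl -bl.
    - by move=> z y y'; rewrite componentD -br.
    - by move=> k z y; rewrite componentZ -[RHS]bz -scalerA.
  exists (additive_of (@raddfD _ _ u)) => z y.
  rewrite -hu /= /as_additive [_ * _](@ttenM X (Defs.comm_alg g) (Ya i)).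
  by rewrite mulr1 mul1r.
exists (fun i n => sval (h1 (i, n))) => i n; exact: (svalP (h1 (i, n))).
Qed.

Lemma exchange_ext (V : nmodType) (u v : {additive tensor N Qm -> V}) :
  (forall n i z y, u (@tens Z N Qm n (compW (pushl g (f i) z * pushr g (f i) y))) =
    v (@tens Z N Qm n (compW (pushl g (f i) z * pushr g (f i) y)))) ->
  u =1 v.
Proof.
move=> uv; have [s hs] := component_sum finI.
have [bl br bz] := @tens_balanced Z N Qm.
have t0 n : @tens Z N Qm n 0 = 0 by exact: tens0r.
elim/tensor_ind => [|n q|x y hx hy]; first by rewrite !raddf0.
  rewrite (hs W q) (big_morph (@tens Z N Qm n) (br n) (t0 n)) !raddf_sum.
  apply: eq_bigr => i _; elim/push_ind: (q i : W i) => [//|x y hx hy].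
  by rewrite componentD br !raddfD hx hy.
by rewrite !raddfD hx hy.
Qed.

Lemma exchange_ext' (V : nmodType) (u v : {additive tensor (NX N) Pm -> V}) :
  (forall n i y, u (@tens X (NX N) Pm n (component (y : Y i))) =
    v (@tens X (NX N) Pm n (component y))) ->
  u =1 v.
Proof.
move=> uv; have [s hs] := component_sum finI.
have [bl br bz] := @tens_balanced X (NX N) Pm.
have t0 n : @tens X (NX N) Pm n 0 = 0 by exact: tens0r.
elim/tensor_ind => [|n q|x y hx hy]; first by rewrite !raddf0.
  rewrite (hs Y q) (big_morph (@tens X (NX N) Pm n) (br n) (t0 n)) !raddf_sum.
  by apply: eq_bigr => i _; exact: uv.
by rewrite !raddfD hx hy.
Qed.

Lemma exchange_map : exists th : {additive tensor N Qm -> tensor (NX N) Pm},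
  forall n i z y,
    th (@tens Z N Qm n (compW (pushl g (f i) z * pushr g (f i) y))) =
    @tens X (NX N) Pm (z *: (n : N)) (component y).
Proof.
have [act hact] := exchange_action; have [s hs] := component_sum finI.
have [bl br bz] := @tens_balanced X (NX N) Pm.
pose b (n : N) (q : Qm) := \sum_(i <- s) act i n (q i).
have hb : @balanced Z N Qm _ b.
  split.
  - move=> n n' q; rewrite -big_split; apply: eq_bigr => i _.
    elim/push_ind: (q i : W i) => [z y|x y hx hy]; last first.
      by rewrite !raddfD hx hy addrACA.
    by rewrite !hact scalerDr; exact: bl.
  - by move=> n q q'; rewrite -big_split; apply: eq_bigr => i _; exact: raddfD.
  - move=> z n q; apply: eq_bigr => i _.
    have -> : (z *: q : Qm) i = pushl g (f i) z * (q i : W i) by [].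
    elim/push_ind: (q i : W i) => [z' y|x y hx hy]; last first.
      by rewrite mulrDr !raddfD hx hy.
    by rewrite mulrA -rmorphM !hact scalerA mulrC.
exists (additive_of (tliftD hb)) => n i z y.
rewrite [LHS](tlift_tens hb) /b [in RHS](hs Y (component y)).
have t0 : @tens X (NX N) Pm (z *: n) 0 = 0 by exact: tens0r.
rewrite (big_morph (@tens X (NX N) Pm (z *: n)) (br _) t0).
apply: eq_bigr => j _; have [e|ij] := pselect (i = j).
  by subst j; rewrite /compW !component_same hact.
rewrite /compW !(component_diff _ ij) raddf0.
have -> : component (0 : Y j) = 0 :> P.
  by apply: (addrI (component (0 : Y j) : P)); rewrite -componentD !addr0.
by rewrite t0.
Qed.

Lemma exchange_map' : exists th : {additive tensor (NX N) Pm -> tensor N Qm},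
  forall n i y, th (@tens X (NX N) Pm n (component (y : Y i))) =
    @tens Z N Qm n (compW (pushr g (f i) y)).
Proof.
have [bl br bz] := @tens_balanced Z N Qm.
pose r (p : Pm) : Qm := fun i => pushr g (f i) (p i).
have hb : @balanced X (NX N) Pm _ (fun n p => @tens Z N Qm n (r p)).
  split=> [n n' p|n p p'|x n p]; first exact: bl.
    rewrite -br; congr tens; apply: functional_extensionality_dep => i.
    exact: rmorphD.
  rewrite [LHS]bz; congr tens; apply: functional_extensionality_dep => i.
  rewrite -[LHS]/(pushl g (f i) (g x) * pushr g (f i) (p i)).
  by rewrite push_comm -rmorphM.
exists (additive_of (tliftD hb)) => n i y; rewrite [LHS](tlift_tens hb).
congr tens; apply: functional_extensionality_dep => j.
rewrite /r /compW; have [e|ij] := pselect (i = j).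
  by subst j; rewrite !component_same.
by rewrite !(component_diff _ ij) rmorph0.
Qed.

Lemma exchange_scale n i (z : Z) (w : W i) :
  @tens Z N Qm (z *: n) (compW w) = @tens Z N Qm n (compW (pushl g (f i) z * w)).
Proof.
rewrite tensZ; congr tens; apply: functional_extensionality_dep => j.
rewrite -[LHS]/(pushl g (f j) z * (compW w j)) /compW.
have [e|ij] := pselect (i = j); first by subst j; rewrite !component_same.
by rewrite !(component_diff _ ij) mulr0.
Qed.
End Exchange.

(** For a Z-module N, the product of the Z (x)_X Y_i tensored over Z with N is N (x)_X P. This
    identification turns flatness and faithfulness over X into the same properties over Z: flatness
    uses that [exchange_map] is split injective, faithfulness that it is onto. *)
Lemma base_change_ff : ring_faithfully_flat fP -> ring_faithfully_flat hQ.
Proof.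
move=> [flP faP]; split=> [N N' u iu|M M0].
  have [th hth] := exchange_map N; have [th' hth'] := exchange_map' N.
  have [th1 hth1] := exchange_map N'.
  have thK : cancel th th'.
    apply: (@exchange_ext N _ (th' \o th : {additive _ -> _}) idfun) => n i z y.
    by rewrite /= hth hth' exchange_scale.
  have [v hv] := restrict_linear g u.
  have nat : forall t, th1 (tmap u [the {linear Qm -> Qm} of idfun] t) =
      tmap v [the {linear Pm -> Pm} of idfun] (th t).
    pose a := additive_of (tmapD u [the {linear Qm -> Qm} of idfun]).
    pose b := additive_of (tmapD v [the {linear Pm -> Pm} of idfun]).
    apply: (@exchange_ext N _ (th1 \o a : {additive _ -> _}) (b \o th : {additive _ -> _})).
    move=> n i z y; rewrite /= /as_additive hth !tmap_tens /= hth1.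
    by rewrite hv linearZ_LR.
  move=> t t' /(congr1 th1); rewrite !nat => /(flP _ _ v) e.
  rewrite -[t]thK -[t']thK; congr (th' _); apply: e => x y.
  by rewrite !hv => /iu.
apply: (faP (NX M)) => t; have [th hth] := exchange_map M.
have [th' hth'] := exchange_map' M.
have -> : t = th (th' t).
  apply: (@exchange_ext' M _ idfun (th \o th' : {additive _ -> _})) => n i y.
  by rewrite /= hth' -[pushr _ _ y]mul1r -(rmorph1 (pushl g (f i))) hth scale1r.
by rewrite (M0 (th' t)) raddf0.
Qed.
End FlatFamilies.

(** * The flat site of affine schemes and its structure sheaf *)

Section AffineSite.
Variable K : comPzRingType.

Lemma affine_ext (X Y : affine K) (f g : @hom (affine K) Y X) :
  (forall x : fp_ring X, fp_hom f x = fp_hom g x) -> f = g.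
Proof. by move=> fg; apply: (@alg_hom_ext K (fp_alg X) (fp_alg Y)) => x; exact: fg. Qed.

Definition fp_arrow (X Y : affine K) (h : {rmorphism fp_ring X -> fp_ring Y})
    (hE : forall k, h (fp_str X k) = fp_str Y k) : @hom (affine K) Y X :=
  @AlgHom K (fp_alg X) (fp_alg Y) h hE.

Lemma fp_hom_str (X Y : affine K) (f : @hom (affine K) Y X) k :
  fp_hom f (fp_str X k) = fp_str Y k.
Proof. exact: (alg_fun_str f k). Qed.

Lemma fp_hom_fp (X Y : affine K) (f : @hom (affine K) Y X) :
  finitely_presented (fp_hom f).
Proof.
by apply: fp_cancel (fp_presented X) (fp_presented Y) => k; rewrite fp_hom_str.
Qed.

Section Pullback.
Variables (X Y Z : affine K) (f : @hom (affine K) Y X) (g : @hom (affine K) Z X).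

Definition fiber_product : affine K :=
  @FpCAlg K (pushout (fp_hom g) (fp_hom f)) _
    (fp_comp (fp_presented Z) (fp_pushl (fp_hom g) (fp_hom_fp f))).

Definition fiber_fst : @hom (affine K) fiber_product Z :=
  @fp_arrow Z fiber_product (pushl (fp_hom g) (fp_hom f)) (fun=> erefl).

Lemma fiber_snd_str k :
  pushr (fp_hom g) (fp_hom f) (fp_str Y k) = fp_str fiber_product k.
Proof. by rewrite -(fp_hom_str f) -push_comm fp_hom_str. Qed.

Definition fiber_snd : @hom (affine K) fiber_product Y :=
  @fp_arrow Y fiber_product (pushr (fp_hom g) (fp_hom f)) fiber_snd_str.

Lemma fiber_comm : comp g fiber_fst = comp f fiber_snd.
Proof. by apply: affine_ext => x; exact: push_comm. Qed.

Lemma fiber_lift (V : affine K) (a : @hom (affine K) V Z) (b : @hom (affine K) V Y) :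
  comp g a = comp f b ->
  exists u : @hom (affine K) V fiber_product,
    comp fiber_fst u = a /\ comp fiber_snd u = b.
Proof.
move=> e.
have hk x : fp_hom a (fp_hom g x) = fp_hom b (fp_hom f x).
  exact: (congr1 (fun w : @hom (affine K) V X => fp_hom w x) e).
have [z y|u [ul ur]] := push_lift hk; first exact: mulrC.
have uE k : u (fp_str fiber_product k) = fp_str V k.
  by rewrite -(fp_hom_str a) -ul.
by exists (@fp_arrow fiber_product V u uE); split; apply: affine_ext.
Qed.
End Pullback.

Lemma pullback_flat_cover X I Y (f : forall i : I, @hom (affine K) (Y i) X)
    Z (g : @hom (affine K) Z X) : @flat_covers K X I Y f ->
  @flat_covers K Z I _ (fun i => fiber_fst (f i) g) /\
  pullback_sieve g (sieve_of_family f) =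
    sieve_of_family (fun i => fiber_fst (f i) g).
Proof.
move=> [finI ffP]; split; first by split=> //; exact: base_change_ff.
apply: arrows_ext => V h; split=> [[i [k e]]|[i [u ->]]].
  by have [u [ul _]] := fiber_lift e; exists i, u.
by exists i, (comp (fiber_snd (f i) g) u); rewrite !comp_assoc fiber_comm.
Qed.

(** Fiber products pull flat covers back to flat covers, so the families themselves are the only
    sieves to test. *)
Lemma flat_sheaf_criterion (F : presheaf (affine K)) :
  (forall X I Y (f : forall i : I, @hom (affine K) (Y i) X),
    @flat_covers K X I Y f -> sheaf_condition F (sieve_of_family f)) ->
  is_sheaf (@flat_topology K) F.
Proof.
move=> hF; apply: sheaf_generated => X I Y f cf Z g.
by have [cg ->] := pullback_flat_cover g cf; exact: hF.
Qed.

Definition structure_presheaf : presheaf (affine K).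
Proof.
by refine (@Presheaf (affine K) (fun X => fp_ring X : Type)
  (fun X Y f x => fp_hom f x) _ _).
Defined.

(** A matching family agrees on the fiber products of the cover, which is the hypothesis of
    [flat_family_descent]. *)
Lemma structure_sheaf : is_sheaf (@flat_topology K) structure_presheaf.
Proof.
apply: flat_sheaf_criterion => X I Y f [finI ffP] x mx.
have Sf i : sieve_of_family f (f i) by exists i, (idm _); rewrite comp_idr.
have [|a ha] := flat_family_descent finI (y := fun i => x _ _ (Sf i)) ffP.
  move=> i j.
  have S1 := sieve_of_familyP (fiber_fst (f j) (f i)) (Sf i).
  have S2 := sieve_of_familyP (fiber_snd (f j) (f i)) (Sf j).
  rewrite -[LHS]/(restr structure_presheaf (fiber_fst (f j) (f i)) _).
  rewrite -[RHS]/(restr structure_presheaf (fiber_snd (f j) (f i)) _).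
  rewrite (mx _ _ _ _ _ S1) (mx _ _ _ _ _ S2).
  exact: (@section_eq _ structure_presheaf _ _ x _ _ _ S1 S2 (fiber_comm _ _)).
exists a; split=> [Z h Sh|b hb].
  case: (Sh) => i [g e]; subst h; rewrite -(mx _ _ _ _ (Sf i)) -(ha i).
  by [].
by apply: (flat_family_inj ffP) => i; rewrite ha; exact/esym/hb.
Qed.

Lemma flat_glue (X : affine K) (S : arrows X) (y : forall Y f, S Y f -> fp_ring Y) :
  @flat_topology K X S ->
  (forall Y Z f (g : @hom (affine K) Z Y) (Sf : S Y f) (Sfg : S Z (comp f g)),
    fp_hom g (y Y f Sf) = y Z (comp f g) Sfg) ->
  exists a : fp_ring X, forall Y f (Sf : S Y f), fp_hom f a = y Y f Sf.
Proof. by move=> JS my; have [a [ha _]] := structure_sheaf JS my; exists a. Qed.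

Lemma flat_separated (X : affine K) (S : arrows X) (a b : fp_ring X) :
  @flat_topology K X S ->
  (forall Y (f : @hom (affine K) Y X), S Y f -> fp_hom f a = fp_hom f b) -> a = b.
Proof.
move=> JS ab; pose y Y f (_ : S Y f) : structure_presheaf Y := fp_hom f a.
have my : matching y by move=> Y Z f g Sf Sfg.
have [c [_ hc]] := structure_sheaf JS my.
by rewrite -(hc a) // -(hc b) // => Y f Sf; rewrite /y ab.
Qed.
End AffineSite.

(** * Flatness of localizations, composites and finite products *)

Section TrivialExtension.
Variables (K : comPzRingType) (N : lmodType K).

(** N is made a square-zero ideal, so that localizing this ring stands in for localizing the module
    N. *)
Definition trivial_extension : Type := (K * N)%type.
HB.instance Definition _ := GRing.Zmodule.on trivial_extension.

Definition te_mul (x y : trivial_extension) : trivial_extension :=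
  (x.1 * y.1, x.1 *: y.2 + y.1 *: x.2).
Definition te_one : trivial_extension := (1, 0).

Fact te_mulA : associative te_mul.
Proof.
move=> [a x] [b y] [c z]; rewrite /te_mul /= mulrA; congr (_, _).
by rewrite !scalerDr !scalerA addrA [c * a]mulrC [c * b]mulrC.
Qed.
Fact te_mulC : commutative te_mul.
Proof. by move=> [a x] [b y]; rewrite /te_mul /= mulrC addrC. Qed.
Fact te_mul1 : left_id te_one te_mul.
Proof. by move=> [a x]; rewrite /te_mul /= mul1r scale1r scaler0 addr0. Qed.
Fact te_mulDl : left_distributive te_mul +%R.
Proof.
move=> [a x] [b y] [c z].
by rewrite /te_mul /= mulrDl; congr (_, _); rewrite /= scalerDl scalerDr addrACA.
Qed.
HB.instance Definition _ := GRing.Zmodule_isComPzRing.Build trivial_extension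
  te_mulA te_mulC te_mul1 te_mulDl.

Let str (k : K) : trivial_extension := (k, 0).
Fact te_strD : {morph str : x y / x + y}.
Proof. by move=> x y; congr (_, _); rewrite addr0. Qed.
Fact te_strM : {morph str : x y / x * y}.
Proof. by move=> x y; congr (_, _); rewrite /= !scaler0 addr0. Qed.
Definition te_str : {rmorphism K -> trivial_extension} :=
  rmorph_of te_strD te_strM erefl.

Lemma te_scale k n : te_str k * (0, n) = (0, k *: n) :> trivial_extension.
Proof. by congr (_, _); rewrite /= ?mulr0 ?scale0r ?addr0. Qed.
End TrivialExtension.

Section LocalizationFlat.
Variables (K L : comPzRingType) (d : K) (i : {rmorphism K -> L}).
Hypothesis iL : is_localization (powers d) i.
Let Lm := as_mod (Defs.comm_alg i).

(** N (x) L maps to the localization of K + N at d by m (x) l -> l (0, m). So (0, n) dies there, and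
    some power of d kills it. *)
Lemma localization_tens0 (N : lmodType K) (n : N) :
  tens n (1 : Lm) = 0 -> exists k, d ^+ k *: n = 0.
Proof.
move=> n0; pose R := trivial_extension N.
have [F [j jF]] := localization_exists (powers_closed (te_str N d)).
have [s [k ->]|h hE] := localization_lift iL (g := [the {rmorphism K -> F} of j \o te_str N])
  (powers_closed d).
  have [|u hu] := loc_unit jF (s := te_str N d ^+ k); first by exists k.
  by exists u; rewrite /= rmorphXn.
have [b hb] : exists b : {additive tensor N Lm -> F}, forall m (l : Lm),
    b (tens m l) = h l * j ((0, m) : R).
  have bal : @balanced K N Lm _ (fun m l => h l * j ((0, m) : R)).
    split=> [m m' l|m l l'|c m l].
    - rewrite -mulrDr -rmorphD; congr (_ * j _).
      by congr (_, _); rewrite addr0.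
    - by rewrite rmorphD mulrDl.
    - by rewrite -te_scale rmorphM as_mod_scaleE rmorphM /= hE mulrCA mulrA.
  by exists (additive_of (tliftD bal)) => m l; exact: tlift_tens.
have /(loc_eq0 jF) [s [[k ->]]] : j ((0, n) : R) = 0.
  by have := congr1 b n0; rewrite hb rmorph1 mul1r raddf0.
by rewrite -rmorphXn te_scale => -[kn]; exists k.
Qed.

(** Every tensor is m (x) v^k with v the inverse of d. If its image is 0, clearing denominators
    shows that a power of d kills u(m), hence m. *)
Lemma localization_flat : ring_flat i.
Proof.
move=> N N' u iu; have pd : powers d d by exists 1%N; rewrite expr1.
have [v vd] := loc_unit iL pd.
have vk k : v ^+ k * i d ^+ k = 1 by exact: unitX.
have idk k (l : Lm) : d ^+ k *: l = i d ^+ k * (l : L) :> Lm.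
  by rewrite as_mod_scaleE /= rmorphXn.
have form (M : lmodType K) (t : tensor M Lm) :
    exists m k, t = tens m (v ^+ k : Lm).
  have [bl br bz] := @tens_balanced K M Lm.
  elim/tensor_ind: t => [|m l|x y [m [k ->]] [m' [k' ->]]].
  - by exists 0, 0%N; rewrite tens0l.
  - have [a [_ [[k ->] e]]] := loc_frac iL l; exists (a *: m), k.
    rewrite bz; congr tens; rewrite as_mod_scaleE /= -e rmorphXn.
    by rewrite -mulrA [_ * v ^+ k]mulrC vk mulr1.
  - exists (d ^+ k' *: m + d ^+ k *: m'), (k + k')%N.
    rewrite bl !bz; congr (tens _ _ + tens _ _); rewrite idk exprD.
      by rewrite mulrCA [i d ^+ k' * _]mulrC vk mulr1.
    by rewrite mulrA [i d ^+ k * _]mulrC vk mul1r.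
pose T := additive_of (tmapD u [the {linear Lm -> Lm} of idfun]).
suff: injective T by [].
apply: raddf_inj => t; have [n [k ->]] := form N t.
rewrite /= /as_additive tmap_tens /= => un0.
have [bl br bz] := @tens_balanced K N' Lm.
have : tens (d ^+ k *: u n) (1 : Lm) = 0.
  rewrite bz idk mulr1.
  have hD : {morph (fun x : Lm => (i d ^+ k) ^+ 2 * (x : L) : Lm) : x y / x + y}.
    by move=> x y; exact: mulrDr.
  have hZ c : {morph (fun x : Lm => (i d ^+ k) ^+ 2 * (x : L) : Lm) : x / c *: x}.
    by move=> x; exact: mulrCA.
  have := congr1 (tmap [the {linear N' -> N'} of idfun] (linear_of hD hZ)) un0.
  rewrite tmap_tens tmap0 /= /as_linear => e; rewrite -[RHS]e; congr tens.
  by rewrite expr2 -mulrA [i d ^+ k * v ^+ k]mulrC vk mulr1.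
move=> /localization_tens0 [m]; rewrite scalerA -exprD -linearZ_LR => /eqP.
rewrite -(linear0 u) => /eqP /iu mn.
have -> : (v ^+ k : Lm) = d ^+ (m + k) *: (v ^+ (m + k + k) : Lm).
  by rewrite idk [v ^+ (m + k + k)]exprD mulrA [i d ^+ _ * _]mulrC vk mul1r.
by rewrite -tensZ mn tens0l.
Qed.
End LocalizationFlat.

Section ExtendScalars.
Variables (X L : comPzRingType) (f : {rmorphism X -> L}) (N : lmodType X).
Let Lm := as_mod (Defs.comm_alg f).

Definition extend_scalars : Type := tensor N Lm.
HB.instance Definition _ := GRing.Zmodule.on extend_scalars.

Let mulD (l : L) : {morph (fun x : Lm => l * (x : L) : Lm) : x y / x + y}.
Proof. by move=> x y; exact: mulrDr. Qed.
Let mulZ (l : L) k : {morph (fun x : Lm => l * (x : L) : Lm) : x / k *: x}.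
Proof. by move=> x; exact: mulrCA. Qed.
Definition extend_scale (l : L) (t : extend_scalars) : extend_scalars :=
  tmap [the {linear N -> N} of idfun] (linear_of (mulD l) (mulZ l)) t.

Lemma extend_scale_tens l n (x : Lm) :
  extend_scale l (tens n x) = tens n (l * (x : L) : Lm).
Proof. by rewrite /extend_scale tmap_tens. Qed.

Fact extend_scaleDr : right_distributive extend_scale +%R.
Proof. by move=> l x y; exact: tmapD. Qed.
Fact extend_scale0 l : extend_scale l 0 = 0. Proof. exact: tmap0. Qed.
Fact extend_scaleA a b t : extend_scale a (extend_scale b t) = extend_scale (a * b) t.
Proof.
elim/tensor_ind: t => [|n x|t u ht hu]; first by rewrite !extend_scale0.
  by rewrite !extend_scale_tens mulrA.
by rewrite !extend_scaleDr ht hu.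
Qed.
Fact extend_scale1 : left_id 1 extend_scale.
Proof.
move=> t; elim/tensor_ind: t => [|n x|t u ht hu]; first by rewrite extend_scale0.
  by rewrite extend_scale_tens mul1r.
by rewrite extend_scaleDr ht hu.
Qed.
Fact extend_scaleDl t : {morph extend_scale^~ t : a b / a + b}.
Proof.
move=> a b; elim/tensor_ind: t => [|n x|t u ht hu].
- by rewrite !extend_scale0 addr0.
- by rewrite !extend_scale_tens mulrDl (balancedDr (@tens_balanced X N Lm)).
- by rewrite !extend_scaleDr ht hu addrACA.
Qed.
HB.instance Definition _ := GRing.Zmodule_isLmodule.Build L extend_scalars
  extend_scaleA extend_scale1 extend_scaleDr extend_scaleDl.
Definition extend : lmodType L := extend_scalars.
End ExtendScalars.

(** M (x)_X Y embeds naturally in (M (x)_X L) (x)_L Y, with retraction m (x) l (x) y -> m (x) g(l)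
    y. There flatness can be applied twice. *)
Lemma flat_comp (X L Y : comPzRingType) (f : {rmorphism X -> L})
    (g : {rmorphism L -> Y}) (h : {rmorphism X -> Y}) :
  (forall x, h x = g (f x)) -> ring_flat f -> ring_flat g -> ring_flat h.
Proof.
move=> hE flf flg N N' u iu.
pose Lm := as_mod (Defs.comm_alg f); pose Yg := as_mod (Defs.comm_alg g).
pose Yh := as_mod (Defs.comm_alg h).
have fwd (M : lmodType X) : exists a : {additive tensor M Yh -> tensor (extend f M) Yg},
    forall m (y : Yh), a (tens m y) = tens (tens m (1 : Lm) : extend f M) (y : Yg).
  have [bl br bz] := @tens_balanced L (extend f M) Yg.
  have [cl cr cz] := @tens_balanced X M Lm.
  have bal : @balanced X M Yh _
      (fun m y => tens (tens m (1 : Lm) : extend f M) (y : Yg)).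
    split=> [m m' y|m y y'|k m y].
    - by rewrite cl bl.
    - exact: br.
    - rewrite cz.
      have -> : tens m (k *: (1 : Lm)) = f k *: (tens m (1 : Lm) : extend f M).
        by rewrite [RHS]extend_scale_tens.
      by rewrite bz; congr tens; rewrite !as_mod_scaleE /= hE.
  by exists (additive_of (tliftD bal)) => m y; exact: tlift_tens.
have bwd (M : lmodType X) : exists b : {additive tensor (extend f M) Yg -> tensor M Yh},
    forall m (l : Lm) (y : Yg), b (tens (tens m l : extend f M) y) = tens m (g l * (y : Y) : Yh).
  have [bl br bz] := @tens_balanced X M Yh.
  have act (y : Y) : exists c : {additive tensor M Lm -> tensor M Yh},
      forall m (l : Lm), c (tens m l) = tens m (g l * y : Yh).
    have bal : @balanced X M Lm _ (fun m l => tens m (g l * y : Yh)).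
      split=> [m m' l|m l l'|k m l].
      - exact: bl.
      - by rewrite rmorphD mulrDl br.
      - rewrite bz; congr tens.
        by rewrite !as_mod_scaleE /= rmorphM hE mulrA.
    by exists (additive_of (tliftD bal)) => m l; exact: tlift_tens.
  have {act} [act hact] := choice act.
  have bal : @balanced L (extend f M) Yg _ (fun t y => act y t).
    split=> [t t' y|t y y'|l t y]; first exact: raddfD.
    - elim/tensor_ind: t => [|m l|t t' h1 h2]; first by rewrite !raddf0 addr0.
        by rewrite !hact mulrDr br.
      by rewrite !raddfD h1 h2 addrACA.
    - elim/tensor_ind: t => [|m x|t t' h1 h2].
      + by rewrite scaler0 !raddf0.
      + rewrite [l *: _]extend_scale_tens !hact; congr tens.
        by rewrite as_mod_scaleE /= rmorphM mulrAC mulrC.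
      + by rewrite scalerDr !raddfD h1 h2.
  exists (additive_of (tliftD bal)) => m l y.
  by rewrite [LHS](tlift_tens bal) hact.
have [a ha] := fwd N; have [a' ha'] := fwd N'; have [b hb] := bwd N.
have bK : cancel a b.
  move=> t; elim/tensor_ind: t => [|n y|t t' h1 h2]; first by rewrite !raddf0.
    by rewrite ha hb rmorph1 mul1r.
  by rewrite !raddfD h1 h2.
pose idL := [the {linear Lm -> Lm} of idfun].
pose idY := [the {linear Yg -> Yg} of idfun].
pose idH := [the {linear Yh -> Yh} of idfun].
pose uL : extend f N -> extend f N' := tmap u idL.
have uLD : {morph uL : x y / x + y} by exact: tmapD.
have uLZ l : {morph uL : x / l *: x}.
  move=> t; elim/tensor_ind: t => [|n x|t t' h1 h2].
  - by rewrite scaler0 /uL !tmap0 scaler0.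
  - transitivity (uL (tens n (l * (x : L) : Lm) : extend f N)).
      by congr uL; exact: extend_scale_tens.
    by rewrite /uL !tmap_tens [RHS]extend_scale_tens.
  - by rewrite scalerDr !uLD h1 h2 scalerDr.
have nat t : a' (tmap u idH t) = tmap (linear_of uLD uLZ) idY (a t).
  elim/tensor_ind: t => [|n y|t t' h1 h2].
  - by rewrite tmap0 !raddf0 tmap0.
  - by rewrite ha !tmap_tens ha' /= /as_linear /uL tmap_tens.
  - by rewrite tmapD !raddfD tmapD h1 h2.
move=> t t' /(congr1 a'); rewrite !nat => /(flg _ _ (linear_of uLD uLZ)) e.
by rewrite -[t]bK -[t']bK; congr (b _); apply: e; exact: flf.
Qed.

Lemma flat_prod (X : comPzRingType) (I : Type) (Y : I -> comPzRingType)
    (f : forall i, {rmorphism X -> Y i}) : finite_set [set: I] ->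
  (forall i, ring_flat (f i)) ->
  ring_flat [the {rmorphism X -> prod_ring Y} of prod_map f].
Proof.
move=> finI fl N N' u iu; have [s hs] := component_sum finI.
set fP := [the {rmorphism X -> _} of prod_map f].
pose Pm := as_mod (Defs.comm_alg fP); pose Ym i := as_mod (Defs.comm_alg (f i)).
pose pr i (q : Pm) : Ym i := (q : prod_ring Y) i.
have prD i : {morph pr i : x y / x + y} by [].
have prZ i k : {morph pr i : x / k *: x} by [].
pose co i (y : Ym i) : Pm := component (y : Y i).
have coD i : {morph co i : x y / x + y} by exact: componentD.
have coZ i k : {morph co i : x / k *: x} by exact: componentZ.
pose p (M : lmodType X) i := tmap [the {linear M -> M} of idfun]
  (linear_of (prD i) (prZ i)).
pose c (M : lmodType X) i := tmap [the {linear M -> M} of idfun]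
  (linear_of (coD i) (coZ i)).
have pD (M : lmodType X) i : {morph p M i : x y / x + y} by exact: tmapD.
have cD (M : lmodType X) i : {morph c M i : x y / x + y} by exact: tmapD.
have sumE (M : lmodType X) t : t = \sum_(i <- s) c M i (p M i t).
  elim/tensor_ind: t => [|m q|x y hx hy].
  - by rewrite big1 // => i _; rewrite /p /c !tmap0.
  - have [_ br _] := @tens_balanced X M Pm.
    rewrite [q in LHS](hs Y q) (big_morph (@tens X M Pm m) (br m) (tens0r _ _)).
    by apply: eq_bigr => i _; rewrite /p /c !tmap_tens.
  - rewrite [in LHS]hx [in LHS]hy -big_split; apply: eq_bigr => i _.
    by rewrite pD cD.
have nat i t : p N' i (tmap u [the {linear Pm -> Pm} of idfun] t) =
    tmap u [the {linear Ym i -> Ym i} of idfun] (p N i t).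
  elim/tensor_ind: t => [|m q|x y hx hy]; first by rewrite /p !tmap0.
    by rewrite /p !tmap_tens.
  by rewrite tmapD !pD tmapD hx hy.
move=> t t' e; rewrite (sumE N t) (sumE N t'); apply: eq_bigr => i _.
congr (c N i _); apply: (fl i _ _ u iu); by rewrite -!nat e.
Qed.

(** * Prime ideals, and covers that are flat and surjective on spectra *)

Record proper_ideal (K : comPzRingType) (J : K -> Prop) : Prop := ProperIdeal {
  ideal0 : J 0;
  idealD : forall x y, J x -> J y -> J (x + y);
  idealM : forall x y, J y -> J (x * y);
  ideal1 : ~ J 1
}.

Lemma maximal_ideal_exists (K : comPzRingType) (J : K -> Prop) : proper_ideal J ->
  exists m : K -> Prop, [/\ proper_ideal m, forall x, J x -> m x &
    forall x, ~ m x -> exists y, m (1 - x * y)].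
Proof.
move=> pJ; pose T := {m : K -> Prop | proper_ideal m /\ forall x, J x -> m x}.
pose R (m n : T) : bool := `[< forall x, sval m x -> sval n x >].
have [||||[m [pm Jm]] maxm] := @Zorn T R.
- by move=> m; apply/asboolP.
- by move=> m n p /asboolP h1 /asboolP h2; apply/asboolP => x /h1 /h2.
- move=> [m pm] [n pn] /asboolP /= h1 /asboolP /= h2.
  have e : m = n by apply/funext => x; apply/propext; split=> [/h1|/h2].
  by subst n; rewrite (Prop_irrelevance pm pn).
(* The empty chain is bounded by J itself, a nonempty one by its union. *)
- move=> A totA; have [[m0 Am0]|noA] := pselect (exists m, A m); last first.
    by exists (exist _ J (conj pJ (fun _ => id))) => m Am; case: noA; exists m.
  pose U x := exists2 m : T, A m & sval m x.
  have pU : proper_ideal U /\ forall x, J x -> U x.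
    split; last by move=> x Jx; exists m0 => //; apply: (svalP m0).2.
    split.
    + by exists m0 => //; apply: ideal0; exact: (svalP m0).1.
    + move=> x y [m Am mx] [n An ny].
      have [/asboolP mn|/asboolP nm] := totA m n Am An.
        by exists n => //; apply: (idealD (svalP n).1) => //; exact: mn.
      by exists m => //; apply: (idealD (svalP m).1) => //; exact: nm.
    + by move=> x y [m Am my]; exists m => //; exact: (idealM (svalP m).1).
    + by move=> [m Am m1]; exact: (ideal1 (svalP m).1).
  by exists (exist _ U pU) => m Am; apply/asboolP => x mx; exists m.
- exists m; split=> // x nmx; apply: contrapT => noy.
  (* If x had no inverse modulo m, then m + x K would be proper. By maximality it would equal m,
     which does not contain x. *)
  pose n z := exists2 y, m y & exists a, z = y + x * a.
  have pn : proper_ideal n.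
    split.
    + by exists 0; [exact: ideal0 | exists 0; rewrite mulr0 addr0].
    + move=> _ _ [y my [a ->]] [z mz [b ->]]; exists (y + z); first exact: idealD.
      by exists (a + b); ring.
    + move=> c _ [y my [a ->]]; exists (c * y); first exact: idealM.
      by exists (c * a); ring.
    + move=> [y my [a e]]; apply: noy; exists a; rewrite e.
      by have -> : y + x * a - x * a = y by ring.
  have Jn z : J z -> n z.
    by move=> /Jm mz; exists z => //; exists 0; rewrite mulr0 addr0.
  have := maxm (exist _ n (conj pn Jn)).
  have le : R (exist _ m (conj pm Jm)) (exist _ n (conj pn Jn)).
    by apply/asboolP => z /= mz; exists z => //; exists 0; rewrite mulr0 addr0.
  move=> /(_ le) /(congr1 sval) /= e; apply: nmx; rewrite -e.
  by exists 0; [exact: ideal0 | exists 1; rewrite mulr1 add0r].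
Qed.

Lemma prime_ideal_exists (K : comPzRingType) (J : K -> Prop) : proper_ideal J ->
  exists p : K -> Prop, prime_ideal p /\ forall x, J x -> p x.
Proof.
move=> /maximal_ideal_exists [m [[m0 mD mM m1] Jm mx]]; exists m; split=> //.
split=> // x y mxy; have [|nmx] := pselect (m x); first by left.
right; have [z hz] := mx x nmx.
have -> : y = y * (1 - x * z) + z * (x * y) by ring.
by apply: mD; exact: mM.
Qed.

(** Suppose M (x) P = 0 and m is nonzero. The annihilator of m lies in a prime p that generates a
    proper ideal in some Y_i, contained in q. By flatness (X / Ann m) (x) P = 0, yet it maps to Y_i
    / q with 1 (x) 1 going to 1, so 1 would lie in q. *)
Lemma family_faithfully_flat (X : comPzRingType) (I : Type) (Y : I -> comPzRingType)
    (f : forall i, {rmorphism X -> Y i}) : finite_set [set: I] ->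
  (forall i, ring_flat (f i)) ->
  (forall p : X -> Prop, prime_ideal p ->
    exists i (q : Y i -> Prop), proper_ideal q /\ forall x, p x -> q (f i x)) ->
  ring_faithfully_flat [the {rmorphism X -> prod_ring Y} of prod_map f].
Proof.
move=> finI fl sp; split; first exact: flat_prod.
set fP := [the {rmorphism X -> _} of prod_map f].
pose Pm := as_mod (Defs.comm_alg fP).
move=> M M0 m; apply: contrapT => m0.
have pJ : proper_ideal (fun x : X => x *: m = 0).
  split=> [|x y hx hy|x y hy|]; first by rewrite scale0r.
  - by rewrite scalerDl hx hy addr0.
  - by rewrite -scalerA hy scaler0.
  - by rewrite scale1r.
have [p [pp hp]] := prime_ideal_exists pJ.
have [i [q [[q0 qD qM q1] hq]]] := sp p pp.
have [Q [c [u [cs iu uc]]]] := cyclic_module m.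
have Q0 : tens (c 1) (1 : Pm) = 0.
  apply: (flat_prod finI fl iu); rewrite tmap_tens tmap0 /=.
  exact: M0.
pose Ym := as_mod (Defs.comm_alg (f i)).
have [//|//|k x qx|V [r [rs r0]]] := @quotient_exists X Ym q; first exact: qM.
have act (y : Y i) : exists w : {linear Q -> V}, forall x, w (c x) = r (f i x * y : Ym).
  have bD : {morph (fun x : X^o => r (f i x * y : Ym)) : a b / a + b}.
    by move=> a b; rewrite rmorphD mulrDl (linearD r).
  have bZ k : {morph (fun x : X^o => r (f i x * y : Ym)) : a / k *: a}.
    by move=> a; rewrite rmorphM -mulrA -(linearZ_LR r).
  have [x cx|w hw] := quotient_lift (f := linear_of bD bZ) cs; last by exists w.
  apply/r0; rewrite mulrC; apply: qM; apply: hq; apply: hp.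
  by rewrite -uc cx linear0.
have {act} [w hw] := choice act.
have bal : @balanced X Q Pm V (fun z y => w ((y : prod_ring Y) i) z).
  split=> [z z' y|z y y'|k z y]; first exact: linearD.
    have [x ->] := cs z; rewrite !hw -(linearD r) -mulrDr.
    by [].
  have [x ->] := cs z; rewrite -linearZ_LR !hw; congr (r _).
  by rewrite rmorphM /= [f i k * _]mulrC -mulrA.
have := congr1 (tlift (fun (z : Q) (y : Pm) => w ((y : prod_ring Y) i) z)) Q0.
rewrite (tlift_tens bal) (tlift0 bal) hw rmorph1 mul1r => /r0.
exact: q1.
Qed.

(** q is the extension of p, the fractions with numerator in p. It contracts to p because no power
    of d lies in p. *)
Lemma localization_proper_ideal (X L : comPzRingType) (d : X)
    (i : {rmorphism X -> L}) (p : X -> Prop) :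
  is_localization (powers d) i -> prime_ideal p -> ~ p d ->
  exists q : L -> Prop, prime_ideal q /\ forall x, p x -> q (i x).
Proof.
move=> iL [p0 pD pM p1 pP] pd.
have pX k : ~ p (d ^+ k).
  elim: k => [|k IH]; first by rewrite expr0.
  by rewrite exprS => /pP [].
pose q (l : L) := exists a k, p a /\ l * i (d ^+ k) = i a.
have qi x : q (i x) -> p x.
  move=> [a [k [pa]]]; rewrite -rmorphM => /eqP; rewrite -subr_eq0 -rmorphB.
  move=> /eqP /(loc_eq0 iL) [_ [[m ->] e]].
  have : p (d ^+ m * (x * d ^+ k)).
    have -> : d ^+ m * (x * d ^+ k) = d ^+ m * a + d ^+ m * (x * d ^+ k - a) by ring.
    by rewrite e addr0; exact: pM.
  by move=> /pP [/pX //|/pP [//|/pX]].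
have iq x : p x -> q (i x).
  by move=> px; exists x, 0%N; rewrite expr0 rmorph1 mulr1.
exists q; split=> //; split.
- by rewrite -(rmorph0 i); exact: iq.
- move=> x y [a [k [pa ea]]] [b [l [pb eb]]].
  exists (d ^+ l * a + d ^+ k * b), (k + l)%N; split; first by apply: pD; exact: pM.
  by rewrite exprD rmorphD !rmorphM /= -ea -eb; ring.
- move=> x y [b [l [pb eb]]]; have [a [_ [[k ->] ea]]] := loc_frac iL x.
  exists (a * b), (k + l)%N; split; first exact: pM.
  by rewrite exprD !rmorphM /= -ea -eb; ring.
- by rewrite -(rmorph1 i) => /qi.
- move=> x y [c [n [pc ec]]].
  have [a [_ [[k ->] ea]]] := loc_frac iL x.
  have [b [_ [[l ->] eb]]] := loc_frac iL y.
  have : q (i (a * b)).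
    exists (d ^+ (k + l) * c), n; split; first exact: pM.
    by rewrite exprD !rmorphM /= -ea -eb -ec; ring.
  move=> /qi /pP [pa|pb]; first by left; exists a, k.
  by right; exists b, l.
Qed.

(** The finitely many d_i in an expression of 1 give a finite subfamily, and every prime misses one
    of them. That subfamily is faithfully flat. *)
Lemma flat_topology_local (K : comPzRingType) (X : affine K) (I : Type)
    (Y : I -> affine K) (f : forall i, @hom (affine K) (Y i) X) (d : I -> fp_ring X) :
  unit_ideal d -> (forall i, ring_flat (fp_hom (f i))) ->
  (forall i (p : fp_ring X -> Prop), prime_ideal p -> ~ p (d i) ->
    exists q : fp_ring (Y i) -> Prop,
      proper_ideal q /\ forall x, p x -> q (fp_hom (f i) x)) ->
  @flat_topology K X (sieve_of_family f).
Proof.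
move=> [s [c cd]] fl sp; pose e := tnth (in_tuple s).
have tJ := generated_topology (@flat_covers K).
apply: (topology_sup tJ (S := sieve_of_family (fun a => f (e a)))).
- apply: generated_cover; split; first exact: finite_finset.
  apply: family_faithfully_flat => [|a|p pp]; [exact: finite_finset|exact: fl|].
  have [a pa] : exists a, ~ p (d (e a)).
    apply: contrapT => np; apply: (prime_ideal1 pp); rewrite -cd big_tnth.
    elim/big_rec: _ => [|a x _ px]; first exact: prime_ideal0.
    apply: prime_idealD => //; apply: prime_idealM => //.
    by apply: contrapT => pda; apply: np; exists a.
  by have [q hq] := sp _ p pp pa; exists a, q.
- exact: sieve_of_familyP.
- by move=> Z _ [a [g ->]]; exists (e a), g.
Qed.

Lemma prime_proper (K : comPzRingType) (p : K -> Prop) :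
  prime_ideal p -> proper_ideal p.
Proof. by case. Qed.

Lemma zariski_flat (K : comPzRingType) X I Y
    (f : forall i : I, @hom (affine K) (Y i) X) :
  @zariski_covers K X I Y f -> @flat_topology K X (sieve_of_family f).
Proof.
move=> [d [ud loc]]; apply: (flat_topology_local ud) => [i|i p pp pd].
  exact: localization_flat (loc i).
have [q [/prime_proper pq hq]] := localization_proper_ideal (loc i) pp pd.
by exists q.
Qed.

Lemma etale_flat_cover (K : comPzRingType) X I Y
    (f : forall i : I, @hom (affine K) (Y i) X) :
  @etale_covers K X I Y f -> @flat_topology K X (sieve_of_family f).
Proof.
move=> [d [L [l [g [ud loc]]]]]; apply: (flat_topology_local ud) => [i|i p pp pd].
  have [locl et _ fE] := loc i.
  exact: (flat_comp fE (localization_flat locl) (etale_flat et)).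
have [locl _ sg fE] := loc i.
have [q [pq hq]] := localization_proper_ideal locl pp pd.
have [r [/prime_proper pr hr]] := sg q pq.
by exists r; split=> // x px; rewrite fE; apply/hr/hq.
Qed.

Lemma zariski_le_flat (K : comPzRingType) (X : affine K) S :
  @zariski_topology K X S -> @flat_topology K X S.
Proof.
apply: generated_le; first exact: generated_topology.
by move=> *; exact: zariski_flat.
Qed.

Lemma etale_le_flat (K : comPzRingType) (X : affine K) S :
  @etale_topology K X S -> @flat_topology K X S.
Proof.
apply: generated_le; first exact: generated_topology.
by move=> *; exact: etale_flat_cover.
Qed.

(** * Constant rank expressed by factorizations of idempotents *)

(** P = V U with U V = 1: an idempotent whose image is free of rank r. As a matrix identity it is
    carried along by every ring map. *)
Definition splits (L : comPzRingType) (J : finType) (P : J -> J -> L) (r : nat) :=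
  exists (U : 'I_r -> J -> L) (V : J -> 'I_r -> L),
    (forall a b, \sum_j U a j * V j b = (a == b)%:R) /\
    (forall j k, \sum_a V j a * U a k = P j k).

Lemma splits_map (L L' : comPzRingType) (h : {rmorphism L -> L'}) (J : finType)
    (P : J -> J -> L) r : splits P r -> splits (fun j k => h (P j k)) r.
Proof.
move=> [U [V [UV VU]]]; exists (fun a j => h (U a j)), (fun j a => h (V j a)).
split=> [a b|j k].
  rewrite -(rmorph_nat h) -UV rmorph_sum; apply: eq_bigr => j _.
  by rewrite rmorphM.
by rewrite -VU rmorph_sum; apply: eq_bigr => a _; rewrite rmorphM.
Qed.

Lemma splits_fin (L : comPzRingType) (J T : finType) (P : J -> J -> L)
    (U : T -> J -> L) (V : J -> T -> L) :
  (forall a b, \sum_j U a j * V j b = (a == b)%:R) ->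
  (forall j k, \sum_a V j a * U a k = P j k) -> splits P #|T|.
Proof.
move=> UV VU; exists (fun a => U (enum_val a)), (fun j a => V j (enum_val a)).
split=> [a b|j k]; first by rewrite UV (inj_eq enum_val_inj).
by rewrite -VU [RHS](reindex _ (onW_bij _ (enum_val_bij T))).
Qed.

Lemma splits_prod (L : comPzRingType) (J J' : finType) (P : J -> J -> L)
    (Q : J' -> J' -> L) r s : splits P r -> splits Q s ->
  splits (fun a b : J * J' => P a.1 b.1 * Q a.2 b.2) (r * s).
Proof.
move=> [U [V [UV VU]]] [U' [V' [UV' VU']]].
have -> : (r * s)%N = #|{: 'I_r * 'I_s}| by rewrite card_prod !card_ord.
apply: (@splits_fin _ _ _ _ (fun a j => U a.1 j.1 * U' a.2 j.2)
  (fun j a => V j.1 a.1 * V' j.2 a.2)) => [a b|j k].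
  transitivity (\sum_j \sum_k (U a.1 j * V j b.1) * (U' a.2 k * V' k b.2)).
    by rewrite pair_bigA; apply: eq_bigr => jk _ /=; rewrite mulrACA.
  under eq_bigr do rewrite -mulr_sumr.
  rewrite -mulr_suml UV UV' -natrM mulnb.
  by case: a b => [a a'] [b b'].
transitivity (\sum_a \sum_b (V j.1 a * U a k.1) * (V' j.2 b * U' b k.2)).
  by rewrite pair_bigA; apply: eq_bigr => ab _ /=; rewrite mulrACA.
under eq_bigr do rewrite -mulr_sumr.
by rewrite -mulr_suml VU VU'.
Qed.

Section FreeSplit.
Variables (L : comPzRingType) (B : alg L) (J : finType) (y : J -> B).
Variable m : J -> {additive B -> L}.
Hypothesis db : dual_basis y m.

(** U holds the dual basis coordinates of a basis of B, and V the coordinates of the generators y_j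
    in that basis. *)
Lemma free_splits r : (exists h : {linear as_mod B -> 'rV[L]_r}, bijective h) <->
  splits (fun j k => m k (y j)) r.
Proof.
have [mZ my] := db; split=> [[h [g hK gK]]|[U [V [UV VU]]]].
  have hZ c (b : B) : h (alg_str B c * b) = c *: h b by exact: (linearZ_LR h).
  have ye (b : B) : b = \sum_a alg_str B (h b 0 a) * g (delta_mx 0 a).
    apply: (can_inj hK); rewrite (linear_sum h) [LHS]row_sum_delta.
    by apply: eq_bigr => a _; rewrite [RHS]hZ gK.
  exists (fun a k => m k (g (delta_mx 0 a))), (fun j a => h (y j) 0 a).
  split=> [a b|j k].
    transitivity ((h (g (delta_mx 0 a)) : 'rV[L]_r) 0 b).
      rewrite [g _ in RHS]my (linear_sum h) summxE; apply: eq_bigr => j _.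
      by rewrite (hZ _ (y j)) mxE.
    by rewrite gK mxE eqxx eq_sym.
  rewrite [in RHS](ye (y j)) raddf_sum; apply: eq_bigr => a _.
  by rewrite mZ.
pose h (b : as_mod B) : 'rV[L]_r := \row_a \sum_k m k b * V k a.
have hD : {morph h : a b / a + b}.
  move=> a b; apply/rowP => i; rewrite !mxE -big_split; apply: eq_bigr => k _.
  by rewrite raddfD mulrDl.
have hZ c : {morph h : a / c *: a}.
  move=> a; apply/rowP => i; rewrite !mxE mulr_sumr; apply: eq_bigr => k _.
  by rewrite as_mod_scaleE mZ mulrA.
pose g (v : 'rV[L]_r) : as_mod B := \sum_a alg_str B (v 0 a) *
  \sum_k alg_str B (U a k) * y k.
have UP a k : \sum_j U a j * m k (y j) = U a k.
  under eq_bigr do rewrite -VU mulr_sumr.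
  rewrite exchange_big (bigD1 a) //= [X in _ + X]big1 ?addr0 => [|c /negPf ac].
    under eq_bigr do rewrite mulrA.
    by rewrite -mulr_suml UV eqxx mul1r.
  under eq_bigr do rewrite mulrA.
  by rewrite -mulr_suml UV eq_sym ac mul0r.
have mg v k : m k (g v) = \sum_a v 0 a * U a k.
  rewrite raddf_sum; apply: eq_bigr => a _; rewrite mZ raddf_sum -UP.
  by congr (_ * _); apply: eq_bigr => j _; rewrite mZ.
exists (linear_of hD hZ); exists g => [b|v]; last first.
  apply/rowP => b; rewrite mxE.
  under eq_bigr do rewrite mg mulr_suml.
  rewrite exchange_big (bigD1 b) //= [X in _ + X]big1 ?addr0 => [|a /negPf ab].
    under eq_bigr do rewrite -mulrA.
    by rewrite -mulr_sumr UV eqxx mulr1.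
  under eq_bigr do rewrite -mulrA.
  by rewrite -mulr_sumr UV ab mulr0.
have mE (b' : B) k : m k b' = \sum_j m j b' * m k (y j).
  by rewrite [b' in LHS]my raddf_sum; apply: eq_bigr => j _; rewrite mZ.
rewrite [LHS]my [RHS]my; apply: eq_bigr => k _; congr (alg_str B _ * _).
rewrite mg [RHS]mE; under eq_bigr do rewrite mxE mulr_suml.
rewrite exchange_big; apply: eq_bigr => j _ /=.
by rewrite -VU mulr_sumr; apply: eq_bigr => a _; rewrite mulrA.
Qed.
End FreeSplit.

Section ConstantRank.
Variables (K : comPzRingType) (A : alg K) (J : finType) (x : J -> A).
Variable l : J -> {additive A -> K}.
Hypothesis db : dual_basis x l.

Lemma constant_rankP r : constant_rank A r <->
  forall (p : K -> Prop) (L : comPzRingType) (i : {rmorphism K -> L}),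
    prime_ideal p -> is_localization (fun k => ~ p k) i ->
    splits (fun j k => i (l k (x j))) r.
Proof.
have E (L : comPzRingType) (i : {rmorphism K -> L}) :
    (exists h : {linear as_mod (base_change A i) -> 'rV[L]_r}, bijective h) <->
    splits (fun j k => i (l k (x j))) r.
  have [fl [flE dbl]] := base_change_dual_basis i db.
  rewrite (free_splits dbl); suff -> : (fun j k => fl k (@tten K A _ (x j) 1)) =
      (fun j k => i (l k (x j))) by [].
  by apply/funext => j; apply/funext => k; rewrite flE mulr1.
by split=> h p L i pp loc; apply/E; exact: (h p).
Qed.

Lemma prime_preimage (D : comPzRingType) (f : {rmorphism K -> D}) (p : D -> Prop) :
  prime_ideal p -> prime_ideal (fun k => p (f k)).
Proof.
move=> [p0 pD pM p1 pP]; split; rewrite ?rmorph0 ?rmorph1 //.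
- by move=> a b; rewrite rmorphD; exact: pD.
- by move=> a b; rewrite rmorphM; exact: pM.
- by move=> a b; rewrite rmorphM; exact: pP.
Qed.

Lemma prime_mult_closed (p : K -> Prop) :
  prime_ideal p -> mult_closed (fun k => ~ p k).
Proof. by move=> [p0 pD pM p1 pP]; split=> // a b pa pb /pP []. Qed.

(** The localization of K at the preimage of p maps to L and carries the splitting with it. *)
Lemma constant_rank_along (D : comPzRingType) (f : {rmorphism K -> D}) r :
  constant_rank A r ->
  forall (p : D -> Prop) (L : comPzRingType) (i : {rmorphism D -> L}),
    prime_ideal p -> is_localization (fun k => ~ p k) i ->
    splits (fun j k => i (f (l k (x j)))) r.
Proof.
move=> /constant_rankP hr p L i pp loc.
have pf := prime_preimage f pp.
have [L0 [j locj]] := localization_exists (prime_mult_closed pf).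
have [|k pk|h hE] := localization_lift locj (g := [the {rmorphism K -> L} of i \o f]).
- exact: prime_mult_closed.
- by have [u hu] := loc_unit loc pk; exists u.
have [U [V [UV VU]]] := splits_map h (hr _ _ j pf locj).
by exists U, V; split=> // a b; rewrite VU hE.
Qed.
End ConstantRank.

Lemma base_change_constant_rank (K D : comPzRingType) (A : alg K)
    (f : {rmorphism K -> D}) r : azumaya A ->
  constant_rank A r -> constant_rank (base_change A f) r.
Proof.
move=> /azumaya_has_data [d] hr.
have db := data_dual_basis d; have [fl [flE dbl]] := base_change_dual_basis f db.
apply/(constant_rankP dbl) => p L i pp loc.
have [U [V [UV VU]]] := constant_rank_along db f hr pp loc.
by exists U, V; split=> // j k; rewrite VU flE mulr1.
Qed.

Lemma splits_eq (L : comPzRingType) (J : finType) (P Q : J -> J -> L) r :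
  (forall j k, P j k = Q j k) -> splits P r -> splits Q r.
Proof. by move=> PQ [U [V [UV VU]]]; exists U, V; split=> // j k; rewrite -PQ. Qed.

Lemma splits_constant_rank (K : comPzRingType) (A : alg K) (J : finType) (x : J -> A) l r :
  dual_basis x l -> splits (fun j k => l k (x j)) r -> constant_rank A r.
Proof.
by move=> db hr; apply/(constant_rankP db) => p L i pp loc; exact: splits_map.
Qed.

Lemma self_constant_degree (K : comPzRingType) : constant_degree (self_alg K).
Proof.
exists 1%N; rewrite exp1n.
have db : @dual_basis K (self_alg K) 'I_1 (fun=> 1 : K)
    (fun=> [the {additive K -> K} of idfun]).
  by split=> // a; rewrite big_ord1 /= mulr1.
apply: (splits_constant_rank db); exists (fun _ _ => 1), (fun _ _ => 1).
by split=> *; rewrite big_ord1 mulr1 // !ord1.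
Qed.

(** * Local freeness of the image of an idempotent matrix *)

Section LocalFreeness.
Variables (C : comPzRingType) (n : nat) (P : 'M[C]_n).
Hypothesis PP : P *m P = P.

Definition mixed_rows (s : {ffun 'I_n -> bool}) : 'M[C]_n :=
  \matrix_(i, j) (if s i then P i j else (1%:M - P) i j).

(* Expand det (P + (1 - P)) = 1 multilinearly in the rows. *)
Lemma sum_det_mixed_rows : \sum_s \det (mixed_rows s) = 1.
Proof.
rewrite -(det1 C n) exchange_big; apply: eq_bigr => t _.
rewrite -mulr_sumr; congr (_ * _).
transitivity (\prod_i \sum_(b : bool) (if b then P i (t i) else (1%:M - P) i (t i))).
  rewrite bigA_distr_bigA; apply: eq_bigr => s _; apply: eq_bigr => i _.
  by rewrite mxE.
by apply: eq_bigr => i _; rewrite big_bool !mxE /= addrC subrK.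
Qed.

Lemma mixed_rows_mul s i j :
  (mixed_rows s *m P) i j = if s i then mixed_rows s i j else 0.
Proof.
rewrite mxE; case: ifP => si.
  transitivity ((P *m P) i j); last by rewrite PP mxE si.
  by rewrite mxE; apply: eq_bigr => k _; rewrite mxE si.
transitivity (((1%:M - P) *m P) i j); last by rewrite mulmxBl mul1mx PP subrr mxE.
by rewrite mxE; apply: eq_bigr => k _; rewrite mxE si.
Qed.

(** For Q = [mixed_rows s], one has Q P = Delta Q with Delta the 0/1 diagonal matrix of s. Once Q is
    invertible, P is conjugate to Delta, and the rows of P selected by s form a basis of its
    image. *)
Lemma splits_mixed_rows (D : comPzRingType) (g : {rmorphism C -> D}) s u :
  u * g (\det (mixed_rows s)) = 1 ->
  splits (fun j k => g (P j k)) #|[pred i | s i]|.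
Proof.
move=> ud; set Q := map_mx g (mixed_rows s); set P' := map_mx g P.
pose W := u *: \adj Q.
have QW : Q *m W = 1%:M.
  by rewrite -scalemxAr mul_mx_adj det_map_mx scale_scalar_mx ud.
have WQ : W *m Q = 1%:M.
  by rewrite -scalemxAl mul_adj_mx det_map_mx scale_scalar_mx ud.
have QP i j : (Q *m P') i j = if s i then Q i j else 0.
  rewrite -map_mxM mxE mixed_rows_mul; case: ifP => _; last exact: rmorph0.
  by rewrite /Q [RHS]mxE.
have PP' : P' *m P' = P' by rewrite -map_mxM PP.
have Qs a k : s a -> Q a k = P' a k by move=> sa; rewrite /Q !mxE sa.
pose A : {pred 'I_n} := [pred i | s i].
have sA (a : {i | i \in A}) : s (val a) by exact: (valP a).
have <- : #|{: {i | i \in A}}| = #|A| by exact: card_sig.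
apply: (@splits_fin _ _ {i | i \in A} _ (fun a k => P' (val a) k)
  (fun j b => (P' *m W) j (val b))) => [a b|j k].
  transitivity ((Q *m P' *m W) (val a) (val b)).
    rewrite -mulmxA [RHS]mxE; apply: eq_bigr => j _.
    by rewrite Qs ?sA.
  transitivity ((Q *m W) (val a) (val b)).
    by rewrite !mxE; apply: eq_bigr => j _; rewrite QP sA.
  by rewrite QW mxE (inj_eq val_inj).
transitivity ((P' *m W *m (Q *m P')) j k); last first.
  by rewrite mulmxA -(mulmxA P') WQ mulmx1 PP' mxE.
rewrite [RHS]mxE (bigID (mem A)) /= [X in _ + X]big1 ?addr0 => [|i /negPf si]; last first.
  by rewrite QP [s i]si mulr0.
rewrite [RHS]big_sub.
by apply: eq_bigr => a _; rewrite QP sA Qs ?sA.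
Qed.
End LocalFreeness.

(** * The dimension of an Azumaya algebra over a closed field *)

Section ClosedFieldAzumaya.
Variables (F : numClosedFieldType) (B : alg F) (r : nat).
Hypothesis azB : azumaya B.
Variable phi : {linear as_mod B -> 'rV[F]_r}.
Variable psi : 'rV[F]_r -> as_mod B.
Hypotheses (phiK : cancel phi psi) (psiK : cancel psi phi).

Let phiD (x y : B) : phi (x + y) = phi x + phi y. Proof. exact: (linearD phi). Qed.
Let phiZ c (x : B) : phi (alg_str B c * x) = c *: phi x.
Proof. exact: (linearZ_LR phi). Qed.

Let rm (b : B) (v : 'rV[F]_r) : 'rV[F]_r := phi ((psi v : B) * b).
Let lm (b : B) (v : 'rV[F]_r) : 'rV[F]_r := phi (b * (psi v : B)).

Let psiD : {morph psi : u v / u + v}.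
Proof. by move=> u v; apply: (can_inj phiK); rewrite (linearD phi) !psiK. Qed.
Let psiZ c : {morph psi : u / c *: u}.
Proof. by move=> u; apply: (can_inj phiK); rewrite (linearZ_LR phi) !psiK. Qed.

Let rmD b : {morph rm b : u v / u + v}.
Proof. by move=> u v; rewrite /rm psiD mulrDl phiD. Qed.
Let rmZ b c : {morph rm b : u / c *: u}.
Proof. by move=> u; rewrite /rm psiZ as_mod_scaleE -mulrA phiZ. Qed.
Let lmD b : {morph lm b : u v / u + v}.
Proof. by move=> u v; rewrite /lm psiD mulrDr phiD. Qed.
Let lmZ b c : {morph lm b : u / c *: u}.
Proof.
by move=> u; rewrite /lm psiZ as_mod_scaleE mulrA -(alg_central c b) -mulrA phiZ.
Qed.

Let R b : 'M[F]_r := lin1_mx (linear_of (rmD b) (rmZ b)).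
Let L b : 'M[F]_r := lin1_mx (linear_of (lmD b) (lmZ b)).

Let phiR x b : phi x *m R b = phi ((x : B) * b).
Proof. by rewrite mul_rV_lin1 /= /as_linear /rm phiK. Qed.
Let phiL x b : phi x *m L b = phi (b * (x : B)).
Proof. by rewrite mul_rV_lin1 /= /as_linear /lm phiK. Qed.

Let LR a b : L a *m R b = R b *m L a.
Proof.
apply/row_matrixP => i; rewrite !rowE -[delta_mx 0 i]psiK !mulmxA.
by rewrite phiL phiR phiR phiL mulrA.
Qed.

Definition left_ideal (V : 'M[F]_r) := forall b, (V *m L b <= V)%MS.

Let left_ideal_mul (V T : 'M[F]_r) : left_ideal V -> (forall b, L b *m T = T *m L b) ->
  left_ideal (V *m T).
Proof. by move=> hV hT b; rewrite -mulmxA -hT mulmxA submxMr. Qed.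

Let left_ideal_ker (V T : 'M[F]_r) : left_ideal V -> (forall b, L b *m T = T *m L b) ->
  left_ideal (V :&: kermx T)%MS.
Proof.
move=> hV hT b; rewrite sub_capmx.
rewrite (submx_trans (submxMr _ (capmxSl _ _)) (hV b)).
apply/sub_kermxP; rewrite -mulmxA hT mulmxA.
have /sub_kermxP -> := capmxSr V (kermx T).
by rewrite mul0mx.
Qed.

Let lin_mem (V : 'M[F]_r) (x : B) b : left_ideal V -> (phi x <= V)%MS ->
  (phi (b * x)%R <= V)%MS.
Proof. by move=> hV xV; rewrite -phiL; apply: submx_trans (hV b); exact: submxMr. Qed.

Lemma minimal_left_ideal : (0 < r)%N -> exists V : 'M[F]_r,
  [/\ left_ideal V, V != 0 & forall W : 'M[F]_r, left_ideal W -> W != 0 ->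
    (W <= V)%MS -> (V <= W)%MS].
Proof.
move=> r0; pose Q k := `[< exists V : 'M[F]_r, [/\ left_ideal V, V != 0 & \rank V = k] >].
have exQ : exists k, Q k.
  exists (\rank (1%:M : 'M[F]_r)); apply/asboolP; exists 1%:M; split=> //.
    by move=> b; exact: submx1.
  by rewrite -mxrank_eq0 mxrank1 -lt0n.
case: (ex_minnP exQ) => k /asboolP [V [lV V0 Vk]] mink.
exists V; split=> // W lW W0 WV.
have [le eq] := mxrank_leqif_eq WV.
have : \rank W == \rank V.
  rewrite eqn_leq le Vk; apply: mink; apply/asboolP; by exists W.
by rewrite eq => /andP[].
Qed.

(** B is the full endomorphism ring of a minimal left ideal V, so r is the square of dim V. Left
    ideals are row spaces stable under the matrices [L b]. *)
Lemma azumaya_rank_square : exists n, r = (n * n)%N.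
Proof.
have [r0|r_gt0] := posnP r; first by exists 0%N.
have [V [lV V0 minV]] := minimal_left_ideal r_gt0.
have [v0 v0V v0n] : exists2 v : B, (phi v <= V)%MS & phi v != 0.
  have [i Vi] : exists i, row i V != 0.
    by apply/existsP; apply: contra_neqT V0; rewrite negb_exists => /forallP h;
      apply/row_matrixP => i; have /negbNE/eqP -> := h i; rewrite row0.
  by exists (psi (row i V)); rewrite psiK // row_sub.
(* V B contains 1: the endomorphism x -> (x_i / (v0)_i) 1 sends v0 to 1. Written as a sandwich, it
   makes 1 a sum of terms p v0 q with p v0 in V. *)
have [w [wV hw]] : exists w : seq (B * B), (forall p, p \in w -> (phi p.1 <= V)%MS) /\
    \sum_(p <- w) p.1 * p.2 = 1.
  have [i vi] : exists i, phi v0 0 i != 0.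
    by apply/existsP; apply: contra_neqT v0n; rewrite negb_exists => /forallP h;
      apply/rowP => i; have /negbNE/eqP -> := h i; rewrite mxE.
  pose f (x : B) : B := alg_str B (phi x 0 i / phi v0 0 i).
  have [||s hs] := azumaya_endomorphism azB (f := f).
  - by move=> x y; rewrite /f phiD mxE mulrDl rmorphD.
  - by move=> c x; rewrite /f phiZ mxE -mulrA rmorphM.
  exists [seq (p.1 * v0, p.2) | p <- s]; split.
    by move=> _ /mapP [p _ ->] /=; exact: lin_mem.
  by rewrite big_map; have := hs v0; rewrite /bimod_act /f divff // rmorph1.
have sumw x : x = \sum_(p <- w) x * p.1 * p.2.
  by rewrite -[LHS]mulr1 -hw mulr_sumr; apply: eq_bigr => p _; rewrite mulrA.
have RL b c : L b *m R c = R c *m L b by exact: LR.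
(* Otherwise v0 V = 0, hence v0 V B = 0 and v0 = 0. *)
have [y yV yv] : exists2 y : B, (phi y <= V)%MS & phi (v0 * y) != 0.
  apply: contrapT => no; case/eqP: v0n; rewrite (sumw v0) big_seq big1 ?linear0 //.
  move=> p pw; have -> : v0 * p.1 = 0; last by rewrite mul0r.
  apply: contrapT => /eqP nz; apply: no; exists p.1; first exact: wV.
  by apply: contra_neq nz => e; rewrite -[LHS]phiK e -(linear0 phi) phiK.
have sub0 (W : 'M[F]_r) (x : B) : (phi x <= W)%MS -> phi x != 0 -> W != 0.
  by move=> xW; apply: contra_neq => W0; apply/eqP; rewrite -submx0 -W0.
have VyV : (V *m R y <= V)%MS.
  apply/row_subP => i; rewrite row_mul -[row i V]psiK phiR; exact: lin_mem.
have VVy : (V <= V *m R y)%MS.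
  apply: minV => //; first exact: left_ideal_mul.
  by apply: (@sub0 _ (v0 * y)) => //; rewrite -phiR; exact: submxMr.
have inj x : (phi x <= V)%MS -> x * y = 0 -> x = 0.
  move=> xV xy; apply: (can_inj phiK); rewrite linear0; apply/eqP/negPn/negP => x0.
  have : (V <= V :&: kermx (R y))%MS.
    apply: minV; [exact: left_ideal_ker | | exact: capmxSl].
    apply: (@sub0 _ x) => //; rewrite sub_capmx xV; apply/sub_kermxP.
    by rewrite phiR xy linear0.
  rewrite sub_capmx => /andP[_ Vk].
  have /sub_kermxP := submx_trans v0V Vk.
  by rewrite phiR => e; rewrite e eqxx in yv.
(* Right multiplication by y is bijective on V by minimality. The preimage e of y is an idempotent
   and a right unit for V. *)
have [e eV ey] : exists2 e : B, (phi e <= V)%MS & e * y = y.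
  have /submxP [D hD] := submx_trans yV VVy.
  exists (psi (D *m V)); first by rewrite psiK submxMl.
  by apply: (can_inj phiK); rewrite -phiR psiK -mulmxA.
have ee : e * e = e.
  apply/eqP; rewrite -subr_eq0; apply/eqP/inj; last by rewrite mulrBl -mulrA !ey subrr.
  by rewrite (linearB phi); apply: addmx_sub; rewrite ?eqmx_opp //; exact: lin_mem.
have Ve x : (phi x <= V)%MS -> x * e = x.
  move=> xV; apply/eqP; rewrite -subr_eq0; apply/eqP/inj.
    rewrite (linearB phi); apply: addmx_sub; rewrite ?eqmx_opp //; exact: lin_mem.
  by rewrite mulrBl -mulrA !ey subrr.
(* Schur's lemma: an eigenspace of right multiplication by b e on V is a nonzero left ideal, hence
   all of V. *)
have scal b : exists c, forall x, (phi x <= V)%MS -> x * (b * e) = alg_str B c * x.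
  pose m := \rank V; pose U := row_base V.
  have UV : (U :=: V)%MS := eq_row_base V.
  have Vst : (V *m R (b * e) <= V)%MS.
    apply/row_subP => i; rewrite row_mul -[row i V]psiK phiR mulrA.
    exact: lin_mem.
  have /submxP [T hT] : (U *m R (b * e) <= U)%MS.
    by rewrite (eqmxMr _ UV) UV.
  have [|c /eigenvalueP [z zT z0]] := eigenvalue_closed T; first by rewrite lt0n mxrank_eq0.
  exists c => x xV.
  have hc b' : L b' *m (R (b * e) - c%:M) = (R (b * e) - c%:M) *m L b'.
    by rewrite mulmxBr mulmxBl RL scalar_mxC.
  have : (V <= V :&: kermx (R (b * e) - c%:M))%MS.
    apply: minV; [exact: left_ideal_ker | | exact: capmxSl].
    apply: (@sub0 _ (psi (z *m U))); rewrite psiK.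
      rewrite sub_capmx -{1}UV submxMl; apply/sub_kermxP.
      by rewrite mulmxBr -mulmxA hT mulmxA zT -scalemxAl mul_mx_scalar subrr.
    apply: contra_neq z0 => zU; apply: (row_free_inj (row_base_free V)).
    by rewrite zU mul0mx.
  rewrite sub_capmx => /andP[_ Vk]; have /sub_kermxP := submx_trans xV Vk.
  rewrite mulmxBr phiR mul_mx_scalar -phiZ => /eqP; rewrite subr_eq0 => /eqP.
  by move/(can_inj phiK).
have [c hc] := choice scal.
pose m := \rank V; pose U := row_base V; exists m.
have UV : (U :=: V)%MS := eq_row_base V.
have Ust b : (U *m L b <= U)%MS by rewrite (eqmxMr _ UV) UV.
have Ufree := row_base_free V.
have UL b i : row i (U *m L b) = phi (b * (psi (row i U) : B)).
  by rewrite row_mul -phiL psiK.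
have xU (x : B) : (phi x <= V)%MS -> phi x = phi x *m pinvmx U *m U.
  by move=> xV; rewrite mulmxKpV // UV.
have UVi i : (phi (psi (row i U)) <= V)%MS by rewrite psiK -UV row_sub.
pose act (b : B) : 'M[F]_m := U *m L b *m pinvmx U.
have actU b : act b *m U = U *m L b by rewrite mulmxKpV.
have ULD : {morph (fun b => U *m L b) : a b / a + b}.
  move=> a b; apply/row_matrixP => i.
  by rewrite [RHS]linearD /= !UL mulrDl phiD.
have ULZ k b : U *m L (alg_str B k * b) = k *: (U *m L b).
  by apply/row_matrixP => i; rewrite [RHS]linearZ /= !UL -mulrA phiZ.
pose f (u : 'rV[F]_r) : 'rV[F]_(m * m) := mxvec (act (psi u)).
have fD : {morph f : u v / u + v}.
  by move=> u v; rewrite /f psiD /act [L _]/(L _) ULD mulmxDl linearD.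
have fZ k : {morph f : u / k *: u}.
  by move=> u; rewrite /f psiZ /act as_mod_scaleE ULZ -scalemxAl linearZ.
pose G := lin1_mx (linear_of fD fZ).
have Gf u : u *m G = f u by rewrite mul_rV_lin1.
(* The representation on V is faithful: an element that kills V kills V B, which contains 1. *)
have free : row_free G.
  apply: inj_row_free => u; rewrite Gf /f => /eqP; rewrite mxvec_eq0 => /eqP act0.
  have UL0 : U *m L (psi u) = 0 by rewrite -actU act0 mul0mx.
  have ann (x : B) : (phi x <= V)%MS -> (psi u : B) * x = 0.
    move=> xV; apply: (can_inj phiK); rewrite -phiL (xU x xV) -mulmxA UL0 mulmx0.
    by rewrite linear0.
  rewrite -[u]psiK [psi u]sumw big_seq big1 ?linear0 // => p pw.
  by rewrite ann ?mul0r //; exact: wV.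
have full : row_full G.
  rewrite -sub1mx; apply/row_subP => i; set M := vec_mx (row i 1%:M) : 'M[F]_m.
  suff [b hb] : exists b : B, U *m L b = M *m U.
    suff -> : row i 1%:M = phi b *m G by exact: submxMl.
    rewrite Gf /f phiK -[LHS]vec_mxK; congr mxvec.
    by apply: (row_free_inj Ufree); rewrite actU hb.
  (* The endomorphism M of V, extended to B by x -> M(x e), is a sum of maps x -> p x q. On V the
     right factors q e act as scalars by [scal], so M is left multiplication by sum c(q) p. *)
  pose g (x : B) : B := psi (phi (x * e) *m pinvmx U *m M *m U).
  have gV x : (phi (g x) <= V)%MS by rewrite psiK -UV submxMl.
  have [||s hs] := azumaya_endomorphism azB (f := g).
  - by move=> x y'; rewrite /g mulrDl phiD !mulmxDl psiD.
  - by move=> k x; rewrite /g -mulrA phiZ -!scalemxAl psiZ as_mod_scaleE.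
  exists (\sum_(p <- s) alg_str B (c p.2) * p.1); apply/row_matrixP => j.
  rewrite UL [RHS]row_mul; pose x : B := psi (row j U); rewrite -[psi (row j U)]/x.
  have xV : (phi x <= V)%MS by exact: UVi.
  have -> : (\sum_(p <- s) alg_str B (c p.2) * p.1) * x = g x * e.
    rewrite -hs !mulr_suml; apply: eq_bigr => p _.
    rewrite -!mulrA hc // (alg_central (c p.2)) -mulrA.
    by rewrite (alg_central (c p.2)).
  rewrite Ve // psiK; congr (_ *m U); rewrite Ve //.
  rewrite (_ : phi x *m pinvmx U = delta_mx 0 j) ?rowE //.
  apply: (row_free_inj Ufree).
  by rewrite -xU // psiK rowE.
exact: etrans (esym (eqP free)) (eqP full).
Qed.
End ClosedFieldAzumaya.

(** * Uncountability of the complex numbers and the Nullstellensatz *)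

Import Num.Theory Order.TTheory.

Lemma avoid_finite (R : realType) (s : seq R) (a b : R) : a < b ->
  exists a' b', [/\ a <= a', a' < b', b' <= b &
    forall x, x \in s -> ~~ (a' <= x <= b')].
Proof.
elim: s a b => [|x s IH] a b ab; first by exists a, b; split.
have [m [am mb]] : exists m, a < m /\ m < b.
  by have [h1 h2] := midf_lt ab; exists ((a + b) / 2%:R); split.
have [c [d [ac cd db xcd]]] : exists c d, [/\ a <= c, c < d, d <= b & ~~ (c <= x <= d)].
  have [xm|mx] := leP x m.
    exists ((m + b) / 2%:R), b; have [h1 h2] := midf_lt mb; split=> //.
      exact: le_trans (ltW am) (ltW h1).
    by rewrite negb_and -ltNge (le_lt_trans xm h1).
  by exists a, m; split=> //; [exact: ltW | rewrite negb_and -!ltNge mx orbT].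
have [a' [b' [ca' ab' bd' hs]]] := IH c d cd.
exists a', b'; split=> //; [exact: le_trans ca' | exact: le_trans bd' _ |].
move=> z; rewrite inE => /predU1P [->|]; last exact: hs.
apply: contra xcd => /andP[h1 h2].
by rewrite (le_trans ca' h1) (le_trans h2 bd').
Qed.

(** Cantor's nested intervals: each step avoids one more list, and the supremum of the left
    endpoints lies in every interval. *)
Lemma real_not_countable (R : realType) (s : nat -> seq R) : exists x, forall n, x \notin s n.
Proof.
pose T := {p : R * R | p.1 < p.2}.
have step n (p : T) : {q : T | [/\ (sval p).1 <= (sval q).1,
    (sval q).2 <= (sval p).2 &
    forall x, x \in s n -> ~~ ((sval q).1 <= x <= (sval q).2)]}.
  apply: cid; case: p => -[a b] /= ab.
  have [a' [b' [aa' ab' bb' h]]] := avoid_finite (s n) ab.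
  by exists (exist (fun p : R * R => p.1 < p.2) (a', b') ab'); split.
pose t := fix t n : T := if n is n'.+1 then sval (step n' (t n'))
  else exist (fun p : R * R => p.1 < p.2) (0, 1) ltr01.
have tS n : [/\ (sval (t n)).1 <= (sval (t n.+1)).1,
    (sval (t n.+1)).2 <= (sval (t n)).2 &
    forall x, x \in s n -> ~~ ((sval (t n.+1)).1 <= x <= (sval (t n.+1)).2)].
  by rewrite /=; case: (step n (t n)).
have mono n k : (sval (t n)).1 <= (sval (t (n + k)%N)).1 /\
    (sval (t (n + k)%N)).2 <= (sval (t n)).2.
  elim: k => [|k [h1 h2]]; first by rewrite addn0.
  by rewrite addnS; have [h3 h4 _] := tS (n + k)%N;
    rewrite (le_trans h1 h3) (le_trans h4 h2).
have cross n k : (sval (t n)).1 <= (sval (t k)).2.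
  have [h1 _] := mono n k; have [_ h2] := mono k n.
  rewrite addnC in h2; apply: le_trans h1 (le_trans _ h2).
  exact/ltW/(svalP (t (n + k)%N)).
pose E := [set x | exists n, x = (sval (t n)).1]%classic.
have supE : has_sup E.
  split; first by exists (sval (t 0%N)).1, 0%N.
  by exists (sval (t 0%N)).2 => _ [n ->].
exists (sup E) => n; have [_ _ h] := tS n; apply/negP => /h; rewrite negb_and.
have -> : (sval (t n.+1)).1 <= sup E.
  by apply: (sup_upper_bound supE); exists n.+1.
have -> // : sup E <= (sval (t n.+1)).2.
by apply: ge_sup; [exact: supE.1 | move=> _ [k ->]].
Qed.

(* Uncountability, in the form that every map to nat has an infinite fiber. *)
Definition large (F : eqType) := forall c : F -> nat,
  exists n, forall k, exists s : seq F, [/\ uniq s, size s = k & all (fun a => c a == n) s].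

(** If all fibers were finite, the reals would be a countable union of finite lists. *)
Lemma real_large (R : realType) : large R.
Proof.
move=> c; apply: contrapT => no.
have fin n : exists s : seq R, forall x, c x = n -> x \in s.
  pose Q k := `[< exists s : seq R, [/\ uniq s, size s = k & all (fun a => c a == n) s] >].
  have Q0 : exists k, Q k by exists 0%N; apply/asboolP; exists [::].
  have [m Qm] : exists m, forall k, Q k -> (k <= m)%N.
    apply: contrapT => nb; apply: no; exists n => k; apply: contrapT => nk.
    apply: nb; exists k => l /asboolP [s [us <- hs]].
    rewrite leqNgt; apply/negP => kl; apply: nk; exists (take k s); split.
    - exact: take_uniq.
    - by rewrite size_take kl.
    - by apply/allP => x /mem_take /(allP hs).
  case: (ex_maxnP Q0 Qm) => k /asboolP [s [us sk hs]] kmax.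
  exists s => x cx; apply/negPn/negP => xs.
  have /kmax : Q k.+1.
    by apply/asboolP; exists (x :: s); rewrite /= xs us sk cx eqxx.
  by rewrite ltnn.
have [s hs] := choice fin; have [x hx] := real_not_countable s.
by have := hx (c x); rewrite hs.
Qed.

Lemma complex_large (R : realType) : large R[i]%C.
Proof.
move=> c; have [n hn] := real_large (fun x : R => c (real_complex R x)).
exists n => k; have [s [us sk hs]] := hn k.
exists (map (real_complex R) s); rewrite size_map all_map; split=> //.
by rewrite map_inj_uniq // => x y [].
Qed.

Section Nullstellensatz.
Variables (F : numClosedFieldType) (D : comNzRingType) (f : {rmorphism F -> D}).
Hypothesis largeF : large F.
Variables (m : nat) (y : 'I_m -> D).
Hypothesis geny : forall z, exists p : npoly F m, z = npoly_eval f y p.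

(** A countable enumeration of the monomials, with value 0 at the codes of no exponent vector. *)
Let mono (k : nat) : D :=
  if @unpickle {ffun 'I_m -> nat} k is Some e then \prod_(i < m) y i ^+ e i else 0.

Lemma monomial_span z :
  exists N (v : nat -> F), z = \sum_(k < N) f (v k) * mono k.
Proof.
have [p ->] := geny z; elim: (p : seq (F * {ffun 'I_m -> nat})) => [|t q [N [v hv]]].
  by exists 0%N, (fun=> 0); rewrite /npoly_eval big_nil big_ord0.
pose M := maxn N (pickle t.2).+1.
have lt : (pickle t.2 < M)%N by rewrite leq_maxr.
have leN : (N <= M)%N by exact: leq_maxl.
exists M, (fun k => t.1 *+ (k == pickle t.2) + if (k < N)%N then v k else 0).
rewrite /npoly_eval big_cons.
rewrite (eq_bigr (fun k : 'I_M => f (t.1 *+ (k == pickle t.2 :> nat)) * mono k +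
  f (if (k < N)%N then v k else 0) * mono k)); last first.
  by move=> k _; rewrite rmorphD mulrDl.
rewrite big_split /=; congr (_ + _).
  rewrite (bigD1 (Ordinal lt)) //= eqxx mulr1n /mono pickleK [X in _ + X]big1 ?addr0 // => k.
  by rewrite -val_eqE /= => /negPf ->; rewrite mulr0n rmorph0 mul0r.
rewrite -[LHS]/(npoly_eval f y q) hv (big_ord_widen M (fun k => f (v k) * mono k) leN).
rewrite big_mkcond; apply: eq_bigr => k _.
by case: ifP; rewrite ?rmorph0 ?mul0r.
Qed.

Section MaximalQuotient.
Variable I : D -> Prop.
Hypotheses (pI : proper_ideal I) (maxI : forall x, ~ I x -> exists z, I (1 - x * z)).

Let IN x : I x -> I (- x).
Proof. by rewrite -mulN1r; exact: (idealM pI). Qed.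

Let IB x z : I x -> I z -> I (x - z).
Proof. by move=> Ix /IN; exact: (idealD pI). Qed.

Let IP x z : I (x * z) -> I x \/ I z.
Proof.
move=> Ixz; have [|nx] := pselect (I x); [by left | right].
have [w hw] := maxI nx.
have -> : z = z * (1 - x * w) + w * (x * z) by ring.
by apply: (idealD pI); exact: (idealM pI).
Qed.

Let Iprod (s : seq F) (t : D) (P : pred F) : I (\prod_(a <- s | P a) (t - f a)) ->
  exists a, I (t - f a).
Proof.
elim: s => [|a s IH]; first by rewrite big_nil => /(ideal1 pI).
by rewrite big_cons; case: ifP => // _ /IP [|/IH //]; exists a.
Qed.

(** If every t - a were invertible modulo I, with inverse u_a, then uncountably many u_a would lie
    in a space of countable dimension. Some n + 1 of them lie in the span of n monomials, and a
    linear relation among them gives a nonzero polynomial killing t modulo I. It splits into linear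
    factors and I is prime, a contradiction. *)
Lemma residue_field (t : D) : exists a, I (t - f a).
Proof.
apply: contrapT => no.
have inv a : {u : D | I (1 - (t - f a) * u)}.
  by apply: cid; apply: maxI => ta; apply: no; exists a.
pose u a := sval (inv a).
have uE a : I (1 - (t - f a) * u a) by rewrite /u; case: (inv a).
have [N hN] := choice (fun a => monomial_span (u a)).
have [v hv] := choice hN.
have [n hn] := largeF N; have [s [us ss sN]] := hn n.+1.
pose a i : F := s`_i.
have aN (i : 'I_n.+1) : N (a i) = n.
  by have /allP h := sN; apply/eqP/h/mem_nth; rewrite ss.
pose M : 'M[F]_(n.+1, n) := \matrix_(i, k) v (a i) k.
have [w wM w0] : exists2 w : 'rV[F]_n.+1, w *m M = 0 & w != 0.
  have K0 : kermx M != 0.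
    rewrite kermx_eq0 /row_free; apply/negP => /eqP e.
    by have := rank_leq_col M; rewrite e ltnn.
  have [i Ki] : exists i, row i (kermx M) != 0.
    by apply/existsP; apply: contra_neqT K0; rewrite negb_exists => /forallP h;
      apply/row_matrixP => i; have /negbNE/eqP -> := h i; rewrite row0.
  by exists (row i (kermx M)) => //; rewrite -row_mul mulmx_ker row0.
have dep : \sum_i f (w 0 i) * u (a i) = 0.
  transitivity (\sum_(k < n) f ((w *m M) 0 k) * mono k); last first.
    by rewrite wM big1 // => k _; rewrite mxE rmorph0 mul0r.
  transitivity (\sum_i \sum_(k < n) f (w 0 i) * (f (v (a i) k) * mono k)).
    by apply: eq_bigr => i _; rewrite {1}hv aN mulr_sumr.
  rewrite exchange_big; apply: eq_bigr => k _ /=.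
  rewrite mxE rmorph_sum mulr_suml; apply: eq_bigr => i _.
  by rewrite mxE rmorphM mulrA.
pose q (i : 'I_n.+1) : {poly F} := \prod_(j < n.+1 | j != i) ('X - (a j)%:P).
pose p : {poly F} := \sum_i w 0 i *: q i.
(* At a_i all summands of p but the i-th vanish. *)
have p0 : p != 0.
  have [i wi] : exists i, w 0 i != 0.
    by apply/existsP; apply: contra_neqT w0; rewrite negb_exists => /forallP h;
      apply/rowP => i; have /negbNE/eqP -> := h i; rewrite mxE.
  apply: contra_neq (wi) => pz; have : p.[a i] = 0 by rewrite pz horner0.
  rewrite horner_sum (bigD1 i) //= big1 ?addr0 => [|j ji]; last first.
    rewrite hornerZ /q horner_prod (bigD1 i) 1?eq_sym //=.
    by rewrite hornerXsubC subrr mul0r mulr0.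
  rewrite hornerZ horner_prod => /eqP; rewrite mulf_eq0 => /predU1P [//|].
  move=> /prodf_eq0 [j ji]; rewrite hornerXsubC subr_eq0 nth_uniq ?ss // => /eqP e.
  by case/eqP: ji; apply: val_inj.
(* Multiply sum w_i u_i = 0 by the product of all t - a_j and use that (t - a_i) u_i is 1 modulo
   I. *)
have fp : I (map_poly f p).[t].
  have qt i : (map_poly f (q i)).[t] = \prod_(j < n.+1 | j != i) (t - f (a j)).
    rewrite rmorph_prod horner_prod; apply: eq_bigr => j _.
    by rewrite rmorphB /= map_polyX map_polyC hornerXsubC.
  have -> : (map_poly f p).[t] = \sum_i f (w 0 i) *
      ((1 - (t - f (a i)) * u (a i)) * (map_poly f (q i)).[t]) +
      (\sum_i f (w 0 i) * u (a i)) * \prod_(j < n.+1) (t - f (a j)).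
    rewrite mulr_suml -big_split rmorph_sum horner_sum; apply: eq_bigr => i _.
    rewrite /= map_polyZ hornerZ [in RHS](bigD1 i) //= -qt; ring.
  rewrite dep mul0r addr0; elim/big_rec: _ => [|i x _ Ix]; first exact: ideal0.
  apply: (idealD pI) => //; apply: (idealM pI); rewrite mulrC.
  exact: (idealM pI).
have [r pr] := closed_field_poly_normal p.
move: fp; rewrite pr map_polyZ hornerZ => /IP [fl|].
  apply: (ideal1 pI); have -> : 1 = f (lead_coef p)^-1 * f (lead_coef p).
    by rewrite -rmorphM mulVf ?rmorph1 // lead_coef_eq0.
  exact: (idealM pI).
rewrite rmorph_prod horner_prod => Ir; apply: no; apply: (Iprod (s := r) (P := xpredT)).
move: Ir; congr I; apply: eq_bigr => z _.
by rewrite rmorphB /= map_polyX map_polyC hornerXsubC.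
Qed.

Lemma residue_morphism : exists h : {rmorphism D -> F}, forall k, h (f k) = k.
Proof.
have [h hI] := choice residue_field.
have uniq t a b : I (t - f a) -> I (t - f b) -> a = b.
  move=> ta tb; apply/eqP; rewrite -subr_eq0; apply/negPn/negP => ab.
  apply: (ideal1 pI); have -> : 1 = f (a - b)^-1 * ((t - f b) - (t - f a)).
    have -> : t - f b - (t - f a) = f (a - b) by rewrite rmorphB; ring.
    by rewrite -rmorphM mulVf ?rmorph1.
  by apply: (idealM pI); exact: IB.
have hD : {morph h : x z / x + z}.
  move=> x z; apply: (@uniq (x + z)) => //; rewrite rmorphD.
  have -> : x + z - (f (h x) + f (h z)) = (x - f (h x)) + (z - f (h z)) by ring.
  exact: (idealD pI).
have hM : {morph h : x z / x * z}.
  move=> x z; apply: (@uniq (x * z)) => //; rewrite rmorphM.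
  have -> : x * z - (f (h x) * f (h z)) =
    z * (x - f (h x)) + f (h x) * (z - f (h z)) by ring.
  by apply: (idealD pI); exact: (idealM pI).
have hf k : h (f k) = k.
  by apply: (@uniq (f k)) => //; rewrite subrr; exact: ideal0.
have h1 : h 1 = 1 by rewrite -(rmorph1 f) hf.
by exists (rmorph_of hD hM h1).
Qed.
End MaximalQuotient.

Lemma nullstellensatz : exists h : {rmorphism D -> F}, forall k, h (f k) = k.
Proof.
have [|I [pI _ maxI]] := @maximal_ideal_exists D (fun x => x = 0).
  split=> // [x z -> ->|x z ->|]; rewrite ?addr0 ?mulr0 //.
  by move/eqP; rewrite oner_eq0.
exact: residue_morphism pI maxI.
Qed.
End Nullstellensatz.

(** The proof of 1 != 0 is attached to an alias of D, so that polynomials over D are available. *)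
Section NonzeroCopy.
Variables (D : comPzRingType) (D1 : (1 : D) != 0).
Definition nonzero_copy (_ : (1 : D) != 0) : Type := D.
HB.instance Definition _ := GRing.ComPzRing.on (nonzero_copy D1).
HB.instance Definition _ :=
  GRing.PzSemiRing_isNonZero.Build (nonzero_copy D1) D1.
Definition nonzero_ring : comNzRingType := nonzero_copy D1.
End NonzeroCopy.

Lemma fp_complex_point (R : realType) (D : fpcalg R[i]%C) : (1 : D) <> 0 ->
  exists h : {rmorphism D -> R[i]%C}, forall k, h (fp_str D k) = k.
Proof.
move=> D1; have [m [y [_ [geny _ _]]]] := fp_presented D.
have D1' : (1 : D) != 0 by apply/eqP.
exact: (@nullstellensatz _ (nonzero_ring D1') (fp_str D) (@complex_large R) m y geny).
Qed.

(** * Azumaya algebras have constant degree locally *)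

Lemma splits_rank_square (R : realType) (C : comPzRingType) (A : alg C)
    (J : finType) (x : J -> A) l (D : fpcalg R[i]%C) (g : {rmorphism C -> D}) r :
  azumaya A -> dual_basis x l -> splits (fun i j => g (l j (x i))) r ->
  exists n, splits (fun i j => g (l j (x i))) (n ^ 2).
Proof.
(* Over the zero ring any rank will do. Otherwise D has a complex point, and there r is the
   dimension of an Azumaya algebra. *)
move=> azA db hr; have [D0|D1] := pselect ((1 : D) = 0).
  have all0 (z z' : D) : z = z' by rewrite -[z]mulr1 -[z']mulr1 D0 !mulr0.
  by exists 0%N, (fun _ _ => 0), (fun _ _ => 0); split.
have [h _] := fp_complex_point D1.
pose gh : {rmorphism C -> R[i]%C} := [the {rmorphism C -> _} of h \o g].
have [fl [flE dbl]] := base_change_dual_basis gh db.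
have /(free_splits dbl) [phi [psi phiK psiK]] :
    splits (fun j k => fl k (@tten C A _ (x j) 1)) r.
  by apply: splits_eq (splits_map h hr) => j k; rewrite flE mulr1.
have [n rn] := azumaya_rank_square (base_change_azumaya gh azA) phiK psiK.
by exists n; rewrite -mulnn -rn.
Qed.

(** The matrix of the l_j(x_i) is idempotent with image A. The d_s are its mixed determinants: they
    sum to 1, and inverting one makes A free. *)
Lemma azumaya_locally_square (R : realType) (C : fpcalg R[i]%C) (A : alg C) :
  azumaya A -> exists n (x : 'I_n -> A) l (T : finType) (d : T -> C),
  [/\ dual_basis x l, \sum_s d s = 1 &
    forall s (D : fpcalg R[i]%C) (g : {rmorphism C -> D}),
      (exists u, u * g (d s) = 1) ->
      exists k, splits (fun i j => g (l j (x i))) (k ^ 2)].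
Proof.
move=> azA; have [dA] := azumaya_has_data azA.
have db := dual_basis_ord (data_dual_basis dA).
set x := (_ \o _) in db; set l := (_ \o _) in db.
pose P : 'M[C]_#|ad_index dA| := \matrix_(i, j) l j (x i).
have PP : P *m P = P.
  apply/matrixP => i j; rewrite !mxE [x i in RHS](db_decomp db) raddf_sum.
  by apply: eq_bigr => k _; rewrite !mxE (db_lZ db).
exists #|ad_index dA|, x, l, {ffun 'I_#|ad_index dA| -> bool}.
exists (fun s => \det (mixed_rows P s)); split=> //.
  exact: sum_det_mixed_rows.
move=> s D g [u ud]; apply: (splits_rank_square (r := _) azA db).
apply: splits_eq (splits_mixed_rows PP ud) => i j.
by rewrite mxE.
Qed.

Section TensorRank.
Variables (C E : comPzRingType) (A : alg C) (B : alg E) (s : {rmorphism C -> B}).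
Hypothesis s_central : forall c x, GRing.comm (s c) x.
Let BC : alg C := @Alg C B s s_central.
Let T : alg E := @tensor_alg C E A BC (alg_str B) (@alg_central _ B).
Variables (c : {rmorphism C -> E}) (sc : forall x, s x = alg_str B (c x)).
Variables (J : finType) (x : J -> A) (l : J -> {additive A -> C}).
Hypotheses (db : dual_basis x l) (azB : azumaya B).

(** A splitting of A over D and local splittings of B multiply, so the rank is the square of k m. *)
Lemma tensor_constant_degree (D : comPzRingType) (f : {rmorphism E -> D}) k :
  splits (fun i j => f (c (l j (x i)))) (k ^ 2) ->
  constant_degree (base_change B f) -> constant_degree (base_change T f).
Proof.
move=> hA [m hB]; have [dB] := azumaya_has_data azB.
have [t [tE dbT]] := @tensor_dual_basis C E A B s s_central c sc _ _ _ _ _ _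
  (ad_str_inj dB) db (data_dual_basis dB).
have [tl [tlE dbTl]] := base_change_dual_basis f dbT.
have [bl [blE dbBl]] := base_change_dual_basis f (data_dual_basis dB).
exists (k * m)%N; rewrite expnMn; apply/(constant_rankP dbTl) => p L i pp loc.
have hB' := (constant_rankP dbBl _).1 hB p L i pp loc.
apply: splits_eq (splits_prod (splits_map i hA) hB') => j j' /=.
by rewrite tlE blE tE !mulr1 !rmorphM.
Qed.

Lemma tensor_constant_degree_self k :
  splits (fun i j => c (l j (x i))) (k ^ 2) ->
  constant_degree B -> constant_degree T.
Proof.
move=> hA [m hB]; have [dB] := azumaya_has_data azB.
have [t [tE dbT]] := @tensor_dual_basis C E A B s s_central c sc _ _ _ _ _ _
  (ad_str_inj dB) db (data_dual_basis dB).
exists (k * m)%N; rewrite expnMn; apply/(constant_rankP dbT) => p L i pp loc.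
have hB' := (constant_rankP (data_dual_basis dB) _).1 hB p L i pp loc.
apply: splits_eq (splits_prod (splits_map i hA) hB') => j j' /=.
by rewrite tE rmorphM.
Qed.
End TensorRank.

Lemma base_change_constant_degree (K D : comPzRingType) (A : alg K)
    (f : {rmorphism K -> D}) : azumaya A ->
  constant_degree A -> constant_degree (base_change A f).
Proof. by move=> azA [n hn]; exists n; exact: base_change_constant_rank. Qed.

Lemma base_change_comp_constant_degree (K D D' : comPzRingType) (A : alg K)
    (f : {rmorphism K -> D}) (g : {rmorphism D -> D'}) (h : {rmorphism K -> D'}) :
  (forall k, h k = g (f k)) -> azumaya A ->
  constant_degree (base_change A f) -> constant_degree (base_change A h).
Proof.
move=> hE azA [n hn]; have [d] := azumaya_has_data azA; exists n.
have [fl [flE dbf]] := base_change_dual_basis f (data_dual_basis d).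
have [hl [hlE dbh]] := base_change_dual_basis h (data_dual_basis d).
apply/(constant_rankP dbh) => p L i pp loc.
apply: splits_eq (constant_rank_along dbf g hn pp loc) => j k.
by rewrite flE hlE !mulr1 hE.
Qed.

Lemma base_change_lift (K D : comPzRingType) (A : alg K) (f : {rmorphism K -> D})
    (B : alg D) (phi : {rmorphism A -> B}) :
  (forall k, phi (alg_str A k) = alg_str B (f k)) ->
  exists g : alg_hom (base_change A f) B,
    forall a, g (@tinl K A (Defs.comm_alg f) a) = phi a.
Proof.
move=> phi_str.
have [||g gE] := @tring_lift K A (Defs.comm_alg f) B phi (alg_str B).
- by move=> k; rewrite phi_str.
- by move=> a b; exact/commr_sym/alg_central.
have g_str d : g (alg_str (base_change A f) d) = alg_str B d.
  by rewrite [LHS]gE rmorph1 mul1r.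
exists (@AlgHom D (base_change A f) B g g_str) => a.
by rewrite [LHS]gE rmorph1 mulr1.
Qed.

Section BaseChangeArrow.
Variables (K : comPzRingType) (B : azob K) (D : fpcalg K).
Variable k : alg_hom (fp_alg (az_center B)) (fp_alg D).

Definition az_base_change : azob K :=
  @AzOb K D _ (base_change_azumaya k (az_azumaya B)).

Lemma base_change_unit_str c :
  tinl (Defs.comm_alg k) (alg_str (az_res B) c) = alg_str (az_res az_base_change) c.
Proof.
rewrite -[RHS]/(@tten _ (az_alg B) (Defs.comm_alg k) 1 (fp_str D c)).
rewrite -(alg_fun_str k c) /tinl -[X in tten X _]mulr1.
by rewrite (@ttenZ _ (az_alg B) (Defs.comm_alg k)) mulr1.
Qed.

Definition base_change_unit_hom : alg_hom (az_res B) (az_res az_base_change) :=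
  @AlgHom K (az_res B) (az_res az_base_change)
    [the {rmorphism az_alg B -> _} of @tinl _ (az_alg B) (Defs.comm_alg k)]
    base_change_unit_str.

Lemma base_change_unit_center z : central z -> central (base_change_unit_hom z).
Proof.
move=> cz; apply: (@tringC _ (az_alg B) (Defs.comm_alg k) _
  [the {rmorphism _ -> _} of idfun]) => [a|b] /=; rewrite /GRing.comm !ttenM.
  by rewrite !mulr1 cz.
by rewrite !mulr1 !mul1r.
Qed.

Definition base_change_unit : az_hom B az_base_change :=
  AzHom base_change_unit_center.
End BaseChangeArrow.

(** A witness B -> B' over D, followed by the unit of base change from D to D', stays in L and is a
    witness over D'. *)
Lemma maximal_flat_arrows_sieve (K : comPzRingType) (B : azob K)
    (L : @arrows (Azufine K) B) :
  is_sieve L -> is_sieve (maximal_flat_arrows L).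
Proof.
move=> sL D D' f k [cd [B' [azB' [g [h [cdB' hg Lh]]]]]].
split.
  exact: (base_change_comp_constant_degree (f := fp_hom f) (g := fp_hom k) _ (az_azumaya B)).
pose B1 := @AzOb K D B' azB'.
pose u := @base_change_unit K B1 D' k.
have phi_str e : (u \o h) (alg_str (az_alg B) e) =
    alg_str (base_change B' (fp_hom k)) (fp_hom (comp f k) e).
  rewrite /= hg /tinl.
  have -> : @tten _ (az_alg B) _ (alg_str (az_alg B) e) 1 =
      alg_str (base_change (az_alg B) (fp_hom f)) (fp_hom f e).
    rewrite -[X in tten X _]mulr1 (@ttenZ _ (az_alg B) (Defs.comm_alg (fp_hom f))).
    by rewrite mulr1.
  rewrite alg_fun_str -[X in tten X _]mulr1.
  by rewrite (@ttenZ _ B' (Defs.comm_alg (fp_hom k))) mulr1.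
have [g' g'E] := base_change_lift
  (phi := [the {rmorphism az_alg B -> base_change B' (fp_hom k)} of u \o h]) phi_str.
exists (base_change B' (fp_hom k)), (base_change_azumaya (fp_hom k) azB'), g'.
exists (az_comp u h); split.
- exact: base_change_constant_degree.
- by move=> b; rewrite g'E.
- exact: (sL _ _ _ u Lh).
Qed.

Lemma base_change_scalar (K D : comPzRingType) (A : alg K) (f : {rmorphism K -> D}) k :
  @tten K A (Defs.comm_alg f) (alg_str A k) 1 = alg_str (base_change A f) (f k).
Proof.
by rewrite -[X in tten X _]mulr1 (@ttenZ K A (Defs.comm_alg f)) mulr1.
Qed.

Lemma base_change_arrow_str (K D : comPzRingType) (A : alg K)
    (f : {rmorphism K -> D}) (B : alg D) (g : alg_hom (base_change A f) B)
    (h : A -> B) : (forall a, h a = g (@tinl K A (Defs.comm_alg f) a)) ->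
  forall k, h (alg_str A k) = alg_str B (f k).
Proof. by move=> hE k; rewrite hE [tinl _ _]base_change_scalar alg_fun_str. Qed.

Lemma fp_res_defined_holds (K : comPzRingType) (C : fpcalg K) : fp_res_defined C.
Proof. by move=> D; apply: fp_comp; exact: fp_presented. Qed.

(** * Restriction to commutative algebras *)

Section RestrictToAffine.
Variables (K : comPzRingType) (C : fpcalg K) (defI : fp_res_defined C).
Local Notation AzC := (Azumaya_under (comm_az C)).

Lemma incl_hom_exists (W : fpcalg C) (Z : AzC)
    (u : {rmorphism W -> az_alg (under_cod Z)}) :
  (forall w, central (u w)) ->
  (forall c, u (fp_str W c) = alg_fun (az_fun (under_str Z)) c) ->
  exists m : @hom AzC (incl_ob defI W) Z,
    forall w, alg_fun (az_fun (under_fun m)) w = u w.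
Proof.
move=> cu uC.
have u_str k : u (alg_str (az_res (comm_az (fp_res defI W))) k) =
    alg_str (az_res (under_cod Z)) k.
  by rewrite /= uC; exact: (alg_fun_str (az_fun (under_str Z)) k).
pose m := @AzHom K (comm_az (fp_res defI W)) (under_cod Z)
  (@AlgHom K (az_res (comm_az (fp_res defI W))) (az_res (under_cod Z)) u u_str)
  (fun z _ => cu z).
have mC : @comp (Azumaya_cat K) _ _ _ m (under_str (incl_ob defI W)) = under_str Z.
  by apply: az_hom_ext => c; exact: uC.
by exists (@UnderHom (Azumaya_cat K) (comm_az C) (incl_ob defI W) Z m mC).
Qed.

Lemma under_ext (X Y : AzC) (f g : hom X Y) :
  (forall x, alg_fun (az_fun (under_fun f)) x = alg_fun (az_fun (under_fun g)) x) ->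
  f = g.
Proof. by move=> fg; apply: under_hom_ext; apply: az_hom_ext. Qed.

Let U := op_functor (inclusion defI).

(** W is the fiber product. Center-preserving maps send commutative algebras into the center of Z,
    so the two images commute and the pushout ring maps to Z. *)
Lemma inclusion_span (X Y Y' : affine C) (Z : Azufine_under (comm_az C))
    (f : hom Y X) (f' : hom Y' X) (g : hom Z (U Y)) (g' : hom Z (U Y')) :
  comp (fmap U f) g = comp (fmap U f') g' ->
  exists W (a : hom W Y) (a' : hom W Y') (m : hom Z (U W)),
    [/\ comp f a = comp f' a', g = comp (fmap U a) m & g' = comp (fmap U a') m].
Proof.
move=> e.
pose G : {rmorphism fp_ring Y -> az_alg (under_cod Z)} := alg_fun (az_fun (under_fun g)).
pose G' : {rmorphism fp_ring Y' -> az_alg (under_cod Z)} :=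
  alg_fun (az_fun (under_fun g')).
have Gc y : central (G y).
  by apply: (@az_fun_center K _ _ (under_fun g) y) => z; exact: mulrC.
have G'c y : central (G' y).
  by apply: (@az_fun_center K _ _ (under_fun g') y) => z; exact: mulrC.
have GG' x : G' (fp_hom f' x) = G (fp_hom f x).
  have /(congr1 (fun h : @hom AzC (incl_ob defI X) Z =>
    alg_fun (az_fun (under_fun h)) x)) := e.
  by move/esym.
have [a b|u [ul ur]] := push_lift GG'; first by move=> *; exact: G'c.
have uc w : central (u w).
  move=> z; elim/push_ind: w => [y' y|w w' hw hw'].
    rewrite rmorphM ul ur; apply/commr_sym/commrM; apply/commr_sym.
      exact: G'c.
    exact: Gc.
  by rewrite rmorphD; apply/commr_sym/commrD; apply/commr_sym.
have uC c : u (fp_str (fiber_product f f') c) = alg_fun (az_fun (under_str Z)) c.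
  rewrite [LHS]ul -(under_comm g').
  by [].
have [m mE] := @incl_hom_exists (fiber_product f f') Z u uc uC.
exists (fiber_product f f'), (fiber_snd f f'), (fiber_fst f f'), m; split.
- exact/esym/fiber_comm.
- by apply: (@under_ext (incl_ob defI Y) Z) => y; rewrite [RHS]mE ur.
- by apply: (@under_ext (incl_ob defI Y') Z) => y; rewrite [RHS]mE ul.
Qed.

(** Over each member of the flat cover the witness B' is the ring itself, of degree 1. *)
Lemma inclusion_cover (X : affine C) (I : Type) (Y : I -> affine C)
    (f : forall i, @hom (affine C) (Y i) X) : @flat_covers C X I Y f ->
  @maximal_flat_under K (comm_az C) (U X) (image_sieve U (sieve_of_family f)).
Proof.
move=> [finI ffP]; split; first exact: image_sieveP.
pose L : @arrows (Azufine K) (comm_az (fp_res defI X)) :=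
  image_sieve (Azufine_forget (comm_az C)) (image_sieve U (sieve_of_family f)).
have sL : is_sieve L.
  exact: (@image_sieveP _ _ (Azufine_forget (comm_az C)) (U X) (image_sieve U (sieve_of_family f))).
have sM := maximal_flat_arrows_sieve sL.
split=> //; split=> //.
have f_str i k : alg_fun (f i) (fp_str (fp_res defI X) k) = fp_str (fp_res defI (Y i)) k.
  exact: (alg_fun_str (f i) (fp_str C k)).
pose f' i : @hom (affine K) (fp_res defI (Y i)) (fp_res defI X) :=
  @fp_arrow K (fp_res defI X) (fp_res defI (Y i)) (alg_fun (f i)) (f_str i).
apply: (topology_sup (generated_topology (@flat_covers K)) (S := sieve_of_family f')) => //.
  by apply: generated_cover; split.
move=> Z _ [i [g ->]]; apply: sM; split.
  exact: base_change_constant_degree (self_azumaya _) (self_constant_degree _).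
have [|b hb] := @base_change_lift (fp_res defI X) (fp_res defI (Y i))
  (self_alg (fp_res defI X)) (fp_hom (f' i)) (self_alg (fp_res defI (Y i)))
  (fp_hom (f' i)); first by [].
exists (self_alg _), (self_azumaya _), b, (incl_arr defI (f i)); split.
- exact: self_constant_degree.
- by move=> x; rewrite hb.
- exists (U (Y i)), (fmap U (f i)), (idm _); split; last by apply: az_hom_ext.
  exists (Y i), (f i), (idm _); split; last by rewrite comp_idr.
  by exists i, (idm _); rewrite comp_idr.
Qed.

Lemma restrict_to_affine_sheaf (F : presheaf (Azufine_under (comm_az C))) :
  is_sheaf (@maximal_flat_under _ (comm_az C)) F ->
  is_sheaf (@flat_topology C) (restrict_to_affine defI F).
Proof.
move=> sF; apply: flat_sheaf_criterion => X I Y f cf.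
apply: (@sheaf_condition_precomp _ _ U F _ X _ sF).
- exact: sieve_of_familyP.
- exact: inclusion_cover.
- by move=> Z Y1 Y2 g1 g2 h1 h2 _ _; exact: inclusion_span.
Qed.
End RestrictToAffine.

(** * The centralizer of an Azumaya subalgebra is Azumaya *)

Section Centralizer.
Variables (A B : pzRingType) (h : {rmorphism A -> B}).

Definition centralizes : {pred B} := fun y => `[< forall a, GRing.comm y (h a) >].

Lemma centralizesP y : reflect (forall a, GRing.comm y (h a)) (y \in centralizes).
Proof. exact: asboolP. Qed.

Fact centralizes_subring : subring_closed centralizes.
Proof.
split=> [|x y /centralizesP hx /centralizesP hy|x y /centralizesP hx /centralizesP hy];
  apply/centralizesP => a.
- exact/commr_sym/commr1.
- by apply/commr_sym/commrB; apply/commr_sym.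
- by apply/commr_sym/commrM; apply/commr_sym.
Qed.

Definition centralizer : Type := {x : B | x \in centralizes}.
HB.instance Definition _ := SubChoice.on centralizer.
HB.instance Definition _ :=
  GRing.SubChoice_isSubPzRing.Build B _ centralizer centralizes_subring.
End Centralizer.

Section CentralizerAzumaya.
Variables (C E : comPzRingType) (A : alg C) (B : alg E) (h : {rmorphism A -> B}).
Hypothesis hc : forall c x, GRing.comm (h (alg_str A c)) x.
Variables (dA : azumaya_data A) (dB : azumaya_data B).

Local Notation W := (centralizer h).

Let mk (y : B) (hy : forall a, GRing.comm y (h a)) : W :=
  exist _ y (introT (centralizesP h y) hy).
Let wh (w : W) a : GRing.comm (val w) (h a).
Proof. by case: w => y /= /centralizesP. Qed.

Let str (e : E) : W := mk (fun a => alg_central e (h a)).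
Let strD : {morph str : x y / x + y}.
Proof. by move=> x y; apply: val_inj; rewrite /= rmorphD. Qed.
Let strM : {morph str : x y / x * y}.
Proof. by move=> x y; apply: val_inj; rewrite /= rmorphM. Qed.
Let str1 : str 1 = 1.
Proof. by apply: val_inj; rewrite /= rmorph1. Qed.
Let str_central e w : GRing.comm (rmorph_of strD strM str1 e) w.
Proof. by apply: val_inj; exact: alg_central. Qed.

Definition centralizer_alg : alg E := @Alg E W (rmorph_of strD strM str1) str_central.

Let act (j : ad_index dA) (y : B) : W :=
  mk (fun a => commr_sym (bimod_actC (fun k => hc k y) a j)).

Let decomp y : y = \sum_j h (ad_x dA j) * val (act j y).
Proof. by rewrite /= (bimod_act_decomp dA (fun k => hc k y)). Qed.

Let actD j : {morph act j : x y / x + y}.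
Proof. by move=> x y; apply: val_inj; rewrite /= bimod_actD. Qed.

Let actZ j e y : act j (alg_str B e * y) = alg_str centralizer_alg e * act j y.
Proof.
apply: val_inj; rewrite /= mulr_sumr; apply: eq_bigr => p _.
by rewrite !mulrA (alg_central e (h p.1)).
Qed.

Let hk (c : C) : W := mk (fun a => hc c (h a)).

Let hkD x y : hk (x + y) = hk x + hk y.
Proof. by apply: val_inj; rewrite /= !rmorphD. Qed.
Let hk0 : hk 0 = 0.
Proof. by apply: val_inj; rewrite /= !rmorph0. Qed.

(** Since B is A (x) W, the map m (x) id retracts B onto W; this is its formula in terms of the
    e_j. *)
Let p (y : B) : W := \sum_j hk (ad_m dA (ad_x dA j)) * act j y.

Let pD : {morph p : x y / x + y}.
Proof.
by move=> x y; rewrite -big_split; apply: eq_bigr => j _; rewrite actD mulrDr.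
Qed.

Let p0 : p 0 = 0.
Proof. by apply: (addrI (p 0)); rewrite -pD !addr0. Qed.

Let pZ e y : p (alg_str B e * y) = alg_str centralizer_alg e * p y.
Proof.
rewrite mulr_sumr; apply: eq_bigr => j _; rewrite actZ !mulrA.
by rewrite (alg_central e (hk _ : centralizer_alg)).
Qed.

Let p_mul a w : p (h a * val w) = hk (ad_m dA a) * w.
Proof.
transitivity ((\sum_j hk (ad_m dA (ad_x dA j) * ad_l dA j a)) * w).
  rewrite mulr_suml; apply: eq_bigr => j _; apply: val_inj; rewrite /=.
  rewrite bimod_act_lin ?mulrA -?rmorphM //.
  by move=> b; exact/commr_sym/wh.
congr (_ * w); rewrite [a in RHS](ad_decomp dA) raddf_sum.
rewrite (big_morph _ hkD hk0); apply: eq_bigr => j _.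
by rewrite ad_mZ mulrC.
Qed.

Let p_val w : p (val w) = w.
Proof.
have := p_mul 1 w; rewrite rmorph1 mul1r ad_m1 => ->.
by apply: val_inj; rewrite /= !rmorph1 mul1r.
Qed.

Let nu k : {additive W -> E} := [the {additive W -> E} of ad_l dB k \o val].

Lemma centralizer_dual_basis :
  @dual_basis E centralizer_alg _ (fun k => p (ad_x dB k)) nu.
Proof.
split=> [k e w|w]; first by rewrite /= ad_lZ.
rewrite -[LHS]p_val [val w](ad_decomp dB) (big_morph _ pD p0).
by apply: eq_bigr => k _; rewrite pZ.
Qed.

Local Notation Wa := centralizer_alg.

(** W (x) W^op embeds in B (x) B^op with retraction given by [p]. Acting on h(a) w, an element t of
    it gives h(a) t(w), so its action on W determines its action on B. *)
Lemma centralizer_sandwich_inj : injective (@sandwich E Wa).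
Proof.
have [io ioE] : exists u : {additive tring Wa (op_alg Wa) -> tring B (op_alg B)},
    forall w w' : W, u (opten Wa w w') = opten B (val w) (val w').
  apply: (@tring_additive E Wa (op_alg Wa) _ (fun w w' => opten B (val w) (val w'))).
  - by move=> w w' v; rewrite ttenDl.
  - by move=> w v v'; exact: (@ttenDr E B (op_alg B)).
  - move=> e w v; rewrite -[RHS](@ttenZ E B (op_alg B) e (val w) (val v)).
    by [].
have [pp ppE] : exists u : {additive tring B (op_alg B) -> tring Wa (op_alg Wa)},
    forall y y' : B, u (opten B y y') = opten Wa (p y) (p y').
  apply: (@tring_additive E B (op_alg B) _ (fun y y' => opten Wa (p y) (p y'))).
  - by move=> w w' v; rewrite pD ttenDl.
  - by move=> w v v'; rewrite (pD v v') (@ttenDr E Wa (op_alg Wa)).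
  - move=> e y y'; rewrite pZ (@ttenZ E Wa (op_alg Wa)); congr tten.
    rewrite -[alg_str (op_alg B) e * y']/((y' : B) * alg_str B e).
    rewrite -(alg_central e (y' : B)) pZ.
    exact: alg_central.
have ioK : cancel io pp.
  apply: (@tring_eq _ _ _ _ (pp \o io : {additive _ -> _}) idfun) => w w'.
  by rewrite /= ioE ppE !p_val.
have act_io (t : tring Wa (op_alg Wa)) w y : sandwich_fun (io t) (h y * val w : B) =
    h y * val (sandwich_fun t w : W) :> B.
  elim/tring_ind: t => [|u v|t t' ht ht'].
  - by rewrite raddf0 !sandwich_fun0 mulr0.
  - rewrite ioE !sandwich_tten /= !mulrA (wh u y) -!mulrA; congr (_ * _).
  - by rewrite raddfD !sandwich_funD ht ht' /= mulrDr.
move=> t t' tt'; rewrite -[t]ioK -[t']ioK; congr (pp _).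
apply: (sandwich_inj (data_azumaya dB)) => y.
rewrite [y in LHS]decomp [y in RHS]decomp.
rewrite !(raddf_sum (@sandwich E B _)); apply: eq_bigr => j _.
rewrite [LHS]act_io [RHS]act_io; congr (_ * val _).
exact: (congr1 (fun f : {linear as_mod Wa -> as_mod Wa} => f (act j y)) tt').
Qed.

(** The endomorphism f p of B is a sandwich. Expanding its factors in B = A W and applying [p]
    replaces the parts in A by the scalars m(x_j x_k). *)
Lemma centralizer_sandwich_surj (f : {linear as_mod Wa -> as_mod Wa}) :
  exists t, @sandwich E Wa t = f.
Proof.
have [||s hs] := azumaya_endomorphism (data_azumaya dB) (f := fun y => val (f (p y) : W)).
- by move=> x y; rewrite pD (linearD f).
- move=> e y; rewrite pZ.
  by rewrite (linearZ_LR f e (p y)).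
pose F j k (q : B * B) : tring Wa (op_alg Wa) :=
  opten Wa (hk (ad_m dA (ad_x dA j * ad_x dA k)) * act j q.1) (act k q.2).
exists (\sum_(q <- s) \sum_j \sum_k F j k q); apply: linear_ext => w.
rewrite /= sandwich_fun_sum.
transitivity (p (bimod_act idfun s (val w))); last by rewrite hs !p_val.
rewrite /bimod_act (big_morph _ pD p0); apply: eq_bigr => q _.
rewrite /= [q.1 in RHS]decomp [q.2 in RHS]decomp !mulr_suml (big_morph _ pD p0).
rewrite sandwich_fun_sum; apply: eq_bigr => j _.
rewrite mulr_sumr (big_morph _ pD p0) sandwich_fun_sum; apply: eq_bigr => k _.
rewrite /F sandwich_tten -!mulrA -p_mul; congr p; rewrite rmorphM -!mulrA.
congr (_ * _).
have c1 := wh (act j q.1) (ad_x dA k); have c2 := wh w (ad_x dA k).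
rewrite /= in c1 c2 *; rewrite !mulrA -c1.
by rewrite -(mulrA _ (h (ad_x dA k)) (sval w)) -c2 !mulrA.
Qed.

Lemma centralizer_azumaya : azumaya centralizer_alg.
Proof.
split.
- move=> e /(_ (1 : W)) /(congr1 val); rewrite as_mod_scaleE /= mulr1 => e0.
  by apply: (ad_str_inj dB); rewrite e0 rmorph0.
- exact: dual_basis_projective centralizer_dual_basis.
- have [g hg] := choice centralizer_sandwich_surj.
  by exists g => // t; apply: centralizer_sandwich_inj; rewrite hg.
Qed.
End CentralizerAzumaya.

(** * Restriction to algebras under A, and the functor A (x)_C - *)

Section RestrictToA.
Variables (K : comPzRingType) (A : azob K).

(** Take Z itself with the structure map through Y. Equality of the composites from X makes the map
    through Y' the same. *)
Lemma forget_span (X Y Y' : Azufine_under A) (Z : Azufine K)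
    (f : hom Y X) (f' : hom Y' X) (g : hom Z (Azufine_forget A Y))
    (g' : hom Z (Azufine_forget A Y')) :
  comp (fmap (Azufine_forget A) f) g = comp (fmap (Azufine_forget A) f') g' ->
  exists W (a : hom W Y) (a' : hom W Y') (m : hom Z (Azufine_forget A W)),
    [/\ comp f a = comp f' a', g = comp (fmap (Azufine_forget A) a) m
      & g' = comp (fmap (Azufine_forget A) a') m].
Proof.
move=> e; pose CA := Azumaya_cat K.
pose W : Azumaya_under A := @UnderOb CA A Z (@comp CA _ _ _ g (under_str Y)).
pose a : @hom (Azumaya_under A) Y W := @UnderHom CA A Y W g erefl.
have gY' : @comp CA _ _ _ g' (under_str Y') = under_str W.
  rewrite -(under_comm f') /= -(under_comm f).
  rewrite [LHS](@comp_assoc CA) [RHS](@comp_assoc CA); congr (@comp CA _ _ _ _ _).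
  exact/esym/e.
pose a' : @hom (Azumaya_under A) Y' W := @UnderHom CA A Y' W g' gY'.
exists W, a, a', (@idm CA Z); split.
- exact/under_hom_ext/e.
- exact/esym/(@comp_idl CA).
- exact/esym/(@comp_idl CA).
Qed.

Lemma restrict_to_A_sheaf (F : presheaf (Azufine K)) :
  is_sheaf (@maximal_flat_topology K) F ->
  is_sheaf (@maximal_flat_under K A) (restrict_to_A A F).
Proof.
move=> sF X S [sS JS].
apply: (@sheaf_condition_precomp _ _ (Azufine_forget A) F _ X S sF sS JS).
by move=> Z Y Y' f f' g g' _ _; exact: forget_span.
Qed.
End RestrictToA.

Lemma az_central_str (K : comPzRingType) (A : alg K) z : azumaya A -> central z ->
  exists k, z = alg_str A k.
Proof. by move=> /azumaya_has_data [d] cz; exists (ad_m d z); exact: ad_center. Qed.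

Section TensorFunctorSpan.
Variables (K : comPzRingType) (A : azob K) (defT : az_tensor_defined A).
Local Notation C := (az_center A).
Local Notation AzC := (Azumaya_under (comm_az C)).
Local Notation CA := (Azumaya_cat K).

Lemma center_inclusion_str k :
  alg_str (az_alg A) (alg_str (az_res (comm_az C)) k) = alg_str (az_res A) k.
Proof. by []. Qed.

Definition center_inclusion : az_hom (comm_az C) A :=
  @AzHom K (comm_az C) A
    (@AlgHom K (az_res (comm_az C)) (az_res A) (alg_str (az_alg A))
      center_inclusion_str)
    (fun z _ => @str_central _ (az_alg A) z).

Definition tensor_inr (Y : AzC) : az_hom (under_cod Y) (az_tensor_cod defT Y) :=
  @AzHom K (under_cod Y) (az_tensor_cod defT Y)
    (@AlgHom K (az_res (under_cod Y)) (az_res (az_tensor_cod defT Y))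
      [the {rmorphism under_alg Y -> _} of @tinr C (az_alg A) (under_alg Y)]
      (fun=> erefl))
    (fun z cz => @tten_central C (az_alg A) (under_alg Y) z cz).

Section Centralizing.
Variable Z : Azumaya_under A.
Let B := under_cod Z.
Let h : {rmorphism az_alg A -> az_alg B} := alg_fun (az_fun (under_str Z)).
Let hc c x : GRing.comm (h (alg_str (az_alg A) c)) x.
Proof. by apply: (@az_fun_center K A B (under_str Z)); exact: (@str_central _ (az_alg A)). Qed.
Variables (dA : azumaya_data (az_alg A)) (dB : azumaya_data (az_alg B)).

Definition centralizer_ob : azob K := AzOb (centralizer_azumaya hc dA dB).

Lemma corestrict (Y : azob K) (phi : az_hom Y B) :
  (forall y a, GRing.comm (phi y) (h a)) ->
  exists psi : az_hom Y centralizer_ob,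
    forall y, val (psi y : centralizer h) = phi y.
Proof.
move=> hphi.
pose f y : centralizer h := exist _ (phi y) (introT (centralizesP h _) (hphi y)).
have fD : {morph f : x y / x + y} by move=> x y; apply: val_inj; rewrite /= rmorphD.
have fM : {morph f : x y / x * y} by move=> x y; apply: val_inj; rewrite /= rmorphM.
have f1 : f 1 = 1 by apply: val_inj; rewrite /= rmorph1.
have f_str k : rmorph_of fD fM f1 (alg_str (az_res Y) k) =
    alg_str (az_res centralizer_ob) k.
  by apply: val_inj; exact: (alg_fun_str phi k).
have fc z : central z -> central (rmorph_of fD fM f1 z).
  move=> /(@az_fun_center K Y B phi) cz w; apply: val_inj; exact: cz.
by exists (@AzHom K Y centralizer_ob
  (@AlgHom K (az_res Y) (az_res centralizer_ob) (rmorph_of fD fM f1) f_str) fc).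
Qed.
End Centralizing.

Let U := op_functor (tensor_functor defT).

(** W is the centralizer of A in Z. Maps A (x) Y -> Z under A correspond to maps Y -> W, and
    multiplication A (x) W -> Z recovers them. *)
Lemma tensor_span (X Y Y' : Azufine_under (comm_az C)) (Z : Azufine_under A)
    (f : hom Y X) (f' : hom Y' X) (g : hom Z (U Y)) (g' : hom Z (U Y')) :
  comp (fmap U f) g = comp (fmap U f') g' ->
  exists W (a : hom W Y) (a' : hom W Y') (m : hom Z (U W)),
    [/\ comp f a = comp f' a', g = comp (fmap U a) m & g' = comp (fmap U a') m].
Proof.
move=> e; have [dA] := azumaya_has_data (az_azumaya A).
have [dB] := azumaya_has_data (az_azumaya (under_cod Z)).
pose h : {rmorphism az_alg A -> az_alg (under_cod Z)} := alg_fun (az_fun (under_str Z)).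
have h_inl (V : AzC) (k : @hom (Azumaya_under A) (az_tensor_ob defT V) Z) a :
    az_fun (under_fun k) (@tinl C (az_alg A) (under_alg V) a) = h a.
  by rewrite /h -(under_comm k).
have comm_inr (V : AzC) (k : @hom (Azumaya_under A) (az_tensor_ob defT V) Z) y a :
    GRing.comm (@az_comp K _ _ _ (under_fun k) (tensor_inr V) y) (h a).
  rewrite -(h_inl V k) /GRing.comm /= -!rmorphM; congr (_ _).
  by rewrite /tinl /tinr !(@ttenM C (az_alg A) (under_alg V)) !mulr1 !mul1r.
have [s hs] := @corestrict Z dA dB (comm_az C)
  (az_comp (under_str Z) center_inclusion)
  (fun c a => @az_fun_center K A (under_cod Z) (under_str Z) _
    (@str_central _ (az_alg A) c) _).
pose W : AzC := @UnderOb CA (comm_az C) (centralizer_ob dA dB) s.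
have lift (V : AzC) (k : @hom (Azumaya_under A) (az_tensor_ob defT V) Z) :
    exists a : @hom AzC V W, forall y, val (under_fun a y : centralizer h) =
      az_fun (under_fun k) (@tinr C (az_alg A) (under_alg V) y).
  have [psi hpsi] := @corestrict Z dA dB _ (@az_comp K _ _ _ (under_fun k) (tensor_inr V))
    (comm_inr V k).
  have psi_comm : @comp CA _ _ _ psi (under_str V) = under_str W.
    apply: az_hom_ext => c; apply: val_inj; rewrite [LHS]hpsi [RHS]hs.
    rewrite -[RHS]/(h (alg_str (az_alg A) c)) -(h_inl V k); congr (az_fun (under_fun k) _).
    have := @ttenZ C (az_alg A) (under_alg V) c 1 1; rewrite !mulr1.
    by move/esym.
  by exists (@UnderHom CA (comm_az C) V W psi psi_comm).
have [a ha] := lift Y g; have [a' ha'] := lift Y' g'.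
have [||u uE] := @tring_lift C (az_alg A) (under_alg W) (az_alg (under_cod Z)) h
    [the {rmorphism centralizer h -> _} of val].
- by move=> c; rewrite [RHS]hs.
- by move=> b [w /= /centralizesP hw]; exact/commr_sym/hw.
have u_str k : u (alg_str (az_res (az_tensor_cod defT W)) k) =
    alg_str (az_res (under_cod Z)) k.
  by rewrite [LHS]uE rmorph1 mul1r.
have uc z : central z -> central (u z).
  move=> /(az_central_str (defT.1 W)) [k ->].
  by rewrite [u _]uE rmorph1 mul1r; exact: (@str_central _ (az_alg (under_cod Z))).
pose m0 := @AzHom K (az_tensor_cod defT W) (under_cod Z)
  (@AlgHom K (az_res (az_tensor_cod defT W)) (az_res (under_cod Z)) u u_str) uc.
have m_comm : @comp CA _ _ _ m0 (under_str (az_tensor_ob defT W)) = under_str Z.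
  by apply: az_hom_ext => b; rewrite [LHS]uE rmorph1 mulr1.
pose m : @hom (Azumaya_under A) (az_tensor_ob defT W) Z :=
  @UnderHom CA A (az_tensor_ob defT W) Z m0 m_comm.
(* A map under A out of A (x) V is determined by its restriction to V. *)
have fact (V : AzC) (k : @hom (Azumaya_under A) (az_tensor_ob defT V) Z)
    (b : @hom AzC V W) : (forall y, val (under_fun b y : centralizer h) =
      az_fun (under_fun k) (@tinr C (az_alg A) (under_alg V) y)) ->
    k = @comp (Azumaya_under A) _ _ _ m (az_tensor_hom defT b).
  move=> hb; apply: under_hom_ext; apply: az_hom_ext.
  pose k' : {rmorphism tring (az_alg A) (under_alg V) -> az_alg (under_cod Z)} :=
    alg_fun (az_fun (under_fun k)).
  apply: (@tring_eq C (az_alg A) (under_alg V) _ k'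
    (u \o az_tensor_map b : {additive _ -> _})) => y z.
  rewrite /= [az_tensor_map _ _](@tring_map_tten C (az_alg A) _ _ (under_alg_hom b)).
  rewrite uE; apply: etrans (congr1 (fun w => h y * w) (esym (hb z))).
  rewrite -(h_inl V k) -[RHS](rmorphM k').
  by rewrite /tinl /tinr ttenM mulr1 mul1r.
exists W, a, a', m; split; [|exact: fact|exact: fact].
apply: under_hom_ext; apply: az_hom_ext => x; apply: val_inj.
rewrite [LHS]ha [RHS]ha'.
have := congr1 (fun k : @hom (Azumaya_under A) (az_tensor_ob defT X) Z =>
  az_fun (under_fun k) (@tinr C (az_alg A) (under_alg X) x)) e.
rewrite /= [az_tensor_map _ _](@tring_map_tten C (az_alg A) _ _ (under_alg_hom f)).
rewrite [az_tensor_map _ _](@tring_map_tten C (az_alg A) _ _ (under_alg_hom f')).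
by [].
Qed.
End TensorFunctorSpan.

Section TensorFunctorSheaf.
Variables (R : realType) (A : azob R[i]%C).
Local Notation K := (R[i]%C : comPzRingType).
Variable defT : az_tensor_defined A.
Local Notation C := (az_center A).
Local Notation AzC := (Azumaya_under (comm_az C)).
Local Notation CA := (Azumaya_cat K).
Let U := op_functor (tensor_functor defT).

(** If B -> B' is a witness for S over D, then A (x) B' is one for the image, provided A has
    constant square rank over D. A Zariski refinement of D achieves this. *)
Lemma tensor_cover (X : Azufine_under (comm_az C)) (S : arrows X) :
  maximal_flat_under S -> @maximal_flat_under K A (U X) (image_sieve U S).
Proof.
move=> [sS [sL [sM JM]]]; split; first exact: image_sieveP.
pose L' : @arrows (Azufine K) (az_tensor_cod defT X) :=
  image_sieve (Azufine_forget A) (image_sieve U S).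
have sL' : is_sieve L'.
  exact: (@image_sieveP _ _ (Azufine_forget A) (U X) (image_sieve U S)).
have sM' := maximal_flat_arrows_sieve sL'.
split=> //; split=> //.
have tJ := generated_topology (@flat_covers K).
have [c sc] := @center_map C (az_center (under_cod X)) (az_alg (under_cod X))
  (alg_fun (az_fun (under_str X))) (@under_ring_central _ _ X) (az_azumaya _).
have [n [x [l [T [d [db sumd hd]]]]]] := azumaya_locally_square (az_azumaya A).
(* Refine each D by inverting the images of the d_s, which sum to 1. *)
apply: (top_trans tJ JM) => // D f Mf.
have /choice [Ls hLs] (s : T) : exists Ls : {L : comPzRingType & {rmorphism fp_ring D -> L}},
    is_localization (powers (fp_hom f (c (d s)))) (projT2 Ls).
  have [L [i iL]] := localization_exists (powers_closed (fp_hom f (c (d s)))).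
  by exists (existT _ L i).
pose Ds s : affine K := @FpCAlg K (projT1 (Ls s)) _
  (fp_comp (fp_presented D) (localization_fp (hLs s))).
pose k s : @hom (affine K) (Ds s) D := @fp_arrow K D (Ds s) (projT2 (Ls s)) (fun=> erefl).
apply: (topology_sup tJ (S := sieve_of_family k)).
- apply: zariski_flat; exists (fun s => fp_hom f (c (d s))); split=> //.
  exists (index_enum T), (fun=> 1).
  under eq_bigr do rewrite mul1r.
  by rewrite -!rmorph_sum sumd !rmorph1.
- exact: is_sieve_pullback.
move=> Z _ [s [g0 ->]]; rewrite /pullback_sieve comp_assoc; apply: sM'.
have [cdB [B' [azB' [g [h [cdB' hg [Y [fY [gY [SY hE]]]]]]]]]] := sM _ _ _ (k s) Mf.
set f2 := comp f (k s) in cdB g hg *.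
have [u us] : exists u, u * fp_hom f2 (c (d s)) = 1.
  apply: (loc_unit (hLs s)); by exists 1%N; rewrite expr1.
have [r hr] := hd s (Ds s) [the {rmorphism C -> Ds s} of fp_hom f2 \o c]
  (ex_intro _ u us).
have h_str := @base_change_arrow_str (az_center (under_cod X)) (Ds s)
  (az_alg (under_cod X)) (fp_hom f2) B' g h hg.
pose X' : AzC := @UnderOb CA (comm_az C) (@AzOb K (Ds s) B' azB')
  (@az_comp K _ _ _ h (under_str X)).
pose hX : @hom AzC X X' := @UnderHom CA (comm_az C) X X' h erefl.
(* The witness h factors through an arrow of S after forgetting C. With the structure map from C
   carried along, the factorization takes place in the comma category, so h belongs to S. *)
have SX : S X' hX.
  have gY_comm : @comp CA _ _ _ gY (under_str Y) = under_str X'.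
    rewrite -(under_comm fY) [LHS](@comp_assoc CA).
    by rewrite -[under_str X']/(@comp CA _ _ _ h (under_str X)) hE.
  pose gY' : @hom AzC Y X' := @UnderHom CA (comm_az C) Y X' gY gY_comm.
  have -> : hX = @comp (Azufine_under (comm_az C)) _ _ _ fY gY'.
    exact: under_hom_ext.
  exact: sS.
split.
  apply: (@tensor_constant_degree C _ (az_alg A) (az_alg (under_cod X)) _
    (@under_ring_central _ _ X) c sc _ x l db (az_azumaya _) _ _ r) => //.
have phi_str e : az_tensor_map hX (alg_str (az_tensor X) e) =
    alg_str (az_tensor X') (fp_hom f2 e).
  rewrite [LHS](@tring_map_tten C (az_alg A) _ _ (under_alg_hom hX)).
  by congr tten; exact: h_str.
have [g' g'E] := @base_change_lift (az_center (under_cod X)) (Ds s)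
  (az_tensor X) (fp_hom f2) (az_tensor X') (az_tensor_map hX) phi_str.
exists (az_tensor X'), (defT.1 X'), g', (az_tensor_arr defT hX); split.
- apply: (@tensor_constant_degree_self C _ (az_alg A) B' _
    (@under_ring_central _ _ X') [the {rmorphism C -> Ds s} of fp_hom f2 \o c]
    _ _ x l db azB' r) => // y.
  by rewrite -[RHS]h_str -sc.
- by move=> b; rewrite g'E.
- exists (U X'), (fmap U hX), (idm _); split; last exact/esym/(@comp_idl CA).
  by exists X', hX, (idm _); split=> //; rewrite comp_idr.
Qed.

Lemma tensor_with_A_sheaf (F : presheaf (Azufine_under A)) :
  is_sheaf (@maximal_flat_under K A) F ->
  is_sheaf (@maximal_flat_under K (comm_az C)) (tensor_with_A defT F).
Proof.
move=> sF X S JS.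
apply: (@sheaf_condition_precomp _ _ U F _ X S sF JS.1 (tensor_cover JS)).
by move=> Z Y Y' f f' g g' _ _; exact: tensor_span.
Qed.
End TensorFunctorSheaf.

(** * Merging two algebras under B *)

Lemma az_hom_on_center (K : comPzRingType) (B B' : azob K) (h : az_hom B B') :
  exists f : alg_hom (fp_alg (az_center B)) (fp_alg (az_center B')),
    forall e, h (alg_str (az_alg B) e) = alg_str (az_alg B') (f e).
Proof.
have hc e (x : az_alg B') : GRing.comm (h (alg_str (az_alg B) e)) x.
  by apply: (@az_fun_center K B B' h); exact: (@str_central _ (az_alg B)).
pose s : {rmorphism fp_ring (az_center B) -> az_alg B'} :=
  [the {rmorphism _ -> _} of alg_fun h \o alg_str (az_alg B)].
have [c cE] := @center_map _ (az_center B') (az_alg B') s hc (az_azumaya B').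
have c_str k : c (alg_str (fp_alg (az_center B)) k) = alg_str (fp_alg (az_center B')) k.
  have [d] := azumaya_has_data (az_azumaya B').
  apply: (ad_str_inj d); rewrite -cE; exact: (alg_fun_str h k).
by exists (@AlgHom K (fp_alg (az_center B)) (fp_alg (az_center B')) c c_str).
Qed.

Section Merge.
Variables (K : comPzRingType) (B B1 B2 : azob K).
Variables (h1 : az_hom B B1) (h2 : az_hom B B2) (d : azumaya_data (az_alg B)).
Variables (f1 : az_center B -> az_center B1) (f2 : az_center B -> az_center B2).
Variable k : alg_hom (fp_alg (az_center B1)) (fp_alg (az_center B2)).
Hypothesis h1_str : forall e, h1 (alg_str (az_alg B) e) = alg_str (az_alg B1) (f1 e).
Hypothesis h2_str : forall e, h2 (alg_str (az_alg B) e) = alg_str (az_alg B2) (f2 e).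
Hypothesis kf : forall e, f2 e = k (f1 e).

Local Notation E1 := (az_center B1).
Local Notation CA := (Azumaya_cat K).

Let H1 : {rmorphism az_alg B -> az_alg B1} := alg_fun (az_fun h1).
Let H2 : {rmorphism az_alg B -> az_alg B2} := alg_fun (az_fun h2).

Let s : {rmorphism E1 -> az_alg B2} :=
  [the {rmorphism _ -> _} of alg_str (az_alg B2) \o k].
Let s_str c : s (alg_str (az_res (comm_az E1)) c) = alg_str (az_res B2) c.
Proof. exact: (congr1 (alg_str (az_alg B2)) (alg_fun_str k c)). Qed.
Let s_hom : az_hom (comm_az E1) B2 :=
  @AzHom K (comm_az E1) B2 (@AlgHom K (az_res (comm_az E1)) (az_res B2) s s_str)
    (fun z _ => @str_central _ (az_alg B2) (k z)).
Let Y : Azumaya_under (comm_az E1) := @UnderOb CA (comm_az E1) B2 s_hom.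
Let M : azob K := az_tensor_cod (azumaya_tensor_defined B1) Y.
Let u : az_hom B1 M := under_str (az_tensor_ob (azumaya_tensor_defined B1) Y).
Let BY : alg E1 := under_alg Y.

Let act j (y : az_alg B2) : az_alg B2 := bimod_act H2 (ad_e d j) y.
Let H2c c y : GRing.comm (H2 (alg_str (az_alg B) c)) y.
Proof. by rewrite [H2 _]h2_str; exact: alg_central. Qed.
Let actC j y b : GRing.comm (H2 b) (act j y).
Proof. by apply: bimod_actC => c; exact: H2c. Qed.
Let decomp y : y = \sum_j H2 (ad_x d j) * act j y.
Proof. by rewrite (bimod_act_decomp d (fun c => H2c c y)). Qed.

(** B_2 is B times its centralizer, and v sends h2(b) w to h1(b) (x) w. This makes it agree on B
    with the inclusion of B_1, as y -> 1 (x) y would not. *)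
Let v (y : az_alg B2) : tring (az_alg B1) BY :=
  \sum_j @tten E1 (az_alg B1) BY (H1 (ad_x d j)) (act j y).

Let scale e a b : @tten E1 (az_alg B1) BY (H1 (alg_str (az_alg B) e) * a) b =
  @tten E1 (az_alg B1) BY a (H2 (alg_str (az_alg B) e) * b).
Proof. by rewrite [H1 _]h1_str (@ttenZ E1 (az_alg B1) BY) [H2 _]h2_str kf. Qed.

Let v_mul a w : (forall b, GRing.comm (H2 b) w) ->
  v (H2 a * w) = @tten E1 (az_alg B1) BY (H1 a) w.
Proof.
move=> hw; rewrite /v [a in RHS](ad_decomp d) rmorph_sum tten_suml.
by apply: eq_bigr => j _; rewrite /act bimod_act_lin // rmorphM scale.
Qed.

Let v_comm w : (forall b, GRing.comm (H2 b) w) -> v w = @tten E1 (az_alg B1) BY 1 w.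
Proof. by move=> /(v_mul 1); rewrite !rmorph1 mul1r. Qed.

Let vD : {morph v : x y / x + y}.
Proof.
move=> x y; rewrite -big_split; apply: eq_bigr => j _.
by rewrite /act bimod_actD (@ttenDr E1 (az_alg B1) BY).
Qed.
Let v0 : v 0 = 0. Proof. by apply: (addrI (v 0)); rewrite -vD !addr0. Qed.

Let vM : {morph v : x y / x * y}.
Proof.
move=> x y; rewrite [x in LHS]decomp [y in LHS]decomp mulr_suml (big_morph _ vD v0).
rewrite [RHS]mulr_suml; apply: eq_bigr => i _.
rewrite mulr_sumr (big_morph _ vD v0) [RHS]mulr_sumr; apply: eq_bigr => j _.
rewrite [RHS](@ttenM E1 (az_alg B1) BY) -rmorphM -v_mul.
  rewrite rmorphM; congr v; rewrite -!mulrA; congr (_ * _).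
  by rewrite !mulrA (actC i x (ad_x d j)).
by move=> b; apply: commrM; exact: actC.
Qed.

Let v1 : v 1 = 1.
Proof. by rewrite v_comm // => b; exact: commr1. Qed.

Let v_scalar e : v (alg_str (az_alg B2) e) = alg_str (az_alg M) e.
Proof. by rewrite v_comm // => b; exact/commr_sym/alg_central. Qed.

Let v_hom : az_hom B2 M.
Proof.
apply: (@AzHom K B2 M (@AlgHom K (az_res B2) (az_res M) (rmorph_of vD vM v1) _)).
  by move=> c; exact: v_scalar.
move=> v_str z /(az_central_str (az_azumaya B2)) [e ->].
rewrite [X in central X]v_scalar; exact: (@str_central _ (az_alg M)).
Defined.

Let uv : az_comp u h1 = az_comp v_hom h2.
Proof.
apply: az_hom_ext => b; have e := @v_mul b 1 (fun c => commr1 (H2 c)).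
by rewrite mulr1 in e; exact: esym e.
Qed.

Let contract (l : {additive az_alg B1 -> E1}) :
  (forall e a, l (alg_str (az_alg B1) e * a) = e * l a) ->
  exists g : {additive tring (az_alg B1) BY -> az_alg B2},
    forall a b, g (tten a b) = alg_str (az_alg B2) (k (l a)) * b.
Proof.
move=> lZ; apply: (@tring_additive E1 (az_alg B1) BY _
  (fun a b => alg_str (az_alg B2) (k (l a)) * b)).
- by move=> a a' b; rewrite !raddfD mulrDl.
- by move=> a b b'; rewrite mulrDr.
- by move=> e a b; rewrite lZ !rmorphM mulrA -!rmorphM mulrC.
Qed.

(** If y1 and y2 become equal in B_1 (x) B_2, then (e_j y1) (x) 1 = 1 (x) (e_j y2). Contracting the
    first factor by m shows that e_j y2 is a scalar. Contracting by l_j instead compares coordinates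
    of elements of B_1. *)
Lemma merge_exists (d1 : azumaya_data (az_alg B1)) :
  exists (N : azob K) (p : az_hom B1 N) (q : az_hom B2 N),
  [/\ az_comp p h1 = az_comp q h2,
    forall j (y1 : az_alg B1) (y2 : az_alg B2), p y1 = q y2 ->
      bimod_act h2 (ad_e d j) y2 =
      alg_str (az_alg B2) (k (ad_m d1 (bimod_act h1 (ad_e d j) y1)))
    & forall j (y y' : az_alg B1), p y = p y' -> k (ad_l d1 j y) = k (ad_l d1 j y')].
Proof.
exists M, u, v_hom; split=> // [j y1 y2 e|j y y' e].
- have [g gE] := contract (ad_mZ d1).
  have e' : @tten E1 (az_alg B1) BY (bimod_act H1 (ad_e d j) y1) 1 =
      @tten E1 (az_alg B1) BY 1 (act j y2).
    rewrite -v_comm; last by move=> b; exact: actC.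
    rewrite /act (big_morph _ vD v0) -[LHS]/(u _) rmorph_sum.
    apply: eq_bigr => p _; rewrite !rmorphM !vM.
    have uvE b : u (H1 b) = v (H2 b).
      exact: (congr1 (fun m : az_hom B M => m b) uv).
    by rewrite !uvE [u y1]e.
  have := congr1 g e'; rewrite !gE mulr1 ad_m1 !rmorph1 mul1r.
  by move/esym.
- have [g gE] := contract (@ad_lZ _ _ d1 j).
  have [d2] := azumaya_has_data (az_azumaya B2).
  apply: (ad_str_inj d2); have := congr1 g e.
  by rewrite [g _]gE [RHS]gE !mulr1.
Qed.
End Merge.

(** * Representations form a sheaf for the maximal flat topology *)

Section RepSheaf.
Variables (K : comPzRingType) (R : alg K) (B : azob K) (L : @arrows (Azufine K) B).
Hypothesis coverL : @maximal_flat_topology K B L.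
Variable x : forall B' (h : @hom (Azufine K) B' B), L h -> Rep R B'.
Hypothesis mx : matching (@x).
Variable d : azumaya_data (az_alg B).

Local Notation E := (az_center B).
Let sL : is_sieve L := coverL.1.
Let J : @flat_topology K E (maximal_flat_arrows L) := coverL.2.2.

Let val_x B' (h : az_hom B B') (Lh : L h) : alg_hom R (az_res B') := x Lh.

Let val_x_comp B' N (h : az_hom B B') (Lh : L h) (p : az_hom B' N)
  (Lp : L (az_comp p h)) r : p (val_x Lh r) = val_x Lp r.
Proof.
exact: (congr1 (fun g : alg_hom R (az_res N) => g r) (mx Lh Lp)).
Qed.

Let val_x_agree B1 B2 N (h1 : az_hom B B1) (h2 : az_hom B B2) (L1 : L h1)
    (L2 : L h2) (p : az_hom B1 N) (q : az_hom B2 N) r :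
  az_comp p h1 = az_comp q h2 -> p (val_x L1 r) = q (val_x L2 r).
Proof.
move=> e; have Lp := sL p L1; have Lq := sL q L2.
rewrite (val_x_comp L1 Lp) (val_x_comp L2 Lq).
exact: (congr1 (fun g : alg_hom R (az_res N) => g r)
  (@section_eq (Azufine K) (Rep R) B L (@x) N _ _ Lp Lq e)).
Qed.

(* The coordinates on B (x)_E D of the section at r. *)
Let coord (D : affine K) (f : @hom (affine K) D E) j r (delta : fp_ring D) :=
  forall (B' : alg (fp_ring D)) (azB' : azumaya B') (h : az_hom B (@AzOb K D B' azB'))
    (Lh : L h), (forall e, h (alg_str (az_alg B) e) = alg_str B' (fp_hom f e)) ->
  bimod_act h (ad_e d j) (val_x Lh r) = alg_str B' delta.

Let arrowP (D : affine K) (f : @hom (affine K) D E) : maximal_flat_arrows L f ->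
  exists (B' : alg (fp_ring D)) (azB' : azumaya B')
    (h : az_hom B (@AzOb K D B' azB')) (Lh : L h),
    forall e, h (alg_str (az_alg B) e) = alg_str B' (fp_hom f e).
Proof.
move=> [_ [B' [azB' [g [h [_ hg Lh]]]]]]; exists B', azB', h, Lh.
exact: (@base_change_arrow_str _ _ (az_alg B) (fp_hom f) B' g h hg).
Qed.

(** The scalar is read off in one algebra B_1 over D; merging B_1 with any other B_2 over D shows
    that B_2 gives the same one. *)
Let coord_exists (D : affine K) (f : @hom (affine K) D E) j r :
  maximal_flat_arrows L f -> exists delta, coord f j r delta.
Proof.
move=> /arrowP [B1 [azB1 [h1 [L1 h1_str]]]]; have [d1] := azumaya_has_data azB1.
exists (ad_m d1 (bimod_act h1 (ad_e d j) (val_x L1 r))).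
move=> B2 azB2 h2 L2 h2_str.
have [N [p [q [e hact _]]]] := @merge_exists K B (@AzOb K D B1 azB1)
  (@AzOb K D B2 azB2) h1 h2 d (fp_hom f) (fp_hom f) (alg_id _) h1_str h2_str
  (fun=> erefl) d1.
exact/hact/val_x_agree.
Qed.

Let coord_comp (D D' : affine K) (f : @hom (affine K) D E) (g : @hom (affine K) D' D)
    j r delta : maximal_flat_arrows L f ->
  coord f j r delta -> coord (comp f g) j r (fp_hom g delta).
Proof.
move=> /arrowP [B1 [azB1 [h1 [L1 h1_str]]]] hd B2 azB2 h2 L2 h2_str.
have [d1] := azumaya_has_data azB1.
have [N [p [q [e hact _]]]] := @merge_exists K B (@AzOb K D B1 azB1)
  (@AzOb K D' B2 azB2) h1 h2 d (fp_hom f) (fp_hom (comp f g)) g h1_str h2_str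
  (fun=> erefl) d1.
rewrite (hact j _ _ (val_x_agree L1 L2 r e)) (hd _ _ _ L1 h1_str).
by rewrite -[alg_str B1 delta]mulr1 ad_mZ ad_m1 mulr1.
Qed.

Let coord_unique (D : affine K) (f : @hom (affine K) D E) j r delta delta' :
  maximal_flat_arrows L f ->
  coord f j r delta -> coord f j r delta' -> delta = delta'.
Proof.
move=> /arrowP [B1 [azB1 [h1 [L1 h1_str]]]] hd hd'.
have [d1] := azumaya_has_data azB1; apply: (ad_str_inj d1).
by rewrite -(hd _ _ _ L1 h1_str) -(hd' _ _ _ L1 h1_str).
Qed.

(** Local coordinates are unique and stable under base change, so they form a matching family of
    functions on a flat cover of E. *)
Let coord_global : exists a : ad_index d -> R -> fp_ring E,
  forall j r (D : affine K) (f : @hom (affine K) D E),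
    maximal_flat_arrows L f -> coord f j r (fp_hom f (a j r)).
Proof.
have glue (jr : ad_index d * R) : exists a : fp_ring E,
    forall (D : affine K) (f : @hom (affine K) D E),
    maximal_flat_arrows L f -> coord f jr.1 jr.2 (fp_hom f a).
  case: jr => j r /=.
  pose y (D : affine K) (f : @hom (affine K) D E)
      (Mf : maximal_flat_arrows L f) : fp_ring D :=
    sval (cid (coord_exists j r Mf)).
  have yP (D : affine K) (f : @hom (affine K) D E) Mf : coord f j r (y D f Mf) by rewrite /y; case: cid.
  have [D D' f g Mf Mfg|a ha] := flat_glue (y := y) J.
    apply: (coord_unique Mfg) => //; exact: coord_comp.
  by exists a => D f Mf; rewrite (ha D f Mf).
have [a ha] := choice glue.
by exists (fun j r => a (j, r)) => j r D f Mf; exact: (ha (j, r)).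
Qed.

(** The coordinates l_j(b) are elements of E, hence detected on the flat cover. *)
Let separated (b b' : az_alg B) :
  (forall (D : affine K) (f : @hom (affine K) D E) (B' : alg (fp_ring D))
    (azB' : azumaya B') (h : az_hom B (@AzOb K D B' azB')),
    maximal_flat_arrows L f -> L h ->
    (forall e, h (alg_str (az_alg B) e) = alg_str B' (fp_hom f e)) -> h b = h b') ->
  b = b'.
Proof.
move=> bb'; apply: (ad_l_inj (d := d)) => j; apply: (flat_separated J) => D f Mf.
have [B1 [azB1 [h1 [L1 h1_str]]]] := arrowP Mf; have [d1] := azumaya_has_data azB1.
apply: (ad_str_inj d1); rewrite -!h1_str.
pose H : {rmorphism az_alg B -> B1} := alg_fun (az_fun h1).
rewrite -[LHS](bimod_act_morph H b j) -[RHS](bimod_act_morph H b' j).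
by rewrite [H b](bb' D f B1 azB1 h1 Mf L1 h1_str).
Qed.

Lemma Rep_glue : exists! y : Rep R B,
  forall B' (h : @hom (Azufine K) B' B) (Lh : L h), restr (Rep R) h y = x Lh.
Proof.
have [a ha] := coord_global.
(* The section is rebuilt from its coordinates. It agrees locally with the family by
   [bimod_act_decomp], and its morphism laws are checked locally. *)
pose y r : az_alg B := \sum_j alg_str (az_alg B) (a j r) * ad_x d j.
have y_local (D : affine K) (f : @hom (affine K) D E) (B' : alg (fp_ring D))
    (azB' : azumaya B') (h : az_hom B (@AzOb K D B' azB')) (Lh : L h) r :
    (forall e, h (alg_str (az_alg B) e) = alg_str B' (fp_hom f e)) ->
    maximal_flat_arrows L f -> h (y r) = val_x Lh r.
  move=> h_str Mf; pose H : {rmorphism az_alg B -> B'} := alg_fun (az_fun h).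
  have Hc c z : GRing.comm (H (alg_str (az_alg B) c)) z.
    by rewrite [H _]h_str; exact: alg_central.
  rewrite -[RHS](bimod_act_decomp d (fun c => Hc c (val_x Lh r))).
  rewrite -[LHS]/(H (y r)) rmorph_sum; apply: eq_bigr => j _.
  rewrite rmorphM [H (alg_str _ _)]h_str.
  have /= <- := ha j r D f Mf B' azB' h Lh h_str.
  by apply/esym; apply: bimod_actC => c; exact: Hc.
have yD : {morph y : r s / r + s}.
  move=> r s; apply: separated => D f B' azB' h Mf Lh h_str.
  by rewrite rmorphD !(y_local D f B' azB' h Lh) // rmorphD.
have yM : {morph y : r s / r * s}.
  move=> r s; apply: separated => D f B' azB' h Mf Lh h_str.
  by rewrite rmorphM !(y_local D f B' azB' h Lh) // rmorphM.
have y1 : y 1 = 1.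
  apply: separated => D f B' azB' h Mf Lh h_str.
  by rewrite (y_local D f B' azB' h Lh) // !rmorph1.
have y_str k : rmorph_of yD yM y1 (alg_str R k) = alg_str (az_res B) k.
  apply: separated => D f B' azB' h Mf Lh h_str.
  rewrite [LHS](y_local D f B' azB' h Lh) // alg_fun_str.
  exact/esym/(alg_fun_str h k).
exists (@AlgHom K R (az_res B) (rmorph_of yD yM y1) y_str); split=> [B1 h1 L1|z hz].
  apply: alg_hom_ext => r; have [f1 f1E] := az_hom_on_center h1.
  have [d1] := azumaya_has_data (az_azumaya B1).
  apply: (ad_l_inj (d := d1)) => j.
  (* For an arbitrary h1 in L, the cover is pulled back to the center of B1, and h1 is compared
     there with local witnesses B2 in a merged algebra. *)
  have J1 := top_pullback (generated_topology (@flat_covers K))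
    (f1 : @hom (affine K) (az_center B1) E) J.
  apply: (flat_separated J1) => D k Mk.
  have [B2 [azB2 [h2 [L2 h2_str]]]] := arrowP Mk.
  have [N [p [q [e _ hl]]]] := @merge_exists K B B1 (@AzOb K D B2 azB2) h1 h2 d
    f1 (fp_hom (comp (f1 : @hom (affine K) (az_center B1) E) k)) k f1E h2_str
    (fun=> erefl) d1.
  apply: hl; rewrite [RHS](val_x_agree L1 L2 r e).
  rewrite -(y_local _ _ _ _ _ L2 r h2_str Mk).
  exact: (congr1 (fun g : az_hom B N => g (y r)) e).
apply: alg_hom_ext => r; apply: separated => D f B' azB' h Mf Lh h_str.
rewrite [LHS](y_local D f B' azB' h Lh r h_str Mf).
exact: (congr1 (fun g : alg_hom R _ => g r) (esym (hz _ h Lh))).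
Qed.
End RepSheaf.

Lemma Rep_sheaf (K : comPzRingType) (R : alg K) :
  is_sheaf (@maximal_flat_topology K) (Rep R).
Proof.
move=> B L coverL x mx; have [d] := azumaya_has_data (az_azumaya B).
exact: Rep_glue.
Qed.

(** * Identification of the image of [Rep] and conclusion *)

Lemma presheaf_ext (C : category) (S : C -> Type)
    (r r' : forall X Y, @hom C Y X -> S X -> S Y) i i' c c' :
  (forall X Y f x, r X Y f x = r' X Y f x) ->
  @Presheaf C S r i c = @Presheaf C S r' i' c'.
Proof.
move=> rr'; have {rr'} e : r = r'.
  apply: functional_extensionality_dep => X; apply: functional_extensionality_dep => Y.
  by apply/funext => f; apply/funext => x.
by subst r'; rewrite (Prop_irrelevance i i') (Prop_irrelevance c c').
Qed.

(* The two presheaves of [Rep_image] tensor A with the same rings and maps,     *)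
(* seen as C-algebras by different proofs of centrality.                      *)
Section RepImage.
Variables (K : comPzRingType) (R : alg K) (A : azob K).
Local Notation C := (az_center A).
Variable p : forall (D : fpcalg C) c x, GRing.comm (fp_str D c) x.

Let V (D : fpcalg C) : alg C := @Alg C D (fp_str D) (@p D).
Let Vmap (D D' : fpcalg C) (f : alg_hom (fp_alg D) (fp_alg D')) :
  alg_hom (V D) (V D') := @AlgHom C (V D) (V D') (alg_fun f) (alg_fun_str f).

Let T (D : fpcalg C) : alg K :=
  res_alg (res_str D) (@tensor_alg C D (az_alg A) (V D)
    [the {rmorphism D -> D} of idfun] (@self_central D)).

Let T_str (D D' : fpcalg C) (f : alg_hom (fp_alg D) (fp_alg D')) k :
  @tring_map C (az_alg A) _ _ (Vmap f) (alg_str (T D) k) = alg_str (T D') k.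
Proof.
by rewrite /= /tinr tring_map_tten; congr tten; exact: (alg_fun_str f (fp_str C k)).
Qed.

Let Tmap (D D' : fpcalg C) (f : alg_hom (fp_alg D) (fp_alg D')) :
    alg_hom (T D) (T D') :=
  @AlgHom K (T D) (T D')
    [the {rmorphism tring (az_alg A) (V D) -> tring (az_alg A) (V D')}
      of tring_map (Vmap f)] (T_str f).

Definition Rep_with : presheaf (affine C).
Proof.
refine (@Presheaf (affine C) (fun D : fpcalg C => alg_hom R (T D))
  (fun (D D' : fpcalg C) (f : alg_hom (fp_alg D) (fp_alg D')) x =>
     alg_comp (Tmap f) x) _ _).
- by move=> D x; apply: alg_hom_ext => r; exact: tring_map_id.
- by move=> D D' D'' f g x; apply: alg_hom_ext => r; exact: tring_map_comp.
Defined.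
End RepImage.

Lemma Rep_image (K : comPzRingType) (R : alg K) (A : azob K)
    (defT : az_tensor_defined A) (defI : fp_res_defined (az_center A)) :
  restrict_to_affine defI (tensor_with_A defT (restrict_to_A A (Rep R))) =
  Rep_at R A.
Proof.
pose p D := @under_ring_central K A (incl_ob defI D).
pose q D := @comm_alg_central (az_center A) (fp_ring D) (fp_str D).
(* With the centrality proof abstracted, [p] can be exchanged for [q] by proof irrelevance, which
   gives an equality of presheaves. *)
transitivity (@Rep_with K R A p).
  by apply: presheaf_ext => X Y f x; exact: alg_hom_ext.
rewrite (Prop_irrelevance p q).
by apply: presheaf_ext => X Y f x; exact: alg_hom_ext.
Qed.

Theorem proposition5p3 (Rr : realType) (R : alg Rr[i]%C)
    (fgR : finitely_generated R) (A : azob Rr[i]%C) :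
  is_sheaf (@maximal_flat_topology Rr[i]%C) (Rep R) /\
  exists (defT : az_tensor_defined A) (defI : fp_res_defined (az_center A)),
    (forall F : presheaf (Azufine Rr[i]%C),
       is_sheaf (@maximal_flat_topology Rr[i]%C) F ->
       is_sheaf (@maximal_flat_under _ A) (restrict_to_A A F)) /\
    (forall F : presheaf (Azufine_under A),
       is_sheaf (@maximal_flat_under _ A) F ->
       is_sheaf (@maximal_flat_under _ (comm_az (az_center A)))
         (tensor_with_A defT F)) /\
    (forall F : presheaf (Azufine_under (comm_az (az_center A))),
       is_sheaf (@maximal_flat_under _ (comm_az (az_center A))) F ->
       is_sheaf (@flat_topology (az_center A)) (restrict_to_affine defI F)) /\
    restrict_to_affine defI (tensor_with_A defT (restrict_to_A A (Rep R))) =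
      Rep_at R A /\
    is_sheaf (@flat_topology (az_center A)) (Rep_at R A) /\
    is_sheaf (@etale_topology (az_center A)) (Rep_at R A) /\
    is_sheaf (@zariski_topology (az_center A)) (Rep_at R A).
Proof.
have RepS := @Rep_sheaf _ R.
have defT := azumaya_tensor_defined A.
have defI := @fp_res_defined_holds _ (az_center A).
(* Being the image of the sheaf [Rep R], it is a sheaf because each of the three functors preserves
   sheaves. *)
have flatS : is_sheaf (@flat_topology (az_center A)) (Rep_at R A).
  rewrite -(Rep_image R defT defI).
  apply: restrict_to_affine_sheaf; apply: tensor_with_A_sheaf.
  exact: restrict_to_A_sheaf.
split=> //; exists defT, defI; split; first by move=> F; exact: restrict_to_A_sheaf.
split; first by move=> F; exact: tensor_with_A_sheaf.
split; first by move=> F; exact: restrict_to_affine_sheaf.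
split; first exact: Rep_image.
split=> //; split.
- by apply: is_sheafW flatS => X S; exact: etale_le_flat.
- by apply: is_sheafW flatS => X S; exact: zariski_le_flat.
Qed.
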